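(* Let $(S,d)$ be a separable complete metric space, and take $\sigma$ to be the topology induced by $d$. Let $\phi,\phi_\epsilon:S\to(-\infty,+\infty]$ ($\epsilon>0$) be such that: there exist $A,B>0$, $u_\star\in S$ with $\phi_\epsilon(\cdot)\ge-A-Bd^2(\cdot,u_\star)$ for all $\epsilon>0$; for every $\epsilon_n\to0$ and $u_n\in S$ with $\sup_{n,m}\{\phi_{\epsilon_n}(u_n),d(u_n,u_m)\}<+\infty$ some subsequence of $(u_n)$ converges in $S$; and $\phi_\epsilon$ $\Gamma$-converges to $\phi$ as $\epsilon\to0$, i.e. $\liminf_{\epsilon\to0}\phi_\epsilon(u_\epsilon)\ge\phi(u)$ whenever $u_\epsilon\stackrel{d}{\to}u$, and for every $u\in S$ there exist $\tilde u_\epsilon\stackrel{d}{\to}u$ with $\phi_\epsilon(\tilde u_\epsilon)\to\phi(u)$. Then there exists $(\epsilon_\tau)_{\tau>0}$ with $\epsilon_\tau>0$ such that for every choice $(\epsilon(\tau))_{\tau>0}$ with $0<\epsilon(\tau)\le\epsilon_\tau$ and $\epsilon(\tau)\to0$ the following holds: for all $u,u_\tau\in S$ with $u_\tau\stackrel{d}{\to}u$ and $\sup_\tau\{\phi_{\epsilon(\tau)}(u_\tau),d(u_\tau,u)\}<+\infty$, $$\liminf_{\tau\to0}\frac{\phi_{\epsilon(\tau)}(u_\tau)-\mathcal{Y}_\tau\phi_{\epsilon(\tau)}(u_\tau)}{\tau}\ge\frac12|\partial^-\phi|^2(u).$$ In particular, for such a choice $\epsilon(\tau)$, if $u^0\in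 D(\phi)$ and sequences $(u_\tau^n)_{n\ge0}$ satisfy $u_\tau^0\to u^0$, $\phi_{\epsilon(\tau)}(u_\tau^0)\to\phi(u^0)$ and $\phi_{\epsilon(\tau)}(u_\tau^n)+\frac1{2\tau}d^2(u_\tau^n,u_\tau^{n-1})\le\mathcal{Y}_\tau\phi_{\epsilon(\tau)}(u_\tau^{n-1})+\gamma_\tau\tau$ ($n\in\mathbb{N}$) with $\gamma_\tau>0$, $\gamma_\tau\to0$, then for the piecewise constant interpolants $\overline u_\tau$ ($\overline u_\tau(0)=u_\tau^0$, $\overline u_\tau=u_\tau^n$ on $((n-1)\tau,n\tau]$) there exist $\tau_k\downarrow0$ and a locally absolutely continuous $u:[0,+\infty)\to S$ with $\overline u_{\tau_k}(t)\to u(t)$ for all $t\ge0$, $u(0)=u^0$, and $\phi(u(0))-\phi(u(t))\ge\frac12\int_0^t|\partial^-\phi|^2(u)\,ds+\frac12\int_0^t|u'|^2\,ds$ for all $t\ge0$; if moreover $|\partial^-\phi|$ is a strong upper gradient for $\phi$, $u$ is a curve of maximal slope for $\phi$.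
   Context: $D(\phi)=\{\phi<+\infty\}$. Local slope $|\partial\phi|(v)=\limsup_{w\stackrel{d}{\to}v}\frac{(\phi(v)-\phi(w))^+}{d(v,w)}$; relaxed slope (here with $\sigma$ the $d$-topology) $|\partial^-\phi|(u)=\inf\{\liminf_n|\partial\phi|(u_n): u_n\stackrel{d}{\to}u,\ \sup_n\{d(u_n,u),\phi(u_n)\}<+\infty\}$; $\mathcal{Y}_\tau f(u)=\inf_{v\in S}\{f(v)+\frac1{2\tau}d^2(v,u)\}$; $|u'|$ the metric derivative. Strong upper gradient: for every absolutely continuous $v$, $|\partial^-\phi|\circ v$ is Borel and $|\phi(v(t))-\phi(v(s))|\le\int_s^t|\partial^-\phi|(v)|v'|$. Curve of maximal slope: locally absolutely continuous $u$ with $\phi(u(s))-\phi(u(t))\ge\frac12\int_s^t|\partial^-\phi|^2(u)+\frac12\int_s^t|u'|^2$ for a.e. $s\le t$. The initial-value condition also requires $\sup_\tau d(u_\tau^0,u^0)<\infty$, automatic for a convergent family as $\tau\to0$ in the limit. *)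

(* Defs.v *)
From HB Require Import structures.
From mathcomp Require Import all_boot all_order all_algebra.
From mathcomp Require Import all_classical all_reals all_analysis.
From mathcomp Require Import measurable_realfun.
Set Implicit Arguments. Unset Strict Implicit. Unset Printing Implicit Defensive.
Import Order.TTheory GRing.Theory Num.Theory.
Import numFieldNormedType.Exports.
Local Open Scope classical_set_scope.
Local Open Scope ring_scope.

Section Defs.
Variables (R : realType) (S : Type) (d : S -> S -> R).

Definition metric_space : Prop :=
  [/\ (forall u v, 0 <= d u v),
      (forall u v, d u v = 0 <-> u = v),
      (forall u v, d u v = d v u) &
      (forall u v w, d u w <= d u v + d v w)].

Definition complete_metric : Prop :=
  forall x : nat -> S,
    (forall e : R, 0 < e -> exists N : nat, forall n m : nat,
        (N <= n)%N -> (N <= m)%N -> d (x n) (x m) < e) ->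
    exists l : S, (fun n => d (x n) l) @ \oo --> 0.

Definition separable_metric : Prop :=
  exists D : set S, countable D /\
    forall (u : S) (e : R), 0 < e -> exists v, D v /\ d u v < e.

Local Open Scope ereal_scope.

(** local slope |dphi|(v) = limsup_{w -> v} (phi v - phi w)^+ / d(v,w)
    (the 0 in the inner sup is the usual convention giving slope 0 at isolated points) *)
Definition local_slope (phi : S -> \bar R) (v : S) : \bar R :=
  ereal_inf [set ereal_sup ([set 0] `|`
     [set maxe (phi v - phi w) 0 * ((d v w)^-1)%:E | w in [set w | 0 < d v w < r]%R])
   | r in [set r : R | (0 < r)%R]].

Definition relaxed_slope (phi : S -> \bar R) (u : S) : \bar R :=
  ereal_inf [set limn_einf (fun n => local_slope phi (un n)) |
    un in [set un : nat -> S |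
      ((fun n => d (un n) u) @ \oo --> 0%R) /\
      exists C : R, forall n, (d (un n) u <= C)%R /\ phi (un n) <= C%:E]].

Definition yosida (tau : R) (f : S -> \bar R) (u : S) : \bar R :=
  ereal_inf [set f v + ((d v u ^+ 2) / (2 * tau))%:E | v in [set: S]].

Definition metric_deriv (I : set R) (u : R -> S) (t : R) : \bar R :=
  ereal_inf [set ereal_sup ([set 0] `|`
     [set ((d (u s) (u t)) / `|s - t|)%:E | s in [set s | I s /\ 0 < `|s - t| < r]%R])
   | r in [set r : R | (0 < r)%R]].

Definition abs_cont (I : set R) (u : R -> S) : Prop :=
  exists m : R -> R,
    (lebesgue_measure).-integrable I (fun r => (m r)%:E) /\
    forall s t, I s -> I t -> (s <= t)%R ->
      (d (u s) (u t))%:E <= \int[lebesgue_measure]_(r in `[s, t]) (m r)%:E.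

Definition loc_abs_cont (u : R -> S) : Prop :=
  exists m : R -> R,
    (forall a b : R, (0 <= a)%R ->
       (lebesgue_measure).-integrable `[a, b] (fun r => (m r)%:E)) /\
    forall s t : R, (0 <= s)%R -> (s <= t)%R ->
      (d (u s) (u t))%:E <= \int[lebesgue_measure]_(r in `[s, t]) (m r)%:E.

Definition strong_upper_gradient (phi : S -> \bar R) (g : S -> \bar R) : Prop :=
  forall (a b : R) (v : R -> S), (a < b)%R -> abs_cont `]a, b[ v ->
    measurable_fun `]a, b[ (g \o v) /\
    forall s t : R, (a < s)%R -> (s <= t)%R -> (t < b)%R ->
      let I := \int[lebesgue_measure]_(r in `[s, t]) (g (v r) * metric_deriv `]a, b[ v r) in
      phi (v t) <= phi (v s) + I /\ phi (v s) <= phi (v t) + I.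

Definition curve_max_slope (phi : S -> \bar R) (u : R -> S) : Prop :=
  loc_abs_cont u /\
  exists N : set R, measurable N /\ lebesgue_measure N = 0 /\
    forall s t : R, (0 <= s)%R -> (s <= t)%R -> ~ N s -> ~ N t ->
      phi (u t)
      + ((2^-1)%:E * \int[lebesgue_measure]_(r in `[s, t]) (relaxed_slope phi (u r)) ^+ 2
         + (2^-1)%:E * \int[lebesgue_measure]_(r in `[s, t])
                           (metric_deriv `[0%R, +oo[%classic u r) ^+ 2)
      <= phi (u s).

End Defs.

(** piecewise constant interpolant: ubar(0) = U 0, ubar = U n on ((n-1)tau, n tau] *)
Definition pc_interp (R : realType) (S : Type) (tau : R) (U : nat -> S) (t : R) : S :=
  U `|Num.ceil (t / tau)|%N.

(* Main.v *)
Require Import Defs.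
From HB Require Import structures.
From mathcomp Require Import all_boot all_order all_algebra.
From mathcomp Require Import all_classical all_reals all_analysis.
From mathcomp Require Import measurable_realfun.
From mathcomp Require Import ring lra.
Set Implicit Arguments. Unset Strict Implicit. Unset Printing Implicit Defensive.
Import Order.TTheory GRing.Theory Num.Theory.
Import numFieldNormedType.Exports.
Local Open Scope classical_set_scope.
Local Open Scope ring_scope.

(** By Gamma-convergence and compactness, for [e] small with respect to [tau] every [w] in a
    bounded sublevel of [phie e] has a neighbour [w'] with
    [phi w' <= phie e w + tau^2] and [Y_tau (phie e) w <= Y_tau phi w' + tau^2]; this fixes
    [epsT] and reduces the first assertion to the fixed functional [phi]. For [phi], if
    [phi w - Y_tau phi w <= lam tau], then, since [Y_r phi w] decreases in [r] at rate
    [d(z_r, w)^2 / (2 r^2)], some minimizer [z_r] with [r <= tau] satisfies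
    [d(z_r, w)^2 <= 2 lam' r^2] for any [lam' > lam], and its local slope is at most
    [d(z_r, w) / r].

    For the scheme, summing the discrete energy inequality and a discrete Gronwall argument
    give a uniform 1/2-Hoelder estimate, hence a limit curve [u] on a subsequence. The three
    terms of the discrete inequality are lower semicontinuous: the energy by Gamma-liminf,
    the slope term by the first assertion and Fatou's lemma, the kinetic term because the
    difference quotients of [u] on dyadic partitions form an L^2-bounded submartingale.
    Its limit bounds the metric derivative almost everywhere by Lebesgue differentiation. *)

(** * Sequences and extractions *)

(** Both comparisons between [phie e] and [phi] lose only [tau ^+ 2], so the loss still vanishes
    after division by [tau]. They are required on the sets where energy and distance are at most
    [tau^-1]. These sets exhaust every bounded sublevel as [tau] tends to 0, which is why [epsT] can
    be fixed before the points and their bound [C] are known. The relaxed slope along a curve is not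
    known to be measurable. It is bounded pointwise by a lower limit of step functions, Fatou's
    lemma is applied to these, and monotonicity of the integral is used in a form free of
    measurability. The metric derivative is an upper limit defined at every time, so its square can
    be integrated only through a function that dominates it almost everywhere. Lower limits are
    handled in one form throughout: a real bound along some extraction bounds the limiting quantity.
    It suits compactness arguments and postpones the arithmetic of infinite values. *)

Lemma cvgn0P (R : realType) (x : nat -> R) : (forall n, 0 <= x n) ->
  x @ \oo --> 0 <->
  (forall e, 0 < e -> exists N, forall n, (N <= n)%N -> x n < e).
Proof.
move=> x0; split=> [/cvgr0Pnorm_lt h e e0|h].
  have [N _ hN] := h e e0.
  by exists N => n Nn; have := hN n Nn; rewrite /= ger0_norm.
apply/cvgr0Pnorm_lt => e e0; have [N hN] := h e e0.
by exists N => // n /= Nn; rewrite ger0_norm// hN.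
Qed.

Lemma at_right0P (R : realType) (P : R -> Prop) :
  (\forall t \near 0^'+, P t) <->
  exists2 r : R, 0 < r & forall t, 0 < t -> t < r -> P t.
Proof.
split=> [[r /= r0 hr]|[r r0 hr]].
  exists r => // t t0 tr; apply: hr => //=.
  by rewrite sub0r normrN gtr0_norm.
exists r => //= t /=; rewrite sub0r normrN => + t0.
by rewrite gtr0_norm// => /hr; apply.
Qed.

Lemma cvg_at_right0P (R : realType) (f : R -> R) :
  f @ 0^'+ --> 0 <->
  (forall e, 0 < e -> exists2 r, 0 < r &
     forall t, 0 < t -> t < r -> `|f t| < e).
Proof.
split=> [/cvgr0Pnorm_lt h e e0|h].
  by have /at_right0P[r r0 hr] := h e e0; exists r.
by apply/cvgr0Pnorm_lt => e e0; have [r r0 hr] := h e e0; apply/at_right0P; exists r.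
Qed.

Definition extraction (sg : nat -> nat) : Prop := forall k, (sg k < sg k.+1)%N.

Lemma extraction_ge sg : extraction sg -> forall k, (k <= sg k)%N.
Proof. by move=> h; elim=> // k /leq_ltn_trans; apply. Qed.

Lemma extraction_lt sg : extraction sg -> {homo sg : i j / (i < j)%N}.
Proof. by move=> h; apply: homo_ltn h; exact: ltn_trans. Qed.

Lemma extraction_le sg : extraction sg -> {homo sg : i j / (i <= j)%N}.
Proof. by move=> h; apply: homo_leq => [//|i j k|i]; [exact: leq_trans|exact: ltnW]. Qed.

Lemma extraction_comp s1 s2 : extraction s1 -> extraction s2 ->
  extraction (s1 \o s2).
Proof. by move=> h1 h2 k /=; apply: extraction_lt. Qed.

Lemma frequently_extraction_dep (P : nat -> nat -> Prop) :
  (forall k N, exists2 n, (N <= n)%N & P k n) ->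
  exists2 sg, extraction sg & forall k, P k (sg k).
Proof.
move=> h; have /choice[f hf] : forall p : nat * nat, exists n, (p.2 <= n)%N /\ P p.1 n.
  by move=> [k N]; have [n ? ?] := h k N; exists n.
pose sg := fix sg k := if k is k'.+1 then f (k, (sg k').+1) else f (0%N, 0%N).
exists sg => [k|[|k]]; first exact: (hf (k.+1, (sg k).+1)).1.
  exact: (hf (0%N, 0%N)).2.
exact: (hf (k.+1, (sg k).+1)).2.
Qed.

Lemma frequently_extraction (P : nat -> Prop) :
  (forall N, exists2 n, (N <= n)%N & P n) ->
  exists2 sg, extraction sg & forall k, P (sg k).
Proof. by move=> h; apply: (@frequently_extraction_dep (fun=> P)) => _. Qed.

Lemma cvgn0_extraction (R : realType) (x : nat -> R) sg : extraction sg ->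
  x @ \oo --> 0 -> (x \o sg) @ \oo --> 0.
Proof.
move=> hs hx; apply: cvg_comp hx => A [N _ hN]; exists N => // n /= Nn.
by apply: hN => /=; apply: leq_trans Nn (extraction_ge hs n).
Qed.

(** The stability hypothesis on [lim] asks for [k <= m k] only, not for a monotone [m]: the diagonal
    is compared with each nested extraction from some index on, which is all that convergence
    needs. *)
Lemma diagonal_extraction (T : Type) (X : nat -> nat -> T)
    (lim : (nat -> T) -> Prop) :
  (forall (x y : nat -> T) N m, (forall k, (N <= k)%N -> (k <= m k)%N /\ y k = x (m k)) ->
     lim x -> lim y) ->
  (forall i sg, extraction sg -> exists2 sg', extraction sg' & lim (X i \o sg \o sg')) ->
  exists2 sg, extraction sg & forall i, lim (X i \o sg).
Proof.
move=> limS h.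
have [F hF] : exists F : nat -> (nat -> nat) -> (nat -> nat), forall i sg, extraction sg ->
    extraction (F i sg) /\ lim (X i \o sg \o F i sg).
  have : forall p : nat * (nat -> nat), exists sg', extraction p.2 ->
      extraction sg' /\ lim (X p.1 \o p.2 \o sg').
    move=> [i sg]; have [hs|] := pselect (extraction sg); last by exists id.
    by have [sg' ? ?] := h i sg hs; exists sg'.
  by move=> /choice[G hG]; exists (fun i sg => G (i, sg)) => i sg hs; exact: (hG (i, sg)).
(* [S i] composes the first [i] refinements; for [k > i] the diagonal value [S k k] is a value of
   [S i.+1] at an index at least [k]. *)
pose S := fix S i := if i is i'.+1 then S i' \o F i' (S i') else (id : nat -> nat).
have eS i : extraction (S i).
  by elim: i => [k //|i IH] /=; apply: extraction_comp => //; exact: (hF i _ IH).1.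
have SS i j : exists2 m, extraction m & S (i + j)%N = S i \o m.
  elim: j => [|j [m hm Em]]; first by exists id => //; rewrite addn0.
  rewrite addnS /= Em; exists (m \o F (i + j)%N (S (i + j)%N)).
    by apply: extraction_comp => //; exact: (hF _ _ (eS _)).1.
  by rewrite Em.
exists (fun k => S k k) => [k /=|i].
  apply: (@leq_trans (S k k.+1)); first exact: eS.
  by apply: extraction_le; [exact: eS|exact: extraction_ge (hF _ _ (eS _)).1 _].
have [_ Li] := hF i _ (eS i).
have /choice[m hm] : forall k, exists m, (i.+1 <= k)%N ->
    (k <= m)%N /\ S k k = S i.+1 m.
  move=> k; have [ik|] := leqP i.+1 k; last by exists 0%N.
  have [m hm Em] := SS i.+1 (k - i.+1)%N.
  by exists (m k) => _; split; [exact: extraction_ge|rewrite subnKC// in Em; rewrite Em].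
apply: (limS _ _ i.+1 m _ Li) => k ik /=.
by have [? E] := hm k ik; split => //; rewrite E.
Qed.

(** * Yosida regularization *)

Lemma between_EFin (R : realType) (x : \bar R) (a b : R) :
  (a%:E <= x)%E -> (x <= b%:E)%E -> exists2 r, x = r%:E & a <= r <= b.
Proof.
case: x => [r|//|//] ar rb; exists r => //.
by move: ar rb; rewrite !lee_fin => -> ->.
Qed.

Lemma lt_inv_natE (R : realType) (e : R) : 0 < e ->
  exists N : nat, forall n, (N <= n)%N -> n.+1%:R^-1 < e.
Proof.
move=> e0; have := @cvg_harmonic R; rewrite (cvgn0P _) => [|n]; last exact: harmonic_ge0.
by move=> /(_ e e0)[N hN]; exists N.
Qed.

Section metric_functional.
Variables (R : realType) (S : Type) (d : S -> S -> R).
Hypothesis hd : metric_space d.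

Lemma dist_ge0 u v : 0 <= d u v. Proof. by case: hd. Qed.
Lemma distC u v : d u v = d v u. Proof. by case: hd. Qed.
Lemma dist_triangle u v w : d u w <= d u v + d v w. Proof. by case: hd. Qed.
Lemma dist_xx u : d u u = 0. Proof. by case: hd => _ h _ _; apply/h. Qed.
Lemma dist_eq0 u v : d u v = 0 -> u = v. Proof. by case: hd => _ h _ _ /h. Qed.

Lemma dist_cvgP (x : nat -> S) l : (fun n => d (x n) l) @ \oo --> 0 <->
  (forall e, 0 < e -> exists N, forall n, (N <= n)%N -> d (x n) l < e).
Proof. by apply: cvgn0P => n; exact: dist_ge0. Qed.

Lemma dist_cvg_unique (x : nat -> S) l l' :
  (fun n => d (x n) l) @ \oo --> 0 -> (fun n => d (x n) l') @ \oo --> 0 -> l = l'.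
Proof.
move=> /dist_cvgP h /dist_cvgP h'; apply: dist_eq0; apply/eqP.
rewrite eq_le dist_ge0 andbT; apply/ler_addgt0Pl => e e0; rewrite addr0.
have e20 : 0 < e / 2 by lra.
have [N hN] := h _ e20; have [M hM] := h' _ e20.
have := hN _ (leq_maxl N M); have := hM _ (leq_maxr N M).
by have := dist_triangle l (x (maxn N M)) l'; rewrite (distC l (x _)); lra.
Qed.

Lemma dist_sq_le u v w : d u w ^+ 2 <= 2 * d u v ^+ 2 + 2 * d v w ^+ 2.
Proof.
have h := dist_triangle u v w; have h1 := dist_ge0 u v; have h2 := dist_ge0 v w.
have h0 := dist_ge0 u w.
have : d u w ^+ 2 <= (d u v + d v w) ^+ 2 by rewrite lerXn2r ?nnegrE// addr_ge0.
have := sqr_ge0 (d u v - d v w); nra.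
Qed.

Lemma dist_diff u v w : `|d u w - d v w| <= d u v.
Proof.
rewrite ler_norml lerBlDr lerBrDl.
have := dist_triangle u v w; have := dist_triangle v u w; rewrite (distC v u); lra.
Qed.

Lemma dist_cvg_sq (x : nat -> S) l w e : (fun n => d (x n) l) @ \oo --> 0 -> 0 < e ->
  exists N, forall n, (N <= n)%N -> `|d (x n) w ^+ 2 - d l w ^+ 2| < e.
Proof.
move=> /dist_cvgP h e0; have l0 := dist_ge0 l w.
pose q := 2 * d l w + 1.
have q0 : 0 < q by rewrite /q; lra.
have [|N hN] := h (Num.min 1 (e / q)); first by rewrite lt_min ltr01 divr_gt0.
exists N => n /hN; rewrite lt_min => /andP[n1 n2].
have h1 := dist_diff (x n) l w; have xw0 := dist_ge0 (x n) w.
rewrite subr_sqr normrM [X in _ * X]ger0_norm ?addr_ge0//.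
apply: (@le_lt_trans _ _ (d (x n) l * q)); last by rewrite -ltr_pdivlMr.
apply: ler_pM => //; first by rewrite addr_ge0.
move: h1; rewrite ler_norml => /andP[_]; rewrite /q; lra.
Qed.

Section functional.
Variables (f : S -> \bar R) (A B : R) (us : S).
Hypothesis B0 : 0 < B.
Hypothesis lb : forall v, ((- A - B * d v us ^+ 2)%:E <= f v)%E.
Hypothesis lsc : forall (v : nat -> S) l (c : R), (fun n => d (v n) l) @ \oo --> 0 ->
  (forall n, (f (v n) <= c%:E)%E) -> (f l <= c%:E)%E.
Hypothesis cpt : forall (v : nat -> S) (C : R),
  (forall n m, (f (v n) <= C%:E)%E /\ d (v n) (v m) <= C) ->
  exists2 sg, extraction sg & exists l, (fun k => d (v (sg k)) l) @ \oo --> 0.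

Definition moreau (r : R) (w v : S) : \bar R := (f v + (d v w ^+ 2 / (2 * r))%:E)%E.

Lemma yosida_le r w v : (yosida d r f w <= moreau r w v)%E.
Proof. by apply: ereal_inf_lbound; exists v. Qed.

Lemma yosida_le_self r w : (yosida d r f w <= f w)%E.
Proof.
by apply: le_trans (yosida_le r w w) _; rewrite /moreau dist_xx expr0n/= mul0r adde0.
Qed.

(** The bound on [r] gives 1/(2r) >= 2B + 1. After d(v,us)^2 <= 2 d(v,w)^2 + 2 d(w,us)^2 the
    quadratic lower bound on [f] consumes 2B of this, and one full d(v,w)^2 remains as
    coercivity. *)
Lemma moreau_ge r w v : 0 < r -> r * (4 * B + 2) <= 1 ->
  ((- A - 2 * B * d w us ^+ 2 + d v w ^+ 2)%:E <= moreau r w v)%E.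
Proof.
move=> r0 rB; apply: (@le_trans _ _ ((- A - B * d v us ^+ 2) + d v w ^+ 2 / (2 * r))%:E).
  rewrite lee_fin; have h := dist_sq_le v w us.
  have h2 : d v w ^+ 2 * (2 * B + 1) <= d v w ^+ 2 / (2 * r).
    rewrite ler_pdivlMr ?mulr_gt0// -mulrA ler_piMr ?sqr_ge0//; nra.
  by have := ler_wpM2l (ltW B0) h; nra.
by rewrite EFinD leeD2r.
Qed.

Lemma yosida_fin r w C : 0 < r -> r * (4 * B + 2) <= 1 -> (f w <= C%:E)%E ->
  exists2 y, yosida d r f w = y%:E & - A - 2 * B * d w us ^+ 2 <= y <= C.
Proof.
move=> r0 rB fw; apply: between_EFin; last exact: le_trans (yosida_le_self r w) fw.
apply: le_ereal_inf_tmp => _ [v _ <-]; apply: le_trans (moreau_ge w v r0 rB).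
by rewrite lee_fin lerDl sqr_ge0.
Qed.

(** Direct method: [moreau_ge] keeps a minimizing sequence bounded, so [cpt] and [lsc] apply. *)
Lemma yosida_attained r w C : 0 < r -> r * (4 * B + 2) <= 1 -> (f w <= C%:E)%E ->
  exists z, yosida d r f w = moreau r w z.
Proof.
move=> r0 rB fw; have [y Ey /andP[y1 y2]] := yosida_fin r0 rB fw.
have /choice[v hv] : forall n : nat, exists v, (moreau r w v < (y + n.+1%:R^-1)%:E)%E.
  move=> n; have : (yosida d r f w < (y + n.+1%:R^-1)%:E)%E.
    by rewrite Ey lte_fin ltrDl invr_gt0.
  by move=> /ereal_inf_lt[_ [v _ <-] ?]; exists v.
have hv1 n : (moreau r w (v n) <= (y + 1)%:E)%E.
  apply/ltW/(lt_le_trans (hv n)); rewrite lee_fin lerD2l invf_le1//.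
  by rewrite ler1n.
pose M := y + 2 + A + 2 * B * d w us ^+ 2.
have dv n : d (v n) w <= M.
  have := le_trans (moreau_ge w (v n) r0 rB) (hv1 n); rewrite lee_fin => h.
  have [|] := leP (d (v n) w) 1; first by move: y1; rewrite /M; lra.
  by move=> h1; rewrite /M; nra.
have fv n : (f (v n) <= (y + 1)%:E)%E.
  apply: le_trans (hv1 n); rewrite /moreau leeDl// lee_fin divr_ge0 ?sqr_ge0//.
  by rewrite mulr_ge0// ltW.
pose C' := Num.max (y + 1) (2 * M).
have hC' n m : (f (v n) <= C'%:E)%E /\ d (v n) (v m) <= C'.
  split; first by apply: le_trans (fv n) _; rewrite lee_fin le_max lexx.
  rewrite le_max; apply/orP; right.
  by have := dist_triangle (v n) w (v m); have := dv n; have := dv m;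
    rewrite (distC w (v m)); lra.
have [sg hs [l hl]] := cpt hC'.
exists l; apply/eqP; rewrite eq_le yosida_le/= Ey.
suff fl : (f l <= (y - d l w ^+ 2 / (2 * r))%:E)%E.
  by apply: le_trans (leeD2r _ fl) _; rewrite -EFinD subrK.
apply/lee_addgt0Pr => e e0; rewrite -EFinD.
have r20 : 0 < 2 * r by rewrite mulr_gt0.
have [N1 hN1] := dist_cvg_sq w hl (mulr_gt0 r20 (divr_gt0 e0 (ltr0Sn _ 1))).
have [N2 hN2] := lt_inv_natE (divr_gt0 e0 (ltr0Sn R 1)).
pose N := maxn N1 N2.
(* [lsc] wants a bound valid at every index, hence the tail past [N], where the excess over the
   infimum and the change of the quadratic term each cost at most [e / 2]. *)
apply: (@lsc (fun k => v (sg (N + k)%N)) l).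
  apply/dist_cvgP => t t0; move/dist_cvgP : hl => /(_ t t0)[K hK].
  by exists K => n Kn; apply: hK; apply: leq_trans Kn (leq_addl _ _).
move=> k; set i := sg _.
have h1 : `|d (v i) w ^+ 2 - d l w ^+ 2| < 2 * r * (e / 2).
  by apply: hN1; apply: leq_trans (leq_maxl _ _) (leq_addr _ _).
have h2 : i.+1%:R^-1 < e / 2.
  apply: hN2; apply: leq_trans (extraction_ge hs _).
  by apply: leq_trans (leq_maxr _ _) (leq_addr _ _).
have := hv i; rewrite /moreau => /ltW; rewrite -leeBrDr// => /le_trans; apply.
rewrite -EFinB lee_fin.
have : d l w ^+ 2 / (2 * r) - d (v i) w ^+ 2 / (2 * r) <= e / 2.
  rewrite -mulrBl ler_pdivrMr// mulrC; move: h1; rewrite ltr_norml; lra.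
move: (d l w ^+ 2 / _) (d (v i) w ^+ 2 / _) (i.+1%:R^-1) h2 => a b c; lra.
Qed.

(** Minimality against [v] gives f z - f v <= (d(v,w)^2 - d(z,w)^2)/(2r) <= d(z,v) (2 d(z,w) +
    d(z,v))/(2r); dividing by d(z,v) and letting [v] tend to [z] leaves d(z,w)/r. *)
Lemma local_slope_minimizer r w z C : 0 < r -> (f z <= C%:E)%E ->
  yosida d r f w = moreau r w z -> (local_slope d f z <= (d z w / r)%:E)%E.
Proof.
move=> r0 fz Ez; have [c Ec _] := between_EFin (lb z) fz.
apply/lee_addgt0Pr => e e0; rewrite -EFinD.
(* Within this radius the remainder d(z,v)/(2r) stays below [e]. *)
have re0 : 0 < 2 * r * e by rewrite !mulr_gt0.
apply: le_trans (ereal_inf_lbound (ex_intro2 _ _ (2 * r * e) re0 erefl)) _.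
have rhs0 : 0 <= d z w / r + e.
  by apply: addr_ge0; [apply: divr_ge0; [exact: dist_ge0|exact: ltW]|exact: ltW].
apply: ge_ereal_sup => x /= [->|[v /andP[zv0 zv] <-]]; first by rewrite lee_fin.
have [fv|fv] := leP (f v) (f z); last first.
  rewrite max_r ?mul0e ?lee_fin//; rewrite sube_le0; exact: ltW.
have [b Eb _] := between_EFin (lb v) (le_trans fv fz).
have := yosida_le r w v; rewrite Ez /moreau Ec Eb -!EFinD lee_fin => h.
rewrite max_l; last by rewrite lee_fin subr_ge0 -lee_fin -Ec -Eb.
rewrite -EFinM lee_fin ler_pdivrMr//.
have h1 : c - b <= (d v w ^+ 2 - d z w ^+ 2) / (2 * r) by rewrite mulrBl; lra.
apply: le_trans h1 _; rewrite ler_pdivrMr ?mulr_gt0//.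
have -> : (d z w / r + e) * d z v * (2 * r) =
    d z v * (2 * d z w + 2 * r * e) by field; rewrite gt_eqF.
have h3 := dist_triangle v z w; rewrite (distC v z) in h3.
have h4 := dist_ge0 v w; have h5 := dist_ge0 z w.
rewrite subr_sqr.
have : (d v w - d z w) * (d v w + d z w) <= d z v * (d v w + d z w).
  by apply: ler_wpM2r; lra.
move=> /le_trans; apply; apply: ler_wpM2l; lra.
Qed.

(* The decrease of r |-> Y_r f (w) along the geometric sequence r_j = tau q^j is a
   discrete form of the formula d/dr Y_r f(w) = - d(z_r, w)^2 / (2 r^2). *)
Lemma exists_low_slope_point tau w C lam lam' :
  0 < tau -> tau * (4 * B + 2) <= 1 -> (f w <= C%:E)%E ->
  (f w <= yosida d tau f w + (lam * tau)%:E)%E -> lam < lam' ->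
  exists z, [/\ (f z <= f w)%E, d z w <= tau * Num.sqrt (2 * lam') &
    (local_slope d f z <= (Num.sqrt (2 * lam'))%:E)%E].
Proof.
move=> tau0 tauB fw hY ll'.
have [c Ec _] := between_EFin (lb w) fw.
pose Y r := fine (yosida d r f w).
have YE r : 0 < r -> r <= tau -> yosida d r f w = (Y r)%:E.
  move=> r0 rt; have rB : r * (4 * B + 2) <= 1 by nra.
  by rewrite /Y; have [y -> _] := yosida_fin r0 rB fw.
have Yle r : 0 < r -> r <= tau -> Y r <= c.
  by move=> r0 rt; rewrite -lee_fin -YE// -Ec yosida_le_self.
have lam0 : 0 <= lam.
  move: hY; rewrite Ec YE// -EFinD lee_fin; have := Yle _ tau0 (lexx _); nra.
have l'0 : 0 < lam' by lra.
apply: contrapT => hn.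
(* In the absence of such a point, the minimizer at parameter [r * q] lies farther than r q sqrt(2
   lam') from [w]; taken as a competitor at the larger parameter [r], it forces a drop of at least
   lam' q (r - r q). *)
have step r q : 0 < r -> r <= tau -> 0 < q -> q < 1 ->
    Y r <= Y (r * q) - lam' * q * (r - r * q).
  move=> r0 rt q0 q1; have rq0 : 0 < r * q by rewrite mulr_gt0.
  have rqt : r * q <= tau by nra.
  have rB : r * q * (4 * B + 2) <= 1 by nra.
  have [z Ez] := yosida_attained rq0 rB fw.
  have fz : (f z <= f w)%E.
    apply: le_trans (yosida_le_self (r * q) w); rewrite Ez /moreau leeDl// lee_fin.
    by rewrite divr_ge0 ?sqr_ge0// ltW// mulr_gt0.
  have hdz : 2 * lam' * (r * q) ^+ 2 < d z w ^+ 2.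
    rewrite ltNge; apply/negP => hz; apply: hn; exists z.
    have dz : d z w <= r * q * Num.sqrt (2 * lam').
      have rhs0 : 0 <= r * q * Num.sqrt (2 * lam').
        by apply: mulr_ge0; [exact: ltW|exact: sqrtr_ge0].
      rewrite -(@ler_pXn2r _ 2)// ?nnegrE ?dist_ge0//.
      rewrite exprMn sqr_sqrtr; last by rewrite mulr_ge0// ltW.
      by rewrite [leRHS]mulrC.
    split=> //; first by apply: le_trans dz _; rewrite ler_wpM2r ?sqrtr_ge0.
    apply: le_trans (local_slope_minimizer rq0 (le_trans fz fw) Ez) _.
    by rewrite lee_fin ler_pdivrMr// mulrC.
  have [b Eb _] := between_EFin (lb z) (le_trans fz fw).
  have := yosida_le r w z; rewrite YE// /moreau Eb -EFinD lee_fin => h1.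
  have h2 : Y (r * q) = b + d z w ^+ 2 / (2 * (r * q)).
    by apply: EFin_inj; rewrite -YE// Ez /moreau Eb.
  rewrite h2.
  have : lam' * q * (r - r * q) <= d z w ^+ 2 / (2 * (r * q)) - d z w ^+ 2 / (2 * r).
    have -> : d z w ^+ 2 / (2 * (r * q)) - d z w ^+ 2 / (2 * r) =
      d z w ^+ 2 * ((1 - q) / (2 * (r * q))) by field; rewrite !gt_eqF.
    have -> : lam' * q * (r - r * q) = 2 * lam' * (r * q) ^+ 2 * ((1 - q) / (2 * (r * q))).
      by field; rewrite !gt_eqF.
    by apply: ler_wpM2r; rewrite ?ltW// divr_gt0 ?mulr_gt0//; lra.
  lra.
have chain q m : 0 < q -> q < 1 -> Y tau <= Y (tau * q ^+ m) - lam' * q * (tau - tau * q ^+ m).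
  move=> q0 q1; elim: m => [|m IH]; first by rewrite expr0 mulr1 subrr mulr0 subr0.
  have qm0 : 0 < tau * q ^+ m by rewrite mulr_gt0 ?exprn_gt0.
  have qmt : tau * q ^+ m <= tau by apply: ler_piMr; [exact: ltW|apply: exprn_ile1; exact: ltW].
  have := step _ _ qm0 qmt q0 q1; rewrite -mulrA -exprSr; move: IH.
  have : 0 < lam' * q by rewrite mulr_gt0.
  nra.
(* With q = 1 - eta this gives lam' q^2 > lam, since lam' (1 - 2 eta) is the mean of [lam] and
   [lam']. With q^m < eta the chain goes down far enough for a total drop above lam tau. *)
pose eta := (lam' - lam) / (4 * lam').
have eta0 : 0 < eta by rewrite divr_gt0 ?mulr_gt0// subr_gt0.
have etaE : eta * (4 * lam') = lam' - lam by rewrite /eta divfK// gt_eqF// mulr_gt0.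
have eta1 : eta < 1 by nra.
pose q := 1 - eta.
have q0 : 0 < q by rewrite /q; lra.
have q1 : q < 1 by rewrite /q; lra.
have [m hm] : exists m, q ^+ m < eta.
  have /cvgr0Pnorm_lt /(_ eta eta0)[N _ hN] : (GRing.exp q) @ \oo --> 0.
    by apply: cvg_expr; rewrite ger0_norm// ltW.
  by exists N; have := hN N (leqnn N); rewrite /= ger0_norm// exprn_ge0// ltW.
have := chain q m q0 q1.
have qm0 : 0 < q ^+ m by rewrite exprn_gt0.
have qmt : tau * q ^+ m <= tau.
  by apply: ler_piMr; [exact: ltW|apply: exprn_ile1; exact: ltW].
have h1 := Yle (tau * q ^+ m) (mulr_gt0 tau0 qm0) qmt => h2.
move: hY; rewrite Ec YE// -EFinD lee_fin => h3.
have h4 : lam' * q * (1 - q ^+ m) * tau <= lam * tau by nra.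
rewrite ler_pM2r// in h4.
have h5 : lam' * q * q <= lam' * q * (1 - q ^+ m).
  by apply: ler_wpM2l; [rewrite mulr_ge0// ltW|rewrite /q; lra].
have : lam < lam' * q * q by rewrite /q; nra.
lra.
Qed.

End functional.
End metric_functional.

(** * Gamma-limits *)

Lemma relaxed_slope_ge0 (R : realType) (S : Type) (d : S -> S -> R) (phi : S -> \bar R) x :
  (0 <= relaxed_slope d phi x)%E.
Proof.
apply: le_ereal_inf_tmp => _ [y _ <-]; rewrite limn_einf_lim.
apply: lime_ge; first exact: is_cvg_einfs.
apply: nearW => n; apply: le_ereal_inf_tmp => _ [k _ <-].
by apply: le_ereal_inf_tmp => _ [r _ <-]; apply: ereal_sup_ubound; left.
Qed.

Section gamma_limit.
Variables (R : realType) (S : Type) (d : S -> S -> R).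
Variables (phi : S -> \bar R) (phie : R -> S -> \bar R).
Variables (A B : R) (us : S).
Hypothesis hd : metric_space d.
Hypothesis B0 : 0 < B.
Hypothesis lb : forall e u, 0 < e -> ((- A - B * d u us ^+ 2)%:E <= phie e u)%E.
Hypothesis cpt : forall (en : nat -> R) (un : nat -> S),
  (forall n, 0 < en n) -> en @ \oo --> 0 ->
  (exists C : R, forall n m, (phie (en n) (un n) <= C%:E)%E /\ d (un n) (un m) <= C) ->
  exists (sg : nat -> nat) (v : S), (forall k, (sg k < sg k.+1)%N) /\
    (fun k => d (un (sg k)) v) @ \oo --> 0.
Hypothesis gliminf : forall (u : S) (ue : R -> S), (fun e => d (ue e) u) @ 0^'+ --> 0 ->
  (phi u <= limf_einf (fun e => phie e (ue e)) 0^'+)%E.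
Hypothesis recov : forall u : S, exists ue : R -> S,
  (fun e => d (ue e) u) @ 0^'+ --> 0 /\
  (fun e => phie e (ue e)) @ 0^'+ --> phi u.

Local Notation dge0 := (dist_ge0 hd).
Local Notation dC := (distC hd).
Local Notation dtri := (dist_triangle hd).

(** The hypothesis concerns families indexed by all e > 0, so the sequence is placed in such a
    family, equal to [v] off the values of [en]. Every right neighbourhood of 0 contains some
    [en n], where the bound [c] holds. *)
Lemma gamma_liminf_seq (en : nat -> R) (vn : nat -> S) v (c : \bar R) :
  (forall n, 0 < en n) -> en @ \oo --> 0 -> (fun n => d (vn n) v) @ \oo --> 0 ->
  (forall n, (phie (en n) (vn n) <= c)%E) -> (phi v <= c)%E.
Proof.
move=> en0 /(cvgn0P (fun n => ltW (en0 n))) ecv /(dist_cvgP hd) dcv hc.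
(* several indices may share the value en n: pick one; all are eventually large *)
have /choice[ue hue] : forall e, exists w,
    (exists2 n, en n = e & w = vn n) \/ ((forall n, en n <> e) /\ w = v).
  move=> e; have [[n hn]|hn] := pselect (exists n, en n = e).
    by exists (vn n); left; exists n.
  by exists v; right; split=> // n hne; apply: hn; exists n.
have ucv : (fun e => d (ue e) v) @ 0^'+ --> 0.
  apply/cvg_at_right0P => t t0; have [N hN] := dcv _ t0.
  have [r r0 hr] : exists2 r, 0 < r & forall n, (n < N)%N -> r <= en n.
    elim: N {hN} => [|N [r r0 hr]]; first by exists 1.
    exists (Num.min r (en N)); first by rewrite lt_min r0 en0.
    move=> n; rewrite ltnS leq_eqVlt => /predU1P[->|/hr h]; first by rewrite ge_min lexx orbT.
    by rewrite ge_min h.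
  exists r => // e e0 er; rewrite ger0_norm ?dge0//.
  have [[n ne ->]|[_ ->]] := hue e; last by rewrite (dist_xx hd).
  by apply: hN; rewrite leqNgt; apply/negP => /hr; rewrite ne leNgt er.
apply: le_trans (gliminf ucv) _; rewrite limf_einfE.
apply: ge_ereal_sup => _ [V hV <-].
have /at_right0P[r r0 hr] : \forall t \near 0^'+, V t by [].
have [n hn] := ecv _ r0.
have Ven : V (en n) by apply: hr => //; exact: hn.
apply: le_trans (ereal_inf_lbound (ex_intro2 _ _ (en n) Ven erefl)) _.
by have [[m <- ->]|[/(_ n)]] := hue (en n).
Qed.

Lemma recovery_point v (c : R) eta : (phi v <= c%:E)%E -> 0 < eta ->
  exists e v', [/\ 0 < e, e < eta, d v' v < eta & (phie e v' <= (c + eta)%:E)%E].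
Proof.
move=> hc eta0; have [ue [/cvg_at_right0P/(_ _ eta0)[r1 r10 h1] h2]] := recov v.
have : \forall t \near 0^'+, (phie t (ue t) < (c + eta)%:E)%E.
  have /h2 : nbhs (phi v) [set x | (x < (c + eta)%:E)%E]; last by [].
  apply: open_nbhs_nbhs; split; first exact: open_ereal_lt_ereal.
  by apply: le_lt_trans hc _; rewrite lte_fin ltrDl.
move=> /at_right0P[r2 r20 h3].
pose m := Num.min (Num.min r1 r2) eta.
have m0 : 0 < m by rewrite !lt_min r10 r20.
have mE : [/\ m / 2 < r1, m / 2 < r2 & m / 2 < eta].
  have hm : m / 2 < m by lra.
  have [h4 h5] : m <= Num.min r1 r2 /\ m <= eta.
    by rewrite /m; split; rewrite ge_min lexx ?orbT.
  have [h6 h7] : Num.min r1 r2 <= r1 /\ Num.min r1 r2 <= r2.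
    by split; rewrite ge_min lexx ?orbT.
  by split; lra.
case: mE => m1 m2 m3; exists (m / 2), (ue (m / 2)); have m20 : 0 < m / 2 by lra.
split=> //; last by apply/ltW/h3.
by apply: le_lt_trans (ler_norm _) _; apply: h1.
Qed.

(** Trades a sequence in a sublevel of [phi] for a nearby one in sublevels of [phie (en n)]; through
    it [phi] inherits the lower bound, lower semicontinuity and compactness. *)
Lemma recovery_seq (v : nat -> S) (c : R) eta : (forall n, (phi (v n) <= c%:E)%E) -> 0 < eta ->
  exists (en : nat -> R) (v' : nat -> S), [/\ (forall n, 0 < en n), en @ \oo --> 0,
    (forall n, d (v' n) (v n) < n.+1%:R^-1) & forall n, (phie (en n) (v' n) <= (c + eta)%:E)%E].
Proof.
move=> hc eta0.
have /choice[p hp] : forall n : nat, exists p : R * S, [/\ 0 < p.1, p.1 < n.+1%:R^-1,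
    d p.2 (v n) < n.+1%:R^-1 & (phie p.1 p.2 <= (c + eta)%:E)%E].
  move=> n; have h0 : 0 < Num.min eta n.+1%:R^-1 by rewrite lt_min eta0 invr_gt0 ltr0n.
  have [e [v' [e0]]] := recovery_point (hc n) h0.
  rewrite !lt_min => /andP[e1 e2] /andP[d1 d2] h.
  exists (e, v'); split=> //=; apply: le_trans h _; rewrite lee_fin lerD2l.
  by rewrite ge_min lexx.
exists (fun n => (p n).1), (fun n => (p n).2); split => [n||n|n]; try by case: (hp n).
apply/cvgn0P => [n|e e0]; first by case: (hp n) => /ltW.
have [N hN] := lt_inv_natE e0; exists N => n /hN; case: (hp n) => _ h1 _ _.
exact: lt_trans.
Qed.

Lemma recovery_seq_cvg (v v' : nat -> S) l :
  (forall n, d (v' n) (v n) < n.+1%:R^-1) -> (fun n => d (v n) l) @ \oo --> 0 ->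
  (fun n => d (v' n) l) @ \oo --> 0.
Proof.
move=> h /(dist_cvgP hd) hv; apply/(dist_cvgP hd) => e e0.
have e20 : 0 < e / 2 by lra.
have [N hN] := hv _ e20; have [M hM] := lt_inv_natE e20.
exists (maxn N M) => n; rewrite geq_max => /andP[/hN h1 /hM h2].
have := h n; have := dtri (v' n) (v n) l.
move: (_^-1) h2 => a; lra.
Qed.

Lemma gamma_limit_lb v : ((- A - B * d v us ^+ 2)%:E <= phi v)%E.
Proof.
suff h (c : R) : (phi v <= c%:E)%E -> - A - B * d v us ^+ 2 <= c.
  case E : (phi v) => [x| |]; first by rewrite lee_fin h// E.
    by rewrite leey.
  by have := h (- A - B * d v us ^+ 2 - 1); rewrite E leNye => /(_ isT);
    clear E; rewrite leNgt ltrBlDr ltrDl ltr01.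
move=> hc; apply/ler_addgt0Pl => e e0.
have [|en [v' [en0 _ hv' he]]] := @recovery_seq (fun=> v) c (e / 2) (fun=> hc); first lra.
have cv : (fun n => d (v' n) v) @ \oo --> 0.
  apply: recovery_seq_cvg hv' _; rewrite (dist_xx hd); exact: cvg_cst.
have eB0 : 0 < e / 2 / B by rewrite !divr_gt0.
have [N hN] := dist_cvg_sq hd us cv eB0.
have := le_trans (lb (v' N) (en0 N)) (he N); rewrite lee_fin => h1.
have := hN N (leqnn N); rewrite ltr_norml => /andP[_]; rewrite ltr_pdivlMr// => h2.
nra.
Qed.

Lemma gamma_limit_lsc (v : nat -> S) l (c : R) : (fun n => d (v n) l) @ \oo --> 0 ->
  (forall n, (phi (v n) <= c%:E)%E) -> (phi l <= c%:E)%E.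
Proof.
move=> cv hc; apply/lee_addgt0Pr => e e0; rewrite -EFinD.
have [en [v' [en0 ecv hv' he]]] := recovery_seq hc e0.
exact: gamma_liminf_seq en0 ecv (recovery_seq_cvg hv' cv) he.
Qed.

Lemma gamma_limit_compact (v : nat -> S) (C : R) :
  (forall n m, (phi (v n) <= C%:E)%E /\ d (v n) (v m) <= C) ->
  exists2 sg, extraction sg & exists l, (fun k => d (v (sg k)) l) @ \oo --> 0.
Proof.
move=> hC; have [en [v' [en0 ecv hv' he]]] := recovery_seq (fun n => (hC n n).1) ltr01.
have inv1 n : (n.+1%:R^-1 : R) <= 1 by rewrite invf_le1// ler1n.
have [|sg [l [hs hl]]] := cpt (un := v') en0 ecv.
  exists (C + 2) => n m; split.
    by apply: le_trans (he n) _; rewrite lee_fin lerD2l ler1n.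
  have := lt_le_trans (hv' n) (inv1 n); have := lt_le_trans (hv' m) (inv1 m).
  have := (hC n m).2; have := dtri (v' n) (v n) (v' m); have := dtri (v n) (v m) (v' m).
  rewrite (dC (v m) (v' m)); lra.
exists sg => //; exists l; apply/(dist_cvgP hd) => e e0.
have e20 : 0 < e / 2 by lra.
move/(dist_cvgP hd) : hl => /(_ _ e20)[N hN]; have [M hM] := lt_inv_natE e20.
exists (maxn N M) => n; rewrite geq_max => /andP[/hN h1 Mn].
have h2 : d (v' (sg n)) (v (sg n)) < e / 2.
  by apply: lt_trans (hv' _) (hM _ (leq_trans Mn (extraction_ge hs n))).
have := dtri (v (sg n)) (v' (sg n)) l; rewrite (dC (v _) (v' _)); lra.
Qed.

(** By contradiction, with thresholds 1/(n+1): compactness extracts a limit [w] from the violating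
    points, and [w] itself is an admissible neighbour for large indices. The energy comparison is
    the Gamma-liminf inequality, the Yosida comparison uses a recovery sequence of an almost optimal
    competitor. *)
Lemma gamma_yosida_close (tau : R) : 0 < tau -> tau * (4 * B + 2) <= 1 ->
  exists2 eT, 0 < eT & forall e w, 0 < e -> e <= eT ->
    (phie e w <= (tau^-1)%:E)%E -> d w us <= tau^-1 ->
    exists w', [/\ d w w' <= tau, (phi w' <= phie e w + (tau ^+ 2)%:E)%E &
      (yosida d tau (phie e) w <= yosida d tau phi w' + (tau ^+ 2)%:E)%E].
Proof.
move=> tau0 tauB; apply: contrapT => hn.
have /choice[p hp] : forall n : nat, exists p : R * S, [/\ 0 < p.1, p.1 <= n.+1%:R^-1,
    (phie p.1 p.2 <= (tau^-1)%:E)%E, d p.2 us <= tau^-1 & forall w', ~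
    [/\ d p.2 w' <= tau, (phi w' <= phie p.1 p.2 + (tau ^+ 2)%:E)%E &
      (yosida d tau (phie p.1) p.2 <= yosida d tau phi w' + (tau ^+ 2)%:E)%E]].
  move=> n; apply: contrapT => hn2; apply: hn; exists n.+1%:R^-1; first by rewrite invr_gt0 ltr0n.
  move=> e w e0 en h1 h2; apply: contrapT => hn3; apply: hn2; exists (e, w); split => //= w' hw'.
  by apply: hn3; exists w'.
pose en n := (p n).1; pose wn n := (p n).2.
have en0 n : 0 < en n by case: (hp n).
have ecv : en @ \oo --> 0.
  apply/cvgn0P => [n|e e0]; first exact: ltW.
  have [N hN] := lt_inv_natE e0; exists N => n /hN; case: (hp n) => _ h1 _ _ _.
  exact: le_lt_trans.
have we n : (phie (en n) (wn n) <= (tau^-1)%:E)%E by case: (hp n).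
have wd n : d (wn n) us <= tau^-1 by case: (hp n).
have ti0 : 0 < tau^-1 by rewrite invr_gt0.
have [|sg [w [hs hw]]] := cpt (un := wn) en0 ecv.
  exists (2 * tau^-1) => n m; split.
    by apply: le_trans (we n) _; rewrite lee_fin; lra.
  by have := dtri (wn n) us (wn m); have := wd n; have := wd m; rewrite (dC us); lra.
have escv := cvgn0_extraction hs ecv.
have fw : (phi w <= (tau^-1)%:E)%E.
  by apply: (gamma_liminf_seq (fun n => en0 (sg n)) escv hw) => n; exact: we.
have [y Ey _] := @yosida_fin _ _ _ hd _ _ _ _ B0 gamma_limit_lb _ _ _ tau0 tauB fw.
have [c Ec _] := between_EFin (gamma_limit_lb w) fw.
have t20 : 0 < tau ^+ 2 by rewrite exprn_gt0.
have dw := (dist_cvgP hd _ _).1 hw; have [N1 hN1] := dw _ tau0.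
(* Were this false infinitely often, the Gamma-liminf inequality along those indices would bound the
   finite [phi w] by itself minus [tau ^+ 2]. *)
have [N2 hN2] : exists N, forall n, (N <= n)%N ->
    (phi w <= phie (en (sg n)) (wn (sg n)) + (tau ^+ 2)%:E)%E.
  apply: contrapT => hN.
  have [k hk hk2] : exists2 k, extraction k & forall n,
      (phie (en (sg (k n))) (wn (sg (k n))) <= (c - tau ^+ 2)%:E)%E.
    apply: (frequently_extraction (P := fun n =>
      (phie (en (sg n)) (wn (sg n)) <= (c - tau ^+ 2)%:E)%E)) => N; apply: contrapT => hN2; apply: hN; exists N => n Nn.
    rewrite leNgt; apply/negP => hlt; apply: hN2; exists n => //.
    by move: hlt; rewrite Ec -lteBrDr// -EFinB => /ltW.
  have := @gamma_liminf_seq (fun n => en (sg (k n))) (fun n => wn (sg (k n))) w _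
    (fun n => en0 _) (cvgn0_extraction hk escv) (cvgn0_extraction hk hw) hk2.
  by rewrite Ec lee_fin; lra.
have : (yosida d tau phi w < (y + tau ^+ 2 / 2)%:E)%E by rewrite Ey lte_fin; lra.
(* [v] is optimal up to tau^2/2; the other half of the allowed error is split into two [eta] =
   tau^2/4, one for the energy of the recovery sequence and one for its quadratic term. *)
move=> /ereal_inf_lt[_ [v _ <-] hv].
have [ue [/cvg_at_right0P ud uphi]] := recov v.
have [b Eb _] : exists2 b, phi v = b%:E & - A - B * d v us ^+ 2 <= b <=
    (y + tau ^+ 2 / 2) - d v w ^+ 2 / (2 * tau).
  by apply: between_EFin (gamma_limit_lb v) _; rewrite EFinB leeBrDr//; exact: ltW.
rewrite Eb -EFinD lte_fin in hv.
pose eta := tau ^+ 2 / 4; have eta0 : 0 < eta by rewrite /eta; lra.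
have /at_right0P[r1 r10 hr1] : \forall t \near 0^'+, (phie t (ue t) < (b + eta)%:E)%E.
  have /uphi : nbhs (phi v) [set x | (x < (b + eta)%:E)%E]; last by [].
  apply: open_nbhs_nbhs; split; first exact: open_ereal_lt_ereal.
  by rewrite /= Eb lte_fin; lra.
have tt0 : 0 < 2 * tau by lra.
have [r2 r20 [N3 hN3]] : exists2 r2, 0 < r2 & exists N, forall n e, (N <= n)%N -> 0 < e -> e < r2 ->
    d (ue e) (wn (sg n)) ^+ 2 <= d v w ^+ 2 + eta * (2 * tau).
  pose q := 2 * d v w + 1; have q0 : 0 < q by have := dge0 v w; rewrite /q; lra.
  (* [x] bounds the displacement at either end; with d = d(v,w), (d + 2x)^2 <= d^2 + 2x (2d + 1) as
     soon as 2x <= 1. *)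
  pose x := Num.min 1 (eta * (2 * tau) / q) / 2.
  have hm0 : 0 < Num.min 1 (eta * (2 * tau) / q).
    by rewrite lt_min ltr01 divr_gt0// mulr_gt0.
  have x0 : 0 < x by rewrite /x; lra.
  have [r2 r20 hr2] := ud _ x0; have [N hN] := dw _ x0.
  exists r2 => //; exists N => n e /hN h1 e0 er; have := hr2 e e0 er.
  rewrite ger0_norm ?dge0// => h2.
  have h3 : d (ue e) (wn (sg n)) <= d v w + 2 * x.
    have := dtri (ue e) v (wn (sg n)); have := dtri v w (wn (sg n)).
    by rewrite (dC w (wn _)); lra.
  have h4 : 2 * x <= 1 by rewrite /x mulrC divfK// ge_min lexx.
  have h5 : 2 * x * q <= eta * (2 * tau).
    by rewrite -ler_pdivlMr// /x mulrC divfK// ge_min lexx orbT.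
  have h6 := dge0 (ue e) (wn (sg n)); have h7 := dge0 v w.
  have : d (ue e) (wn (sg n)) ^+ 2 <= (d v w + 2 * x) ^+ 2.
    by rewrite lerXn2r ?nnegrE//; lra.
  move: h5; rewrite /q; nra.
pose r := Num.min r1 r2; have r0 : 0 < r by rewrite lt_min r10.
have [N4 hN4] := (cvgn0P (fun n => ltW (en0 (sg n)))).1 escv _ r0.
pose n := maxn (maxn N1 N2) (maxn N3 N4).
have [n1 n2 n3 n4] : [/\ (N1 <= n)%N, (N2 <= n)%N, (N3 <= n)%N & (N4 <= n)%N].
  by rewrite /n; split; rewrite !leq_max leqnn ?orbT.
have := hN4 _ n4; rewrite /= lt_min => /andP[er1 er2].
case: (hp (sg n)) => _ _ _ _ /(_ w); apply; split.
- by apply/ltW/hN1.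
- exact: hN2.
- apply: le_trans (yosida_le d (phie (en (sg n))) tau (wn (sg n)) (ue (en (sg n)))) _.
  rewrite /moreau Ey -EFinD.
  apply: le_trans (leeD2r _ (ltW (hr1 _ (en0 _) er1))) _.
  rewrite -EFinD lee_fin.
  have h8 : d (ue (en (sg n))) (wn (sg n)) ^+ 2 / (2 * tau) <= d v w ^+ 2 / (2 * tau) + eta.
    rewrite ler_pdivrMr// mulrDl divfK ?gt_eqF//; exact: hN3.
  by move: h8 hv; rewrite /eta; lra.
Qed.

(** [lam] bounds the quotient of the first assertion along a sequence. Near each [un n], up to
    O(tau), there is a point of bounded energy and local slope at most sqrt(2 lam'); these points
    are admissible in the infimum that defines the relaxed slope at [u]. *)
Lemma relaxed_slope_le_seq (tau : nat -> R) (e : nat -> R) (eT : R -> R)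
    (un : nat -> S) u (C lam : R) :
  (forall t, 0 < t -> t * (4 * B + 2) <= 1 -> forall e w, 0 < e -> e <= eT t ->
    (phie e w <= (t^-1)%:E)%E -> d w us <= t^-1 ->
    exists w', [/\ d w w' <= t, (phi w' <= phie e w + (t ^+ 2)%:E)%E &
      (yosida d t (phie e) w <= yosida d t phi w' + (t ^+ 2)%:E)%E]) ->
  (forall n, 0 < tau n) -> tau @ \oo --> 0 ->
  (forall n, 0 < e n <= eT (tau n)) ->
  (fun n => d (un n) u) @ \oo --> 0 ->
  (forall n, (phie (e n) (un n) <= C%:E)%E) ->
  (forall n, (phie (e n) (un n) <= yosida d (tau n) (phie (e n)) (un n) + (lam * tau n)%:E)%E) ->
  ((2^-1)%:E * relaxed_slope d phi u ^+ 2 <= lam%:E)%E.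
Proof.
move=> heT tau0 tcv he ucv hC hlam.
have dcv := (dist_cvgP hd _ _).1 ucv.
have tcv' := (cvgn0P (fun n => ltW (tau0 n))).1 tcv.
apply/lee_addgt0Pr => eta eta0; rewrite -EFinD.
pose lam' := lam + eta.
have lam0 : 0 <= lam.
  have h := hlam 0%N; have := le_trans h (leeD2r _ (yosida_le_self hd _ _ _)).
  have [e0 _] := andP (he 0%N).
  have [c -> _] := between_EFin (lb (un 0%N) e0) (hC 0%N).
  by rewrite -EFinD lee_fin lerDl pmulr_lge0.
(* For [tau n < M^-1] and d(un n, u) < 1 all requirements of [heT] hold: [tau n] is small enough,
   and both [C] and d(un n, us) are at most 1/tau. *)
pose M := Num.max (Num.max 1 (4 * B + 2)) (Num.max (Num.max C 0) (d u us + 1) + 1 ).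
have M1 : 1 <= M by rewrite /M !le_max lexx.
have M0 : 0 < M by lra.
have MB : 4 * B + 2 <= M by rewrite /M !le_max lexx !orbT.
have [MC Md] : C <= M /\ d u us + 1 <= M.
  have h : Num.max (Num.max C 0) (d u us + 1) + 1 <= M by rewrite /M le_max lexx !orbT.
  have h1 : C <= Num.max (Num.max C 0) (d u us + 1) by rewrite !le_max lexx.
  have h2 : d u us + 1 <= Num.max (Num.max C 0) (d u us + 1) by rewrite le_max lexx orbT.
  by split; lra.
have m0 : 0 < Num.min (eta / 3) M^-1 by rewrite lt_min invr_gt0 M0 andbT; lra.
have [N1 hN1] := tcv' _ m0; have [N2 hN2] := dcv _ ltr01.
pose N := maxn N1 N2.
have key n : (N <= n)%N -> exists z, [/\ (phi z <= (C + 1)%:E)%E,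
    d z u <= d (un n) u + tau n * (1 + Num.sqrt (2 * lam')) &
    (local_slope d phi z <= (Num.sqrt (2 * lam'))%:E)%E].
  rewrite geq_max => /andP[/hN1 h1 /hN2 h2].
  have := h1; rewrite lt_min => /andP[ht1 ht2].
  have t0 := tau0 n.
  have tM : tau n * M <= 1 by rewrite -ler_pdivlMr// div1r ltW.
  have Mt : M <= (tau n)^-1 by rewrite -div1r ler_pdivlMr// mulrC.
  have tB : tau n * (4 * B + 2) <= 1 by nra.
  have t1 : tau n <= 1 by nra.
  have [e0 eT0] := andP (he n).
  have [||w [w1 w2 w3]] := heT _ t0 tB _ (un n) e0 eT0.
  - by apply: le_trans (hC n) _; rewrite lee_fin; lra.
  - by have := dtri (un n) u us; lra.
  have [c Ec cC] := between_EFin (lb (un n) e0) (hC n).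
  have fw : (phi w <= (C + 1)%:E)%E.
    by apply: le_trans w2 _; rewrite Ec -EFinD lee_fin; nra.
  have [y Ey _] := @yosida_fin _ _ _ hd _ _ _ _ B0 gamma_limit_lb _ _ _ t0 tB fw.
  (* The two errors [tau n ^+ 2] raise the constant by 2 tau, which [lam'] absorbs because tau <
     eta/3. *)
  have fw2 : (phi w <= yosida d (tau n) phi w + ((lam + 2 * tau n) * tau n)%:E)%E.
    apply: le_trans w2 _; apply: le_trans (leeD2r _ (hlam n)) _.
    apply: le_trans (leeD2r _ (leeD2r _ w3)) _.
    by rewrite Ey -!EFinD lee_fin; nra.
  have ll : lam + 2 * tau n < lam' by rewrite /lam'; lra.
  have [z [z1 z2 z3]] := exists_low_slope_point hd B0 gamma_limit_lb gamma_limit_lsc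
    gamma_limit_compact t0 tB fw fw2 ll.
  exists z; split=> //; first exact: le_trans z1 fw.
  have := dtri z w u; have := dtri w (un n) u; rewrite (dC w (un n)); lra.
have /choice[z hz] : forall k, exists z, [/\ (phi z <= (C + 1)%:E)%E,
    d z u <= d (un (N + k)%N) u + tau (N + k)%N * (1 + Num.sqrt (2 * lam')) &
    (local_slope d phi z <= (Num.sqrt (2 * lam'))%:E)%E].
  by move=> k; apply: key; exact: leq_addr.
pose q := 1 + Num.sqrt (2 * lam').
have q0 : 0 < q by have := sqrtr_ge0 (2 * lam'); rewrite /q; lra.
have zcv e' : 0 < e' -> exists K, forall k, (K <= k)%N -> d (z k) u < e'.
  move=> e'0; have e20 : 0 < e' / 2 by lra.
  have [K1 hK1] := dcv _ e20; have [K2 hK2] := tcv' _ (divr_gt0 e20 q0).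
  exists (maxn K1 K2) => k; rewrite geq_max => /andP[k1 k2].
  have h1 := hK1 _ (leq_trans k1 (leq_addl N k)).
  have h2 := hK2 _ (leq_trans k2 (leq_addl N k)); rewrite ltr_pdivlMr// in h2.
  by case: (hz k) => _ h3 _; rewrite -/q in h3; lra.
have [K hK] := zcv _ ltr01.
have lam'0 : 0 <= 2 * lam' by rewrite /lam'; lra.
have rle : (relaxed_slope d phi u <= (Num.sqrt (2 * lam'))%:E)%E.
  pose zz k := z (K + k)%N.
  apply: (@le_trans _ _ (limn_einf (fun n => local_slope d phi (zz n)))).
    apply: ereal_inf_lbound; exists zz => //=; split.
      apply/(dist_cvgP hd) => e' /zcv[K' hK']; exists K' => k /leq_trans/(_ (leq_addl K k)).
      exact: hK'.
    exists (Num.max (C + 1) 1) => n; split.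
      by rewrite le_max; apply/orP; right; apply/ltW/hK/leq_addr.
    case: (hz (K + n)%N) => h _ _; apply: le_trans h _.
    by rewrite lee_fin le_max lexx.
  rewrite limn_einf_lim; apply: lime_le; first exact: is_cvg_einfs.
  apply: nearW => n; apply: (@le_trans _ _ (local_slope d phi (zz n))).
    by apply: ereal_inf_lbound; exists n => /=.
  by case: (hz (K + n)%N).
have rge := relaxed_slope_ge0 d phi u.
have [x -> /andP[x0 x1]] := between_EFin rge rle.
rewrite -EFin_expe -EFinM lee_fin -/lam'.
have : x ^+ 2 <= Num.sqrt (2 * lam') ^+ 2 by rewrite lerXn2r ?nnegrE// sqrtr_ge0.
by rewrite sqr_sqrtr//; lra.
Qed.

End gamma_limit.

(** * Step functions and metric derivatives *)

Section integral_aux.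
Local Open Scope ereal_scope.
Context (d : measure_display) (T : measurableType d) (R : realType).
Variable mu : {measure set T -> \bar R}.

(* No measurability: the integral of a nonnegative function is a supremum over the
   simple functions below it. *)
Lemma ge0_le_integral_nomeas (D : set T) (f g : T -> \bar R) :
  (forall x, D x -> 0 <= f x) -> (forall x, D x -> f x <= g x) ->
  \int[mu]_(x in D) f x <= \int[mu]_(x in D) g x.
Proof.
move=> f0 fg; rewrite !(integral_mkcond D).
have h0 x : 0 <= (f \_ D) x by apply: erestrict_ge0.
have h1 x : 0 <= (g \_ D) x.
  by apply: erestrict_ge0 => t Dt; exact: le_trans (f0 _ Dt) (fg _ Dt).
rewrite !ge0_integralTE//; apply: ge_ereal_sup => _ [h hf <-].
apply: ereal_sup_ubound; exists h => // x; apply: le_trans (hf x) _.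
exact: lee_restrict.
Qed.

Lemma measurable_fun_limn_einf (D : set T) (f : (T -> \bar R)^nat) :
  (forall n, measurable_fun D (f n)) ->
  measurable_fun D (fun x => limn_einf (f ^~ x)).
Proof.
move=> mf; apply: measurableT_comp => //.
apply: measurable_fun_limn_esup => n; exact: measurableT_comp.
Qed.

End integral_aux.

Section step_function.
Variable R : realType.
Local Notation mu := (@lebesgue_measure R).

Definition step (dl : R) (c : nat -> R) (s : R) : R := c (Num.truncn (s / dl)).

Lemma step_itv dl c s i : 0 < dl -> i%:R * dl <= s -> s < i.+1%:R * dl -> step dl c s = c i.
Proof.
move=> dl0 h1 h2; rewrite /step; congr c; apply/eqP; rewrite eqn_leq.
have s0 : 0 <= s / dl.
  by apply: divr_ge0 (ltW dl0); apply: le_trans h1; rewrite mulr_ge0// ltW.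
by rewrite truncn_le_nat ltr_pdivrMr// h2 truncn_ge_nat// ler_pdivlMr.
Qed.

Lemma truncn_div_itv (dl s : R) : 0 < dl -> 0 <= s ->
  (Num.truncn (s / dl))%:R * dl <= s /\ s < (Num.truncn (s / dl)).+1%:R * dl.
Proof.
move=> dl0 s0; have : 0 <= s / dl by rewrite divr_ge0// ltW.
by move=> /truncn_itv; rewrite ler_pdivlMr// ltr_pdivrMr// => /andP.
Qed.

Lemma measurable_step D dl c : 0 < dl -> measurable_fun D (step dl c).
Proof.
move=> dl0; apply: (@measurable_funS _ _ _ _ setT) => // _ A mA; rewrite setTI.
pose E i := [set s : R | Num.truncn (s / dl) = i].
have mE i : measurable (E i).
  have -> : E i = [set` `]-oo, i.+1%:R * dl[] `\`
      (if i is 0 then set0 else [set` `]-oo, i%:R * dl[]).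
    apply/seteqP; split=> s; rewrite /E /= in_itv/= -ltr_pdivrMr//.
      move=> si; split; first by rewrite -truncn_le_nat si.
      case: i si => [_ []|i si]; rewrite /= in_itv/= -ltr_pdivrMr// -truncn_le_nat si.
      by rewrite ltnn.
    move=> [h1 h2]; apply/eqP; rewrite eqn_leq truncn_le_nat h1/=.
    case: i {h1} h2 => [//|i]; rewrite /= in_itv/= -ltr_pdivrMr// -truncn_le_nat => /negP.
    by rewrite -ltnNge.
  by apply: measurableD; [exact: measurable_itv|case: i => [|i]; [exact: measurable0|exact: measurable_itv]].
have -> : step dl c @^-1` A = \bigcup_(i in [set i | A (c i)]) E i.
  by apply/seteqP; split=> s /= => [h|[i /= h]]; [exists (Num.truncn (s / dl))|rewrite /step => ->].
by apply: bigcup_measurable.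
Qed.

Lemma integral_step dl c i n : 0 < dl -> (forall k, 0 <= c k) ->
  (\int[mu]_(s in `[(i%:R * dl)%R, ((i + n)%:R * dl)%R[) (step dl c s)%:E)%E =
  (dl * \sum_(i <= k < i + n) c k)%:E.
Proof.
move=> dl0 c0; elim: n => [|n IH].
  by rewrite addn0 set_itvco0 integral_set0 big_geq// mulr0.
have le1 : (i%:R * dl <= (i + n)%:R * dl)%R.
  by rewrite ler_wpM2r ?(ltW dl0)// ler_nat leq_addr.
have le2 : ((i + n)%:R * dl < (i + n.+1)%:R * dl)%R.
  by rewrite ltr_pM2r// ltr_nat addnS.
rewrite (@itv_bndbnd_setU _ _ _ (BLeft ((i + n)%:R * dl))); [|by rewrite bnd_simp|by rewrite bnd_simp ltW].
have ms D : measurable_fun D (EFin \o step dl c).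
  by apply/measurable_EFinP; exact: measurable_step.
rewrite ge0_integral_setU//=; last 3 first.
  exact: ms.
  by move=> x _; rewrite lee_fin; exact: c0.
  apply/disj_setPRL => x /=; rewrite !in_itv/= => /andP[h1 h2] /andP[h3 h4].
  by have := lt_le_trans h4 h1; rewrite ltxx.
rewrite IH (eq_integral (cst (c (i + n)%N)%:E)); last first.
  move=> x; rewrite inE/= in_itv/= => /andP[h1 h2].
  by rewrite (step_itv _ dl0 h1)// -addnS.
rewrite integral_cst//= lebesgue_measure_itv/= lte_fin le2.
rewrite -EFinB -EFinM -EFinD; congr EFin.
rewrite addnS big_nat_recr ?leq_addr//= -mulrBl mulrDr; congr (_ + _).
by rewrite -natrB// subSnn mul1r mulrC.
Qed.

Lemma integral_step0 dl c n : 0 < dl -> (forall k, 0 <= c k) ->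
  (\int[mu]_(s in `[0%R, (n%:R * dl)%R[) (step dl c s)%:E)%E =
  (dl * \sum_(0 <= k < n) c k)%:E.
Proof. by move=> dl0 c0; have := integral_step 0 n dl0 c0; rewrite mul0r add0n. Qed.

End step_function.

Section metric_derivative.
Variables (R : realType) (S : Type) (d : S -> S -> R).
Hypothesis hd : metric_space d.

Lemma metric_deriv_ge0 (D : set R) (u : R -> S) t : (0 <= metric_deriv d D u t)%E.
Proof.
by apply: le_ereal_inf_tmp => _ [r _ <-]; apply: ereal_sup_ubound; left.
Qed.

(** For fixed [r] the supremum of the quotients is lower semicontinuous by continuity of [u], so its
    superlevel sets are relatively open; the metric derivative is the infimum of these suprema over
    r = 1/(n+1). *)
Lemma measurable_metric_deriv (D : set R) (u : R -> S) : measurable D ->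
  (forall t, D t -> forall e, 0 < e -> exists2 r, 0 < r &
     forall s, D s -> `|s - t| < r -> d (u s) (u t) < e) ->
  measurable_fun D (metric_deriv d D u).
Proof.
move=> mD cu.
pose F (r t : R) : \bar R := ereal_sup ([set 0%E] `|`
     [set ((d (u s) (u t)) / `|s - t|)%:E | s in [set s | D s /\ 0 < `|s - t| < r]%R]).
have FS r r' t : r <= r' -> (F r t <= F r' t)%E.
  move=> rr'; apply: ge_ereal_sup => x [->|[s [Ds /andP[s1 s2]] <-]].
    by apply: ereal_sup_ubound; left.
  apply: ereal_sup_ubound; right; exists s => //=; split=> //.
  by rewrite s1 (lt_le_trans s2).
have -> : metric_deriv d D u = fun t => einfs (fun n => F n.+1%:R^-1 t) 0.
  apply/funext => t; apply/eqP; rewrite eq_le; apply/andP; split.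
    apply: le_ereal_inf_tmp => _ [n _ <-]; apply: ereal_inf_lbound.
    by exists n.+1%:R^-1 => //=; rewrite invr_gt0 ltr0n.
  apply: le_ereal_inf_tmp => _ [r r0 <-]; have [N hN] := lt_inv_natE r0.
  have h0 : [set n | (0 <= n)%N] N by [].
  apply: le_trans (ereal_inf_lbound (ex_intro2 _ _ N h0 erefl)) _.
  by apply: FS; apply/ltW/hN.
apply: measurable_fun_einfs => n; set r := n.+1%:R^-1.
move=> _; apply: (measurability _ (ErealGenOInfty.measurableE R)) => //.
move=> /= _ [_ [a ->]] <-; rewrite preimage_itvoy.
pose O := [set t | exists2 e, 0 < e & forall t', D t' -> `|t' - t| < e -> (a%:E < F r t')%E].
have -> : D `&` [set x | (a%:E < F r x)%E] = D `&` O.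
  apply/seteqP; split=> t [Dt]; last first.
    by move=> [e e0 /(_ t Dt)] h; split=> //=; apply: h; rewrite subrr normr0.
  move=> /= /ereal_sup_gt[x [->|[s [Ds /andP[s1 s2]] <-]]] ax; split=> //.
    exists 1 => // t' _ _; apply: lt_le_trans ax _.
    by apply: ereal_sup_ubound; left.
  have [a0|a0] := ltP a 0.
    exists 1 => // t' _ _; apply: (@lt_le_trans _ _ 0%E); first by rewrite lte_fin.
    by apply: ereal_sup_ubound; left.
  move: ax; rewrite lte_fin ltr_pdivlMr// => ax.
  pose g := d (u s) (u t) - a * `|s - t|; have g0 : 0 < g by rewrite /g subr_gt0.
  have [r1 r10 hr1] := cu t Dt _ (divr_gt0 g0 (ltr0Sn _ 1)).
  (* Within [e] the point [s] stays admissible for [t'], and the numerator and [a] times the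
     denominator each move by less than half of the margin [g]. *)
  pose e := Num.min (Num.min r1 (g / (2 * (a + 1)))) (Num.min `|s - t| (r - `|s - t|)).
  have e0 : 0 < e by rewrite /e !lt_min r10 s1 subr_gt0 s2 divr_gt0// mulr_gt0//; lra.
  exists e => // t' Dt'; rewrite /e !lt_min => /andP[/andP[h1 h2] /andP[h3 h4]].
  have k1 : `|s - t'| <= `|s - t| + `|t' - t|.
    by rewrite (distrC t' t) -(subrKA t) ler_normD.
  have k2 : `|s - t| <= `|s - t'| + `|t' - t|.
    by rewrite -(subrKA t') ler_normD.
  have k3 : 0 < `|s - t'| by lra.
  apply: (@lt_le_trans _ _ (d (u s) (u t') / `|s - t'|)%:E); last first.
    apply: ereal_sup_ubound; right; exists s => //=; split=> //.
    by rewrite k3/=; lra.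
  rewrite lte_fin ltr_pdivlMr//.
  have := hr1 t' Dt' h1; have := dist_triangle hd (u s) (u t') (u t).
  have q0 : 0 < 2 * (a + 1) by lra.
  rewrite ltr_pdivlMr// in h2.
  have : a * `|s - t'| <= a * (`|s - t| + `|t' - t|) by rewrite ler_wpM2l.
  have := normr_ge0 (t' - t); rewrite /g in h2 *.
  rewrite mulrDr; nra.
apply: measurableI => //; apply: open_measurable.
rewrite openE => t [e e0 he]; exists (e / 2) => /=; first by rewrite divr_gt0.
move=> t1 /= ht1; exists (e / 2); first by rewrite divr_gt0.
move=> t' Dt' h; apply: he => //.
have : `|t' - t| <= `|t' - t1| + `|t1 - t| by rewrite -(subrKA t1) ler_normD.
by move: ht1; rewrite distrC; lra.
Qed.

End metric_derivative.

(** * Dyadic polygons *)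

Section finite_sums.
Variable R : realType.

Lemma sum_blocks (F : nat -> R) N m :
  \sum_(0 <= j < N * m) F j = \sum_(0 <= i < N) \sum_(0 <= l < m) F (i * m + l)%N.
Proof.
elim: N => [|N IH]; first by rewrite mul0n !big_geq.
rewrite (big_cat_nat (n := (N * m)%N))//= ?leq_mul2r ?leqnSn ?orbT// IH big_nat_recr//=.
congr (_ + _); rewrite mulSn addnC -{1}[(N * m)%N]add0n big_addn addnC addnK.
by apply: eq_bigr => i _; rewrite addnC.
Qed.

(* The L^2 form of the submartingale property: c i is at most the mean of x on block i. *)
Lemma block_variance (x c : nat -> R) N m : (forall i, 0 <= c i) ->
  (forall i, m%:R * c i <= \sum_(0 <= l < m) x (i * m + l)%N) -> (0 < m)%N ->
  \sum_(0 <= j < N * m) (x j - c (j %/ m)%N) ^+ 2 <=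
  \sum_(0 <= j < N * m) x j ^+ 2 - m%:R * \sum_(0 <= i < N) c i ^+ 2.
Proof.
move=> c0 h m0; rewrite !sum_blocks mulr_sumr -sumrB; apply: ler_sum => i _.
have -> : \sum_(0 <= l < m) (x (i * m + l)%N - c ((i * m + l) %/ m)%N) ^+ 2 =
    \sum_(0 <= l < m) x (i * m + l)%N ^+ 2 -
    2 * c i * \sum_(0 <= l < m) x (i * m + l)%N + m%:R * c i ^+ 2.
  have -> : m%:R * c i ^+ 2 = \sum_(0 <= l < m) c i ^+ 2.
    by rewrite big_const_nat subn0 iter_addr_0 mulr_natl.
  rewrite mulr_sumr -sumrB -big_split/=; apply: eq_big_nat => l /andP[_ lm].
  by rewrite divnMDl// divn_small// addn0; ring.
have := ler_wpM2l (c0 i) (h i); nra.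
Qed.

(** Young's inequality with a free weight stands in for Cauchy-Schwarz: no square root appears, and
    [t] can be matched to the size of the squares. *)
Lemma sum_abs_le_sq (y : nat -> R) n t : 0 < t ->
  \sum_(0 <= j < n) `|y j| <= 2^-1 * (t * \sum_(0 <= j < n) y j ^+ 2 + n%:R * t^-1).
Proof.
move=> t0; have -> : n%:R * t^-1 = \sum_(0 <= j < n) t^-1.
  by rewrite big_const_nat subn0 iter_addr_0 mulr_natl.
rewrite mulr_sumr -big_split/= mulr_sumr; apply: ler_sum => j _.
have -> : y j ^+ 2 = `|y j| ^+ 2 by rewrite real_normK// num_real.
have : 0 <= (t * `|y j| - 1) ^+ 2 / t by rewrite divr_ge0 ?sqr_ge0// ltW.
have -> : (t * `|y j| - 1) ^+ 2 / t = t * `|y j| ^+ 2 - 2 * `|y j| + t^-1.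
  by field; rewrite gt_eqF.
lra.
Qed.

Lemma cvg_bounded_variation (y : nat -> R) C :
  (forall n, \sum_(0 <= k < n) `|y k.+1 - y k| <= C) -> exists l : R, y @ \oo --> l.
Proof.
move=> hC; have : cvgn (series (fun k => y k.+1 - y k)).
  apply: normed_cvg; apply: nondecreasing_is_cvgn.
    by apply: nondecreasing_series => n _ _; exact: normr_ge0.
  by exists C => _ [n _ <-]; exact: hC.
move=> /cvg_ex[l hl]; exists (l + y 0%N).
have E : (fun n => series (fun k => y k.+1 - y k) n + y 0%N) = y.
  by apply/funext => n; rewrite /series/= telescope_sumr// subrK.
by rewrite -{1}E; apply: cvgD hl _; exact: cvg_cst.
Qed.

End finite_sums.

Section polygon.
Variables (R : realType) (S : Type) (d : S -> S -> R).
Hypothesis hd : metric_space d.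

Lemma dist_sum_le (V : nat -> S) i n :
  d (V i) (V (i + n)%N) <= \sum_(i <= k < i + n) d (V k) (V k.+1).
Proof.
elim: n => [|n IH]; first by rewrite addn0 (dist_xx hd) big_geq.
rewrite addnS big_nat_recr ?leq_addr//=.
exact: le_trans (dist_triangle hd _ (V (i + n)%N) _) (lerD IH (lexx _)).
Qed.

Lemma dist_sum_le0 (V : nat -> S) i n :
  d (V i) (V (i + n)%N) <= \sum_(0 <= l < n) d (V (i + l)%N) (V (i + l).+1).
Proof.
elim: n => [|n IH]; first by rewrite addn0 (dist_xx hd) big_geq.
rewrite addnS big_nat_recr//=.
exact: le_trans (dist_triangle hd _ (V (i + n)%N) _) (lerD IH (lexx _)).
Qed.

Variables (u : R -> S) (T : R).
Hypothesis T0 : 0 < T.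

Definition mesh (n : nat) : R := T / (2 ^ n)%N%:R.
Definition chord (n i : nat) : R :=
  d (u (i%:R * mesh n)) (u (i.+1%:R * mesh n)) / mesh n.
(** A metric space offers no segments between the nodes; only the quotients of neighbouring nodes
    exist, and this step function plays the role of the speed of an inscribed polygon. *)
Definition polygon_speed (n : nat) : R -> R := step (mesh n) (chord n).
Definition polygon_energy (n : nat) : R :=
  mesh n * \sum_(0 <= i < (2 ^ n)%N) chord n i ^+ 2.

Lemma mesh_gt0 n : 0 < mesh n.
Proof. by rewrite divr_gt0// ltr0n expn_gt0. Qed.

Lemma mesh_pow n : (2 ^ n)%N%:R * mesh n = T.
Proof. by rewrite mulrC divfK// pnatr_eq0 -lt0n expn_gt0. Qed.

Lemma mesh_refine n p : (n <= p)%N -> mesh n = (2 ^ (p - n))%N%:R * mesh p.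
Proof.
move=> np; rewrite /mesh -{2}(subnK np) expnD natrM; field.
by rewrite !pnatr_eq0 -!lt0n !expn_gt0.
Qed.

Lemma mesh_small e : 0 < e -> exists N, forall n, (N <= n)%N -> mesh n < e.
Proof.
move=> e0; have [N hN] := lt_inv_natE (divr_gt0 e0 T0); exists N => n /hN h.
rewrite /mesh ltr_pdivrMr ?ltr0n ?expn_gt0//.
move: h; rewrite ltr_pdivlMr// mulrC ltr_pdivrMr// => h.
by apply: lt_le_trans h _; rewrite ler_wpM2l// ?(ltW e0)// ler_nat ltn_expl.
Qed.

Lemma chord_ge0 n i : 0 <= chord n i.
Proof. by rewrite divr_ge0 ?(dist_ge0 hd)// ltW// mesh_gt0. Qed.

(** Triangle inequality through the nodes of level [p]; this is the source of the submartingale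
    property. *)
Lemma chord_mean n p i : (n <= p)%N -> (2 ^ (p - n))%N%:R * chord n i <=
  \sum_(0 <= l < (2 ^ (p - n))%N) chord p (i * 2 ^ (p - n) + l)%N.
Proof.
move=> np; set m := (2 ^ (p - n))%N; rewrite /chord.
have dp := mesh_gt0 p; have dn := mesh_gt0 n.
have -> : m%:R * (d (u (i%:R * mesh n)) (u (i.+1%:R * mesh n)) / mesh n) =
    d (u (i%:R * mesh n)) (u (i.+1%:R * mesh n)) / mesh p.
  rewrite (mesh_refine np) -/m; field; rewrite gt_eqF//= pnatr_eq0 -lt0n expn_gt0//.
rewrite -mulr_suml ler_wpM2r ?invr_ge0 ?(ltW dp)//.
have := dist_sum_le0 (fun k => u (k%:R * mesh p)) (i * m)%N m.
by rewrite (mesh_refine np) -/m !mulrA -!natrM mulSn addnC.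
Qed.

Lemma polygon_speed_refine n p s : (n <= p)%N -> 0 <= s ->
  polygon_speed n s = step (mesh p) (fun j => chord n (j %/ 2 ^ (p - n))%N) s.
Proof.
move=> np s0; set m := (2 ^ (p - n))%N.
have m0 : (0 < m)%N by rewrite expn_gt0.
have [h1 h2] := truncn_div_itv (mesh_gt0 p) s0.
rewrite [RHS]/step; set j := Num.truncn _ in h1 h2 *.
have dp := mesh_gt0 p.
apply: step_itv; first exact: mesh_gt0.
  apply: le_trans h1; rewrite (mesh_refine np) -/m mulrA -natrM ler_wpM2r ?(ltW dp)//.
  by rewrite ler_nat leq_trunc_div.
apply: lt_le_trans h2 _; rewrite (mesh_refine np) -/m [leRHS]mulrA -natrM ler_wpM2r ?(ltW dp)//.
by rewrite ler_nat ltn_ceil.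
Qed.

Local Notation mu := (@lebesgue_measure R).

Lemma polygon_energyE n :
  (\int[mu]_(s in `[0%R, T[) (polygon_speed n s ^+ 2)%:E)%E = (polygon_energy n)%:E.
Proof.
rewrite -[X in `[0%R, X[](mesh_pow n) /polygon_energy -integral_step0 ?mesh_gt0//.
by move=> k; exact: sqr_ge0.
Qed.

(** The left side is the squared L^2 distance between the speeds of levels [n] and [p], so bounded
    energies make the speeds a Cauchy sequence in L^2. *)
Lemma polygon_sq_diff n p : (n <= p)%N ->
  mesh p * \sum_(0 <= j < (2 ^ p)%N) (chord p j - chord n (j %/ 2 ^ (p - n))%N) ^+ 2 <=
  polygon_energy p - polygon_energy n.
Proof.
move=> np; have := @block_variance R (chord p) (chord n) (2 ^ n)%N (2 ^ (p - n))%N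
  (chord_ge0 n) (fun i => chord_mean i np).
rewrite expn_gt0 -expnD subnKC// => /(_ isT) h.
rewrite /polygon_energy (mesh_refine np).
have := ler_wpM2l (ltW (mesh_gt0 p)) h.
by rewrite mulrBr mulrA [mesh p * _%:R]mulrC.
Qed.

Lemma polygon_energy_nd n p : (n <= p)%N -> polygon_energy n <= polygon_energy p.
Proof.
move=> np; rewrite -subr_ge0; apply: le_trans (polygon_sq_diff np).
by rewrite mulr_ge0 ?(ltW (mesh_gt0 p))// sumr_ge0// => i _; exact: sqr_ge0.
Qed.

Lemma polygon_L1_diff n p t : (n <= p)%N -> 0 < t ->
  (\int[mu]_(s in `[0%R, T[) `|polygon_speed p s - polygon_speed n s|%:E <=
   (2^-1 * (t * (polygon_energy p - polygon_energy n) + T * t^-1))%:E)%E.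
Proof.
move=> np t0; pose y j := chord p j - chord n (j %/ 2 ^ (p - n))%N.
have -> : (\int[mu]_(s in `[0%R, T[) `|polygon_speed p s - polygon_speed n s|%:E =
    \int[mu]_(s in `[0%R, T[) (step (mesh p) (fun j => `|y j|) s)%:E)%E.
  apply: eq_integral => s; rewrite inE/= in_itv/= => /andP[s0 _].
  by rewrite (polygon_speed_refine np s0).
rewrite -[X in `[0%R, X[](mesh_pow p) integral_step0 ?mesh_gt0// lee_fin.
have := sum_abs_le_sq y (2 ^ p)%N t0; move=> /(ler_wpM2l (ltW (mesh_gt0 p))) /le_trans; apply.
have := polygon_sq_diff np; rewrite -/(y _); move=> /(ler_wpM2l (ltW t0)).
have : mesh p * ((2 ^ p)%N%:R * t^-1) = T * t^-1 by rewrite mulrA [mesh p * _]mulrC mesh_pow.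
rewrite /y; move: (\sum_(_ <= _ < _) _) (mesh p) => a b; rewrite -/(polygon_energy p); lra.
Qed.

Hypothesis cu : forall e, 0 < e -> exists2 r, 0 < r & forall s t,
  0 <= s -> s <= T -> 0 <= t -> t <= T -> `|s - t| < r -> d (u s) (u t) < e.

(** Between the first node after [s] and the last node before [t] the sum of the chords is an
    integral of the speed; the two end pieces are no longer than the mesh, and uniform continuity
    bounds each by [e / 2]. *)
Lemma dist_le_polygon_speed e : 0 < e -> exists N, forall n s t, (N <= n)%N ->
  0 <= s -> s <= t -> t <= T ->
  ((d (u s) (u t))%:E <= e%:E + \int[mu]_(x in `[s, t[) (polygon_speed n x)%:E)%E.
Proof.
move=> e0; have [r r0 hr] := cu (divr_gt0 e0 (ltr0Sn _ 1)).
have [N hN] := mesh_small r0; exists N => n s t Nn s0 st tT.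
have dn0 := mesh_gt0 n; have hdn := hN n Nn.
have t0 : 0 <= t by lra.
have [s1 s2] := truncn_div_itv dn0 s0; have [t1 t2] := truncn_div_itv dn0 t0.
set i := Num.truncn _ in s1 s2; set j := Num.truncn _ in t1 t2.
have I0 : (0 <= \int[mu]_(x in `[s, t[) (polygon_speed n x)%:E)%E.
  by apply: integral_ge0 => x _; rewrite lee_fin chord_ge0.
have [ij|ij] := leqP i.+1 j; last first.
  rewrite -[leLHS]adde0; apply: leeD => //; rewrite lee_fin.
  have tj : t < i.+1%:R * mesh n.
    by apply: lt_le_trans t2 _; rewrite ler_wpM2r ?(ltW dn0)// ler_nat.
  have : d (u s) (u t) < e / 2.
    apply: hr => //; first exact: le_trans st tT.
    by rewrite distrC ger0_norm ?subr_ge0//; move: tj; rewrite -natr1 mulrDl mul1r; lra.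
  lra.
have si : i.+1%:R * mesh n <= j%:R * mesh n by rewrite ler_wpM2r ?(ltW dn0)// ler_nat.
have h1 : d (u s) (u (i.+1%:R * mesh n)) < e / 2.
  apply: hr => //; rewrite ?mulr_ge0 ?(ltW dn0)//; try lra.
  by rewrite distrC ger0_norm ?subr_ge0 ?(ltW s2)//; move: s1; rewrite -natr1 mulrDl mul1r; lra.
have h2 : d (u (j%:R * mesh n)) (u t) < e / 2.
  apply: hr => //; rewrite ?mulr_ge0 ?(ltW dn0)//; try lra.
  by rewrite distrC ger0_norm ?subr_ge0//; move: t2; rewrite -natr1 mulrDl mul1r; lra.
have h3 := dist_sum_le (fun k => u (k%:R * mesh n)) i.+1 (j - i.+1)%N.
rewrite subnKC// in h3.
have h4 : ((d (u (i.+1%:R * mesh n)) (u (j%:R * mesh n)))%:E <=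
    \int[mu]_(x in `[(i.+1%:R * mesh n)%R, (j%:R * mesh n)%R[) (polygon_speed n x)%:E)%E.
  have := integral_step i.+1 (j - i.+1)%N dn0 (chord_ge0 n).
  rewrite subnKC// /polygon_speed => ->; rewrite lee_fin; apply: le_trans h3 _.
  rewrite mulr_sumr; apply: ler_sum => k _; rewrite /chord [leRHS]mulrC divfK ?gt_eqF//.
have h5 : (\int[mu]_(x in `[(i.+1%:R * mesh n)%R, (j%:R * mesh n)%R[) (polygon_speed n x)%:E <=
    \int[mu]_(x in `[s, t[) (polygon_speed n x)%:E)%E.
  apply: ge0_subset_integral => //.
  - by apply/measurable_EFinP; exact: measurable_step.
  - by move=> x _; rewrite lee_fin chord_ge0.
  - by apply: subset_itv; rewrite bnd_simp ?(ltW s2).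
apply: (@le_trans _ _ (e%:E + (d (u (i.+1%:R * mesh n)) (u (j%:R * mesh n)))%:E)%E).
  rewrite -EFinD lee_fin.
  have := dist_triangle hd (u s) (u (i.+1%:R * mesh n)) (u t).
  have := dist_triangle hd (u (i.+1%:R * mesh n)) (u (j%:R * mesh n)) (u t).
  lra.
by rewrite leeD2l//; exact: le_trans h4 h5.
Qed.

End polygon.

(** * The speed of a curve of finite energy *)

Section speed.
Variables (R : realType) (S : Type) (d : S -> S -> R).
Hypothesis hd : metric_space d.
Variables (u : R -> S) (T K : R).
Hypothesis T0 : 0 < T.
Hypothesis cu : forall e, 0 < e -> exists2 r, 0 < r & forall s t,
  0 <= s -> s <= T -> 0 <= t -> t <= T -> `|s - t| < r -> d (u s) (u t) < e.
Hypothesis EK : forall n, polygon_energy d u T n <= K.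

Local Notation mu := (@lebesgue_measure R).
Local Notation E := (polygon_energy d u T).
Local Notation M := (polygon_speed d u T).
Local Notation md := (metric_deriv d `[0%R, +oo[%classic u).

Lemma polygon_speed_ge0 n x : 0 <= M n x.
Proof. exact: chord_ge0. Qed.

Lemma measurable_polygon_speed D n : measurable_fun D (M n).
Proof. by apply: measurable_step; exact: mesh_gt0. Qed.

Lemma energy_extraction : exists2 sg, extraction sg &
  forall k p, (sg k <= p)%N -> E p - E (sg k) <= (4 ^ k)%N%:R^-1.
Proof.
pose P k n := forall p, (n <= p)%N -> E p - E n <= (4 ^ k)%N%:R^-1.
apply: (@frequently_extraction_dep P) => k N.
have : cvgn E.
  apply: nondecreasing_is_cvgn; first by move=> n p; exact: polygon_energy_nd.
  by exists K => _ [n _ <-].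
move=> /cvg_ex[l hl]; have e0 : 0 < ((4 ^ k)%N%:R^-1 : R) by rewrite invr_gt0 ltr0n expn_gt0.
move/cvgrPdist_lt : hl => /(_ _ (divr_gt0 e0 (ltr0Sn _ 1)))[N' _ hN'].
exists (maxn N N'); first exact: leq_maxl.
move=> p hp; have h1 := hN' _ (leq_maxr N N'); have := hN' p (leq_trans (leq_maxr N N') hp).
move: h1; rewrite /= !ltr_norml => /andP[_ h2] /andP[h3 _].
by move: (_^-1) h2 h3 => a; lra.
Qed.

(** Along the extraction the L^1 distances of consecutive speeds are summable, so [g] is an
    integrable majorant. It gives convergence almost everywhere and dominated convergence on every
    subinterval, by which the approximate bound on distances passes to the limit. *)
Lemma limit_speed : exists (f : nat -> nat) (m : R -> R), [/\ extraction f,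
  (forall x, 0 <= m x),
  mu.-integrable `[0%R, T[ (EFin \o m),
  {ae mu, forall x, `[0%R, T[%classic x -> (fun k => M (f k) x) @ \oo --> m x} &
  forall s t, 0 <= s -> s <= t -> t <= T ->
    ((d (u s) (u t))%:E <= \int[mu]_(x in `[s, t[) (m x)%:E)%E].
Proof.
have [sg hs hE] := energy_extraction.
pose f k := M (sg k); pose D : set R := `[0%R, T[%classic.
have mf k D' : measurable_fun D' (EFin \o f k).
  by apply/measurable_EFinP; exact: measurable_polygon_speed.
have mdf k D' : measurable_fun D' (fun x => `|f k.+1 x - f k x|%:E).
  apply/measurable_EFinP; apply: measurableT_comp => //.
  by apply: measurable_funB; exact: measurable_polygon_speed.
have L1 k : (\int[mu]_(x in D) `|f k.+1 x - f k x|%:E <= ((1 + T) / (2 ^ k.+1)%:R)%:E)%E.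
  (* The weight 2^k balances the energy gap 4^-k: both terms of the L^1 bound become multiples of
     2^-k. *)
  have t0 : 0 < ((2 ^ k)%N%:R : R) by rewrite ltr0n expn_gt0.
  apply: le_trans (polygon_L1_diff hd u T0 (ltnW (hs k)) t0) _.
  rewrite lee_fin; have := hE k _ (ltnW (hs k)).
  move=> /(ler_wpM2l (ltW t0)).
  have -> : (2 ^ k)%N%:R * (4 ^ k)%N%:R^-1 = (2 ^ k)%N%:R^-1 :> R.
    rewrite (_ : 4 = 2 * 2)%N// expnMn natrM invfM mulrA divff ?mul1r// gt_eqF//.
  rewrite expnS natrM invfM.
  move: ((2 ^ k)%:R^-1) => a; move: (_ * (_ - _)) => b; lra.
pose sr x := (\sum_(k <oo) `|f k.+1 x - f k x|%:E)%E.
pose g x := ((f 0%N x)%:E + sr x)%E.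
have sr0 x : (0 <= sr x)%E by apply: nneseries_ge0 => k _ _; rewrite lee_fin.
have mD : @measurable _ (measurableTypeR R) D by exact: measurable_itv.
have msr : measurable_fun D sr.
  by apply: (ge0_emeasurable_sum (P := xpredT)) => [k x _ _|k _]; [rewrite lee_fin|exact: mdf].
have mg : measurable_fun D g by apply: emeasurable_funD => //; exact: mf.
have f0 k x : 0 <= f k x by exact: polygon_speed_ge0.
have g0 x : (0 <= g x)%E by rewrite adde_ge0// lee_fin.
have If0 : (\int[mu]_(x in D) (f 0%N x)%:E < +oo)%E.
  apply: (@le_lt_trans _ _ (\int[mu]_(x in D) ((1 + f 0%N x ^+ 2)%:E))%E).
    apply: ge0_le_integral => //=.
    - by move=> x _; rewrite lee_fin.
    - exact: mf.
    - apply/measurable_EFinP; apply: measurable_funD => //.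
      by apply: measurable_funX; exact: measurable_polygon_speed.
    - by move=> x _; rewrite lee_fin; have := sqr_ge0 (f 0%N x - 1); nra.
  under eq_integral do rewrite EFinD.
  rewrite ge0_integralD//=; last 2 first.
  - by move=> x _; rewrite lee_fin sqr_ge0.
  - by apply/measurable_EFinP; apply: measurable_funX; exact: measurable_polygon_speed.
  rewrite (polygon_energyE d u T0) integral_cst//= /D lebesgue_measure_itv/= lte_fin T0.
  by rewrite mul1e -EFinB -EFinD ltry.
have ig : mu.-integrable D g.
  apply/integrableP; split => //.
  under eq_integral do rewrite gee0_abs//.
  rewrite ge0_integralD//=; last 2 first.
  - by move=> x _; rewrite lee_fin.
  - exact: mf.
  rewrite lte_add_pinfty//.
  rewrite integral_nneseries//; last by move=> k; exact: mdf.
  apply: (@le_lt_trans _ _ (\sum_(k <oo) ((1 + T) / (2 ^ k.+1)%:R)%:E)%E).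
    apply: lee_nneseries => [k *|k *]; last exact: L1.
    by apply: integral_ge0 => x _; rewrite lee_fin.
  apply: (@le_lt_trans _ _ (1 + T)%:E); last exact: ltry.
  by apply: epsilon_trick0; rewrite addr_ge0// ltW.
pose mE x := limn_einf (fun k => (f k x)%:E).
(* [fine] sends an infinite lower limit to 0; on [0, T) this happens on a null set only, and [m] is
   real, nonnegative and measurable everywhere. *)
pose m x := fine (mE x).
have mE0 x : (0 <= mE x)%E.
  rewrite /mE limn_einf_lim; apply: lime_ge; first exact: is_cvg_einfs.
  by apply: nearW => n; apply: le_ereal_inf_tmp => _ [k _ <-]; rewrite lee_fin.
have part x n : (\sum_(0 <= k < n) `|f k.+1 x - f k x|)%:E%E = (\sum_(0 <= k < n) `|f k.+1 x - f k x|%:E)%E.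
  by rewrite sumEFin.
have fg x n : ((f n x)%:E <= g x)%E.
  apply: (@le_trans _ _ ((f 0%N x + \sum_(0 <= k < n) `|f k.+1 x - f k x|)%:E)).
    rewrite lee_fin -lerBlDl -(telescope_sumr (fun k => f k x) (leq0n n)); apply: ler_sum => k _; exact: ler_norm.
  rewrite EFinD leeD2l// part; apply: nneseries_lim_ge => k _ _; by rewrite lee_fin.
have aecv : {ae mu, forall x, D x -> (fun k => f k x) @ \oo --> m x}.
  have := integrable_ae mD ig; apply: filterS => x h Dx; have gfin := h Dx.
  have [l hl] : exists l : R, (fun k => f k x) @ \oo --> l.
    apply: (@cvg_bounded_variation _ _ (fine (g x))) => n.
    rewrite -lee_fin fineK// part.
    apply: (@le_trans _ _ (sr x)); first by apply: nneseries_lim_ge => k _ _; rewrite lee_fin.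
    by rewrite /g leeDr// lee_fin.
  suff -> : m x = l by [].
  have : (fun k => (f k x)%:E) @ \oo --> l%:E by apply: cvg_EFin => //; exact: nearW.
  by move=> /cvg_limn_einf_sup[]; rewrite /m /mE => ->.
have mm D' : measurable_fun D' m.
  apply: measurableT_comp; first exact: fine_measurable.
  by apply: measurable_fun_limn_einf => n; exact: mf.
have dom D' : @measurable _ (measurableTypeR R) D' -> D' `<=` D ->
    mu.-integrable D' (EFin \o m) /\
    (fun n => \int[mu]_(x in D') (f n x)%:E)%E @ \oo --> (\int[mu]_(x in D') (m x)%:E)%E.
  move=> mD' D'D.
  have [|||||h1 _ h2] := @dominated_convergence _ _ R mu D' mD' (fun n x => (f n x)%:E)
    (EFin \o m) g.
  - by move=> n; exact: mf.
  - by apply/measurable_EFinP; exact: mm.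
  - apply: (@filterS _ _ (ae_filter_ringOfSetsType mu) _ _ _ aecv) => x h /D'D /h hx.
    by apply: cvg_EFin => //; exact: nearW.
  - exact: integrableS ig.
  - by apply: aeW => x n _; rewrite gee0_abs ?lee_fin.
  by [].
exists sg, m; split=> //.
- by move=> x; apply: fine_ge0.
- by have [] := dom D mD (@subset_refl _ D).
- move=> s t s0 st tT; have DD : `[s, t[%classic `<=` D.
    by apply: subset_itv; rewrite bnd_simp.
  have [_ cv] := dom _ (measurable_itv _) DD.
  apply/lee_addgt0Pr => e e0; rewrite addeC.
  have cv2 : (fun n => e%:E + \int[mu]_(x in `[s, t[) (f n x)%:E)%E @ \oo -->
      (e%:E + \int[mu]_(x in `[s, t[) (m x)%:E)%E.
    by apply: cvgeD => //; exact: cvg_cst.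
  have [N hN] := dist_le_polygon_speed hd T0 cu e0.
  rewrite -(cvg_lim _ cv2)//; apply: lime_ge; first by apply/cvg_ex; eexists; exact: cv2.
  exists N => // n /= Nn; apply: hN => //; exact: leq_trans Nn (extraction_ge hs n).
Qed.

(** If a, b are the end points of the cell of [x] and [q] bounds the quotients near [x], then
    passing through u(x) gives d(u a, u b) <= q (x - a) + q (b - x) = q (b - a). *)
Lemma polygon_limit_le_metric_deriv (f : nat -> nat) x (l : R) : extraction f -> 0 <= x ->
  (fun k => M (f k) x) @ \oo --> l -> (l%:E <= md x)%E.
Proof.
move=> hf x0 hl; apply: le_ereal_inf_tmp => _ [r r0 <-].
set Q := ereal_sup _.
have Q0 : (0 <= Q)%E by apply: ereal_sup_ubound; left.
case EQ : Q Q0 => [q| |//] Q0; last by rewrite leey.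
rewrite lee_fin in Q0.
have hq s : 0 <= s -> `|s - x| < r -> d (u s) (u x) <= q * `|s - x|.
  move=> s0 sr; have [->|sx] := eqVneq s x; first by rewrite (dist_xx hd) mulr_ge0.
  have sx0 : 0 < `|s - x| by rewrite normr_gt0 subr_eq0.
  rewrite -ler_pdivrMr// -lee_fin -EQ; apply: ereal_sup_ubound; right; exists s => //=.
  by rewrite in_itv/= s0 sx0.
rewrite lee_fin; apply/ler_addgt0Pl => e e0.
move/cvgrPdist_lt : hl => /(_ _ e0)[N1 _ hN1]; have [N2 hN2] := mesh_small T0 r0.
pose k := maxn N1 N2; have := hN1 k (leq_maxl _ _).
have := hN2 (f k) (leq_trans (leq_maxr _ _) (extraction_ge hf k)).
set n := f k => hmesh; rewrite /= ltr_norml => /andP[_].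
have dn0 := mesh_gt0 T0 n; have [h1 h2] := truncn_div_itv dn0 x0.
suff : M n x <= q by move=> hM hl; apply/ltW; apply: lt_le_trans (_ : _ < e + M n x) _; lra.
rewrite /polygon_speed /step /chord; set i := Num.truncn _ in h1 h2 *.
rewrite ler_pdivrMr//.
have hi : i.+1%:R * mesh T n = i%:R * mesh T n + mesh T n by rewrite -natr1 mulrDl mul1r.
have a0 : 0 <= i%:R * mesh T n by rewrite mulr_ge0// ltW.
have := dist_triangle hd (u (i%:R * mesh T n)) (u x) (u (i.+1%:R * mesh T n)).
have b0 : 0 <= i.+1%:R * mesh T n by lra.
have := hq _ a0; rewrite distrC ger0_norm ?subr_ge0// => ha.
have := hq _ b0; rewrite ger0_norm ?subr_ge0 ?(ltW h2)// => hb.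
rewrite (distC hd (u x)); rewrite hi in h2 hb *.
have {}ha := ha (le_lt_trans (_ : _ <= mesh T n) hmesh).
have {}hb := hb (le_lt_trans (_ : _ <= mesh T n) hmesh).
have := ha _; have := hb _.
move=> /(_ ltac:(lra)) hb' /(_ ltac:(lra)) ha'; lra.
Qed.

(** d(u s, u x) is at most m(x) |s - x| plus the integral of |m - m(x)| between the two times, and
    the latter is o(|s - x|) at a Lebesgue point. *)
Lemma metric_deriv_le_density (m : R -> R) : (forall x, 0 <= m x) ->
  mu.-integrable `[0%R, T[ (EFin \o m) ->
  (forall s t, 0 <= s -> s <= t -> t <= T ->
    ((d (u s) (u t))%:E <= \int[mu]_(x in `[s, t[) (m x)%:E)%E) ->
  {ae mu, forall x, `]0%R, T[%classic x -> (md x <= (m x)%:E)%E}.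
Proof.
move=> m0 im hm; pose h := m \_ (`[0%R, T[%classic : set R).
have lh : locally_integrable setT h by exact: integrable_locally im.
have mh : measurable_fun setT h by case: lh.
have hE x : 0 <= x -> x < T -> h x = m x.
  by move=> x0 xT; rewrite /h /patch ifT// inE/= in_itv/= x0.
apply: (@filterS _ _ (ae_filter_ringOfSetsType mu) _ _ _ (lebesgue_differentiation lh)) => x hx.
rewrite /= in_itv/= => /andP[x0 xT].
apply/lee_addgt0Pr => e e0; rewrite -EFinD.
(* A ball of radius 2 |s - x| has measure 4 |s - x|, which turns [e / 4] into [e]. The radius is
   doubled because balls are open and the interval may contain a point at distance exactly |s - x|
   from [x]. *)
have e40 : 0 < e / 4 by lra.
have /at_right0P[r1 r10 hr1] : \forall r \near 0^'+, (davg h x r < (e / 4)%:E)%E.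
  have /hx : nbhs (0%E : \bar R) [set y | (y < (e / 4)%:E)%E]; last by [].
  by apply: open_nbhs_nbhs; split; [exact: open_ereal_lt_ereal|rewrite /= lte_fin].
(* The bounds [x] and [T - x] keep [s] inside (0, T), where the extension by zero [h] agrees with
   [m]. *)
pose r := Num.min (r1 / 2) (Num.min x (T - x)).
have r0 : 0 < r by rewrite /r !lt_min x0 subr_gt0 xT divr_gt0.
apply: le_trans (ereal_inf_lbound (ex_intro2 _ _ r r0 erefl)) _.
have rhs0 : 0 <= m x + e by rewrite addr_ge0// ltW.
apply: ge_ereal_sup => _ [->|[s [Is /andP[s1 s2]] <-]]; first by rewrite lee_fin.
rewrite lee_fin ler_pdivrMr//.
have [hs1 hs2] : 2 * `|s - x| < r1 /\ (`|s - x| < x /\ `|s - x| < T - x).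
  by move: s2; rewrite /r !lt_min => /andP[? /andP[-> ->]]; split=> //; lra.
have key a b : a < b -> 0 <= a -> b < T -> `|s - x| = b - a -> (x = a \/ x = b) ->
    d (u a) (u b) <= (m x + e) * (b - a).
  move=> ab a0 bT sxE xab; have xa : a <= x <= b by case: xab => ->; rewrite lexx ltW.
  have ba0 : 0 < b - a by rewrite subr_gt0.
  pose rho := 2 * (b - a); have rho0 : 0 < rho by rewrite /rho; lra.
  have := hr1 rho rho0; rewrite /rho -sxE => /(_ hs1); rewrite sxE -/rho => hd1.
  have mabs : measurable_fun setT (fun y => `|(h y - h x)%:E|%E).
    apply: measurableT_comp => //; apply/measurable_EFinP; exact: measurable_funB.
  have I1 : (\int[mu]_(y in ball x rho) `|(h y - h x)%:E| <= (e * (b - a))%:E)%E.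
    have := ltW hd1; rewrite /davg /iavg lebesgue_measure_ball ?(ltW rho0)// inver.
    rewrite mulrn_eq0/= gt_eqF// lee_pdivrMl ?mulrn_wgt0// => /le_trans; apply.
    by rewrite -EFinM lee_fin -mulr_natl /rho; lra.
  have sub : `[a, b[%classic `<=` ball x rho.
    move=> y /=; rewrite in_itv/= => /andP[y1 y2]; rewrite /ball/= ltr_norml.
    by move: xa => /andP[x1 x2]; rewrite /rho; apply/andP; split; lra.
  have I2 : (\int[mu]_(y in `[a, b[) `|(h y - h x)%:E| <= (e * (b - a))%:E)%E.
    apply: le_trans I1; apply: ge0_subset_integral => //; first exact: measurable_ball.
    exact: measurable_funTS.
  have I3 : ((d (u a) (u b))%:E <= \int[mu]_(y in `[a, b[) ((m x)%:E + `|(h y - h x)%:E|))%E.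
    apply: le_trans (hm _ _ a0 (ltW ab) (ltW bT)) _.
    apply: ge0_le_integral_nomeas => y /=; first by rewrite lee_fin.
    rewrite in_itv/= => /andP[y1 y2]; rewrite /= -EFinD lee_fin.
    have y0 : 0 <= y := le_trans a0 y1.
    rewrite (hE y y0 (lt_trans y2 bT)) (hE x (ltW x0) xT).
    by have := ler_norm (m y - m x); lra.
  rewrite -lee_fin; apply: le_trans I3 _.
  rewrite ge0_integralD//=; last 2 first.
  - by move=> y _; rewrite lee_fin.
  - exact: measurable_funTS.
  rewrite integral_cst//= lebesgue_measure_itv/= lte_fin ab -EFinB -EFinM.
  by apply: le_trans (leeD2l _ I2) _; rewrite -EFinD lee_fin mulrDl.
move: s1; rewrite normr_gt0 subr_eq0 => sx.
case/orP : (lt_total sx) => [sltx|xlts].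
- have E1 : `|s - x| = x - s by rewrite distrC ger0_norm// subr_ge0 ltW.
  have hs0 : 0 <= s by lra.
  by have h1 := key s x sltx hs0 xT E1 (or_intror erefl); rewrite -E1 in h1; exact: h1.
- have E1 : `|s - x| = s - x by rewrite ger0_norm// subr_ge0 ltW.
  have sT : s < T by lra.
  have h1 := key x s xlts (ltW x0) sT E1 (or_introl erefl).
  by rewrite -E1 (distC hd) in h1; exact: h1.
Qed.

Hypothesis mmd : @measurable_fun _ _ (measurableTypeR R) _ `[0%R, +oo[%classic md.

Lemma measurable_metric_deriv_itv b0 b1 a b : 0 <= a ->
  @measurable_fun _ _ (measurableTypeR R) _ [set` Interval (BSide b0 a) (BSide b1 b)] md.
Proof.
move=> a0; apply: measurable_funS mmd => //.
move=> x /=; rewrite !in_itv/= andbT => /andP[+ _].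
by case: b0 => /= => [|/ltW] /(le_trans a0).
Qed.

(** On (0, T) the limit [m] of the polygon speeds coincides with the metric derivative almost
    everywhere: md <= m serves the energy through Fatou's lemma, m <= md serves the distances. *)
Theorem speed_energy :
  (\int[mu]_(x in `[0%R, T]) (md x ^+ 2) <= K%:E)%E /\
  forall s t, 0 <= s -> s <= t -> t <= T ->
    ((d (u s) (u t))%:E <= \int[mu]_(x in `[s, t]) md x)%E.
Proof.
have [f [m [hf m0 im aecv hm]]] := limit_speed.
have mdm := metric_deriv_le_density m0 im hm.
have mdge x : (0 <= md x)%E := metric_deriv_ge0 d _ u x.
split; last first.
  move=> s t s0 st tT; rewrite -integral_itv_bndo_bndc; last exact: measurable_metric_deriv_itv.
  apply: le_trans (hm _ _ s0 st tT) _; apply: ae_ge0_le_integral => //.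
  - by move=> x _; rewrite lee_fin.
  - apply: measurable_funS (measurable_int _ im) => //.
    by apply: subset_itv; rewrite bnd_simp.
  - exact: measurable_metric_deriv_itv.
  - apply: (@filterS _ _ (ae_filter_ringOfSetsType mu) _ _ _ aecv) => x hx /=.
    rewrite in_itv/= => /andP[x1 x2]; have x0 := le_trans s0 x1.
    have Dx : `[0%R, T[%classic x by rewrite /= in_itv/= x0 (lt_le_trans x2).
    exact: polygon_limit_le_metric_deriv hf x0 (hx Dx).
have mmd2 b0 b1 : @measurable_fun _ _ (measurableTypeR R) _
    [set` Interval (BSide b0 0%R) (BSide b1 T)] (fun x => md x ^+ 2)%E.
  by apply: emeasurable_funM; exact: measurable_metric_deriv_itv.
rewrite integral_itv_bndoo; last exact: mmd2.
pose F k x := ((M (f k) x ^+ 2)%:E : \bar R).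
have mF k D : @measurable_fun _ _ (measurableTypeR R) _ D (F k).
  by apply/measurable_EFinP; apply: measurable_funX; exact: measurable_polygon_speed.
have F0 k x : (0 <= F k x)%E by rewrite lee_fin sqr_ge0.
apply: (@le_trans _ _ (\int[mu]_(x in `]0%R, T[) limn_einf (F^~ x))%E).
  apply: ae_ge0_le_integral => //.
  - by move=> x _; rewrite expe2 mule_ge0.
  - move=> x _; rewrite limn_einf_lim; apply: lime_ge; first exact: is_cvg_einfs.
    by apply: nearW => n; apply: le_ereal_inf_tmp => _ [k _ <-].
  - by apply: measurable_fun_limn_einf.
  - apply: (@filterS2 _ _ (ae_filter_ringOfSetsType mu) _ _ _ _ aecv mdm) => x hx hmx Dx.
    have := Dx; rewrite /= in_itv/= => /andP[x0 xT].
    have cv : (fun k => F k x) @ \oo --> (m x ^+ 2)%:E.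
      apply: cvg_EFin; first exact: nearW.
      have := hx; rewrite /= in_itv/= (ltW x0) xT => /(_ isT) h.
      by apply: cvgM.
    rewrite (cvg_limn_einf_sup cv).1.
    have /hmx := Dx; have := mdge x; case: (md x) => [y| |] // y0 yx.
    by rewrite -EFinM lee_fin; rewrite !lee_fin in y0 yx; exact: ler_pM.
apply: le_trans (fatou _ _ _ _) _ => //.
rewrite limn_einf_lim; apply: lime_le; first exact: is_cvg_einfs.
apply: nearW => n; apply: (@le_trans _ _ (\int[mu]_(x in `]0%R, T[) F n x)%E).
  by apply: ereal_inf_lbound; exists n => /=.
apply: (@le_trans _ _ (\int[mu]_(x in `[0%R, T[) F n x)%E).
  apply: ge0_subset_integral => //; apply: subset_itv; by rewrite bnd_simp.
by rewrite (polygon_energyE d u T0) lee_fin.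
Qed.

End speed.

(** * The discrete scheme *)

Section discrete_scheme.
Variable R : realType.

Lemma sqr_sum_le (x : nat -> R) i n :
  (\sum_(i <= k < i + n) x k) ^+ 2 <= n%:R * \sum_(i <= k < i + n) x k ^+ 2.
Proof.
case: n => [|n]; first by rewrite addn0 !big_geq// expr0n/= mulr0.
set N := n.+1; set s := \sum_(_ <= _ < _) x _.
have N0 : 0 < (N%:R : R) by rewrite ltr0n.
have : 0 <= \sum_(i <= k < i + N) (x k - s / N%:R) ^+ 2.
  by apply: sumr_ge0 => k _; exact: sqr_ge0.
have -> : \sum_(i <= k < i + N) (x k - s / N%:R) ^+ 2 =
    \sum_(i <= k < i + N) x k ^+ 2 - s ^+ 2 / N%:R.
  transitivity (\sum_(i <= k < i + N) (x k ^+ 2 - 2 * (s / N%:R) * x k + (s / N%:R) ^+ 2)).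
    by apply: eq_bigr => k _; ring.
  rewrite big_split/= sumrB -mulr_sumr -/s big_const_nat addKn iter_addr_0 -[_ *+ N]mulr_natl.
  by field; rewrite gt_eqF.
rewrite subr_ge0 => h; have := ler_wpM2l (ltW N0) h.
by rewrite mulrC divfK ?gt_eqF.
Qed.

(** The estimate is implicit, as the sum contains the term [a n] itself. Moving it to the left costs
    a factor 1/(1 - x), which is at most 1 + 2x when 2x <= 1. *)
Lemma discrete_gronwall (x K : R) (a : nat -> R) N : 0 <= x -> 2 * x <= 1 -> 0 <= K ->
  (forall n, 0 <= a n) ->
  (forall n, (n <= N)%N -> a n <= K + x * \sum_(0 <= k < n) a k.+1) ->
  a N <= K * expR (2 * x * N%:R).
Proof.
move=> x0 x1 K0 a0 h.
pose s n := K + x * \sum_(0 <= k < n) a k.+1.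
have s0 n : 0 <= s n.
  by rewrite addr_ge0// mulr_ge0// sumr_ge0// => k _; exact: a0.
have hs n : (n <= N)%N -> s n <= K * (1 + 2 * x) ^+ n.
  elim: n => [_|n IH nN]; first by rewrite /s big_geq// mulr0 addr0 expr0 mulr1.
  have h1 : s n.+1 <= s n + x * s n.+1.
    rewrite {1}/s big_nat_recr//= mulrDr addrA lerD2l ler_wpM2l//; exact: h.
  have h2 : s n.+1 <= (1 + 2 * x) * s n.
    have hx : 0 <= 1 - 2 * x by lra.
    have h3 := mulr_ge0 (mulr_ge0 x0 hx) (s0 n.+1).
    have h4 : 0 <= (1 + 2 * x) * (s n + x * s n.+1 - s n.+1) by rewrite mulr_ge0//; lra.
    nra.
  apply: le_trans h2 _; rewrite exprS mulrCA ler_wpM2l//; first lra.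
  by apply: IH; exact: ltnW.
apply: le_trans (h N (leqnn N)) _; apply: le_trans (hs N (leqnn N)) _.
rewrite ler_wpM2l// [2 * x * _]mulrC expRM_natl lerXn2r ?nnegrE ?expR_ge0 ?expR_ge1Dx//; lra.
Qed.

(** * A priori bounds along one discrete trajectory *)

Section energy.
Variables (S : Type) (d : S -> S -> R) (A B : R) (us : S).
Hypothesis hd : metric_space d.
Hypothesis B0 : 0 < B.
Variables (tau gam : R) (V : nat -> S) (F Y : nat -> R).
Hypothesis tau0 : 0 < tau.
Hypothesis step_le : forall n, F n.+1 + d (V n) (V n.+1) ^+ 2 / (2 * tau) <= Y n + gam * tau.

(** The differences [F n - Y n] are kept beside the kinetic sum: divided by [tau] they are the
    quotients of the first assertion and produce the slope term in the limit. *)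
Lemma discrete_energy N :
  F N + \sum_(0 <= n < N) d (V n) (V n.+1) ^+ 2 / (2 * tau)
      + \sum_(0 <= n < N) (F n - Y n) <= F 0%N + gam * (N%:R * tau).
Proof.
elim: N => [|N IH]; first by rewrite !big_geq// mul0r mulr0 !addr0.
rewrite !big_nat_recr//=; have := step_le N.
have -> : gam * (N.+1%:R * tau) = gam * (N%:R * tau) + gam * tau by rewrite -natr1; ring.
set a := d _ _ ^+ 2 / _; move: IH; set b := \sum_(_ <= _ < _) _; set c := \sum_(_ <= _ < _) _.
by move: (gam * _) => e; lra.
Qed.

Hypothesis Yle : forall n, Y n <= F n.
Hypothesis lbF : forall n, - A - B * d (V n) us ^+ 2 <= F n.
Hypothesis gam1 : gam <= 1.
Hypothesis tauB : 16 * B * tau <= 1.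

Lemma discrete_energy_le N T : N%:R * tau <= T ->
  F N + \sum_(0 <= n < N) d (V n) (V n.+1) ^+ 2 / (2 * tau) <= F 0%N + T.
Proof.
move=> NT; have := discrete_energy N.
have : 0 <= \sum_(0 <= n < N) (F n - Y n) by apply: sumr_ge0 => n _; rewrite subr_ge0.
have Nt0 : 0 <= N%:R * tau by rewrite mulr_ge0// ltW.
have : gam * (N%:R * tau) <= T by apply: le_trans NT; rewrite ler_piMl.
lra.
Qed.

(** Young's inequality splits the increment of the squared distance into e^2/(4 B tau) and 4 B tau
    D(k+1)^2. The kinetic part is controlled by F(0) + T - F(n), where the lower bound on [F] brings
    back B D(n)^2; the weight 1/(2B) makes this half of D(n)^2, which the left side absorbs. The
    Gronwall constant is then 8 B tau. *)
Lemma discrete_dist_le N T : N%:R * tau <= T ->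
  d (V N) us ^+ 2 <=
  (2 * d (V 0%N) us ^+ 2 + (F 0%N + T + A) / B) * expR (16 * B * T).
Proof.
move=> NT; pose D n := d (V n) us.
have D0 n : 0 <= D n by exact: dist_ge0.
have nT n : (n <= N)%N -> n%:R * tau <= T.
  by move=> nN; apply: le_trans NT; rewrite ler_wpM2r ?(ltW tau0)// ler_nat.
have T0 : 0 <= T by have := nT 0%N (leq0n _); rewrite mul0r.
pose K := 2 * D 0%N ^+ 2 + (F 0%N + T + A) / B.
have K0 : 0 <= K.
  have : - D 0%N ^+ 2 <= (F 0%N + T + A) / B.
    by rewrite ler_pdivlMr// mulNr mulrC; have := lbF 0%N; rewrite -/(D 0%N); lra.
  by have := sqr_ge0 (D 0%N); rewrite /K; lra.
have telescope n : D n ^+ 2 - D 0%N ^+ 2 <=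
    (2 * B)^-1 * \sum_(0 <= k < n) d (V k) (V k.+1) ^+ 2 / (2 * tau) +
    4 * B * tau * \sum_(0 <= k < n) D k.+1 ^+ 2.
  rewrite -(telescope_sumr (fun k => D k ^+ 2) (leq0n n)) !mulr_sumr -big_split/=.
  apply: ler_sum => k _; set e := d (V k) (V k.+1).
  have h1 : D k.+1 <= D k + e.
    by have := dist_triangle hd (V k.+1) (V k) us; rewrite (distC hd (V k.+1) (V k)) -/e addrC.
  have e0 : 0 <= e by exact: dist_ge0.
  have h2 : D k.+1 ^+ 2 - D k ^+ 2 <= 2 * e * D k.+1.
    have [h3|h3] := leP e (D k.+1); last by have := D0 k; have := D0 k.+1; nra.
    have : (D k.+1 - e) ^+ 2 <= D k ^+ 2 by rewrite lerXn2r ?nnegrE ?D0//; lra.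
    nra.
  apply: le_trans h2 _.
  have -> : (2 * B)^-1 * (e ^+ 2 / (2 * tau)) = e ^+ 2 / (4 * B * tau).
    by field; rewrite !gt_eqF.
  have q0 : 0 < 4 * B * tau by rewrite !mulr_gt0.
  have : 0 <= (e - 4 * B * tau * D k.+1) ^+ 2 / (4 * B * tau).
    by rewrite divr_ge0 ?sqr_ge0// ltW.
  have -> : (e - 4 * B * tau * D k.+1) ^+ 2 / (4 * B * tau) =
      e ^+ 2 / (4 * B * tau) - 2 * e * D k.+1 + 4 * B * tau * D k.+1 ^+ 2.
    by field; rewrite !gt_eqF.
  lra.
have x0 : 0 <= 8 * B * tau by rewrite !mulr_ge0// ltW.
have x1 : 2 * (8 * B * tau) <= 1 by apply: le_trans tauB; rewrite le_eqVlt; apply/orP; left; apply/eqP; ring.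
have := @discrete_gronwall (8 * B * tau) K (fun n => D n ^+ 2) N x0 x1 K0
  (fun n => sqr_ge0 _).
move=> h; apply: le_trans (h _) _ => [n nN|].
  have h1 := telescope n; have h2 := discrete_energy_le (nT n nN); have h3 := lbF n.
  move: h1 h2; set s := \sum_(_ <= _ < _) _ / _; set r := \sum_(_ <= _ < _) _ => h1 h2.
  have h4 : (2 * B)^-1 * s <= (F 0%N + T + A) / B / 2 + D n ^+ 2 / 2.
    have -> : (F 0%N + T + A) / B / 2 + D n ^+ 2 / 2 =
        (2 * B)^-1 * (F 0%N + T + A + B * D n ^+ 2) by field; rewrite gt_eqF.
    by rewrite ler_wpM2l ?invr_ge0 ?mulr_ge0 ?(ltW B0)//; rewrite -/(D n) in h3; lra.
  by rewrite /K; lra.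
rewrite ler_wpM2l// ler_expR; have := ler_wpM2l (ltW B0) NT; lra.
Qed.

End energy.

Lemma scheme_bounds (S : Type) (d : S -> S -> R) (A B : R) (us : S) (T Fm Dm : R) :
  metric_space d -> 0 < B -> exists C : R,
  forall (tau gam : R) (V : nat -> S) (F Y : nat -> R), 0 < tau -> 16 * B * tau <= 1 ->
  gam <= 1 ->
  (forall n, F n.+1 + d (V n) (V n.+1) ^+ 2 / (2 * tau) <= Y n + gam * tau) ->
  (forall n, Y n <= F n) -> (forall n, - A - B * d (V n) us ^+ 2 <= F n) ->
  F 0%N <= Fm -> d (V 0%N) us <= Dm ->
  forall N, N%:R * tau <= T ->
  [/\ F N <= C, d (V N) us <= C & \sum_(0 <= n < N) d (V n) (V n.+1) ^+ 2 / tau <= C].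
Proof.
move=> hd B0; pose Q := (2 * Dm ^+ 2 + (Fm + T + A) / B) * expR (16 * B * T).
pose E := 2 * (Fm + T + A + B * Q).
exists (`|Fm + T| + (`|Q| + 1) + `|E|).
move=> tau gam V F Y tau0 tauB g1 hs hY hF F0 D0 N NT.
have h1 := discrete_energy_le tau0 hs hY g1 NT.
have h2 := discrete_dist_le hd B0 tau0 hs hY hF g1 tauB NT.
have d0 := dist_ge0 hd (V 0%N) us; have dN := dist_ge0 hd (V N) us.
have hQ : d (V N) us ^+ 2 <= Q.
  apply: le_trans h2 _; rewrite ler_wpM2r ?expR_ge0// lerD ?ler_wpM2l//.
    by rewrite lerXn2r ?nnegrE//; lra.
  by rewrite ler_wpM2r ?invr_ge0 ?(ltW B0)//; lra.
have := ler_norm Q; have := ler_norm (Fm + T); have := ler_norm E.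
have := normr_ge0 Q; have := normr_ge0 (Fm + T); have := normr_ge0 E.
move: h1; set s := \sum_(_ <= _ < _) _ => h1 E0 FT0 Q0 E1 FT1 Q1.
have s0 : 0 <= s by apply: sumr_ge0 => n _; rewrite divr_ge0 ?sqr_ge0// mulr_ge0// ltW.
split.
- lra.
- by have := sqr_ge0 (d (V N) us - 1); nra.
- have -> : \sum_(0 <= n < N) d (V n) (V n.+1) ^+ 2 / tau = 2 * s.
    rewrite /s mulr_sumr; apply: eq_bigr => n _; field; rewrite gt_eqF//.
  have := hF N; have : B * d (V N) us ^+ 2 <= B * Q by rewrite ler_wpM2l// ltW.
  by rewrite /E in E1 *; lra.
Qed.

End discrete_scheme.

(** * Piecewise constant interpolants *)

Section interpolant.
Variables (R : realType) (S : Type) (d : S -> S -> R).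
Hypothesis hd : metric_space d.

Definition interp_index (tau t : R) : nat := `|Num.ceil (t / tau)|%N.

Lemma interp_index_itv tau t : 0 < tau -> 0 <= t ->
  t <= (interp_index tau t)%:R * tau /\ (interp_index tau t)%:R * tau < t + tau.
Proof.
move=> tau0 t0; have q0 : 0 <= t / tau by rewrite divr_ge0// ltW.
have c0 : 0 <= Num.ceil (t / tau) by rewrite -[0]/(0 : int) ceil_ge0; lra.
have E : (interp_index tau t)%:R = (Num.ceil (t / tau))%:~R :> R.
  by rewrite /interp_index natr_absz ger0_norm.
rewrite E -ler_pdivrMr// -ltr_pdivlMr// mulrDl divff ?gt_eqF//; split; first exact: ceil_ge.
by rewrite -ltrBlDr -[X in _ - X]/(1%:~R) -intrB; exact: gt_pred_ceil.
Qed.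

Lemma interp_index_le tau s t : 0 < tau -> 0 <= s -> s <= t ->
  (interp_index tau s <= interp_index tau t)%N.
Proof.
move=> tau0 s0 st.
have [_ h1] := interp_index_itv tau0 s0; have [h2 _] := interp_index_itv tau0 (le_trans s0 st).
rewrite -ltnS -(ltr_nat R) -natr1 -(ltr_pM2r tau0) mulrDl mul1r; lra.
Qed.

Lemma interp_index0 tau : interp_index tau 0 = 0%N.
Proof. by rewrite /interp_index mul0r ceil0. Qed.

(** Cauchy-Schwarz over the steps between [s] and [t], whose total length is at most t - s + tau;
    the extra [tau] accounts for the jumps and disappears in the limit. *)
Lemma interp_dist_sq tau (V : nat -> S) s t : 0 < tau -> 0 <= s -> s <= t ->
  d (pc_interp tau V s) (pc_interp tau V t) ^+ 2 <= (t - s + tau) *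
  \sum_(interp_index tau s <= k < interp_index tau t) d (V k) (V k.+1) ^+ 2 / tau.
Proof.
move=> tau0 s0 st; have ij := interp_index_le tau0 s0 st.
have [s1 s2] := interp_index_itv tau0 s0.
have [t1 t2] := interp_index_itv tau0 (le_trans s0 st).
rewrite /pc_interp -/(interp_index tau s) -/(interp_index tau t).
set i := interp_index tau s in ij s1 s2 *; set j := interp_index tau t in ij t1 t2 *.
have h := dist_sum_le hd V i (j - i); rewrite subnKC// in h.
have h2 := sqr_sum_le (fun k => d (V k) (V k.+1)) i (j - i); rewrite subnKC// in h2.
apply: le_trans (_ : (\sum_(i <= k < j) d (V k) (V k.+1)) ^+ 2 <= _).
  by rewrite lerXn2r ?nnegrE ?(dist_ge0 hd)// sumr_ge0// => k _; exact: dist_ge0.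
apply: le_trans h2 _; rewrite -mulr_suml natrB// mulrA mulrAC.
apply: ler_wpM2r; first by apply: sumr_ge0 => k _; exact: sqr_ge0.
rewrite ler_pdivlMr// mulrBl; lra.
Qed.

Lemma dist_cvg2 (x y : nat -> S) a b : (fun n => d (x n) a) @ \oo --> 0 ->
  (fun n => d (y n) b) @ \oo --> 0 -> (fun n => d (x n) (y n)) @ \oo --> d a b.
Proof.
move=> /(dist_cvgP hd) hx /(dist_cvgP hd) hy; apply/cvgrPdist_lt => e e0.
have e20 : 0 < e / 2 by lra.
have [N hN] := hx _ e20; have [M hM] := hy _ e20.
exists (maxn N M) => // n /=; rewrite geq_max => /andP[/hN h1 /hM h2].
have h3 := dist_triangle hd a (x n) b; have h4 := dist_triangle hd (x n) (y n) b.
have h5 := dist_triangle hd (x n) a (y n); have h6 := dist_triangle hd a b (y n).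
rewrite (distC hd a (x n)) in h3; rewrite (distC hd b (y n)) in h6.
by rewrite ltr_norml; apply/andP; split; lra.
Qed.

Lemma sum_consecutive (x : nat -> R) (g : nat -> nat) n : (forall i, (g i <= g i.+1)%N) ->
  \sum_(0 <= i < n) \sum_(g i <= k < g i.+1) x k = \sum_(g 0%N <= k < g n) x k.
Proof.
move=> hg; elim: n => [|n IH]; first by rewrite !big_geq.
rewrite big_nat_recr//= IH -big_cat_nat//.
by elim: n {IH} => // n /leq_trans; apply.
Qed.

Lemma cvg_sum_nat (a : nat -> nat -> R) (l : nat -> R) n :
  (forall i, (i < n)%N -> a i @ \oo --> l i) ->
  (fun j => \sum_(0 <= i < n) a i j) @ \oo --> \sum_(0 <= i < n) l i.
Proof.
elim: n => [_|n IH h].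
  rewrite big_geq//; under eq_cvg do rewrite big_geq//; exact: cvg_cst.
rewrite big_nat_recr//=; under eq_cvg do rewrite big_nat_recr//=.
apply: cvgD; last exact: h.
by apply: IH => i /leqW; exact: h.
Qed.

Variables (tk : nat -> R) (V : nat -> nat -> S).
Hypothesis tk0 : forall k, 0 < tk k.
Hypothesis tkcv : tk @ \oo --> 0.

(** On each dyadic cell [interp_dist_sq] bounds d^2/(mesh + tk) by the kinetic sum over the steps of
    that cell. The cells are consecutive, so these sums add up to at most [K], and the denominators
    tend to the mesh. *)
Lemma limit_polygon_energy_le (u : R -> S) T K : 0 < T ->
  (forall t, 0 <= t -> t <= T -> (fun k => d (pc_interp (tk k) (V k) t) (u t)) @ \oo --> 0) ->
  (forall k, \sum_(0 <= n < interp_index (tk k) T) d (V k n) (V k n.+1) ^+ 2 / tk k <= K) ->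
  forall n, polygon_energy d u T n <= K.
Proof.
move=> T0 hu hK n; have m0 := mesh_gt0 T0 n; set m := mesh T n in m0 *.
have im i : (i <= 2 ^ n)%N -> 0 <= i%:R * m /\ i%:R * m <= T.
  move=> hi; split; first by rewrite mulr_ge0// ltW.
  by rewrite -(mesh_pow T n) -/m ler_wpM2r ?(ltW m0)// ler_nat.
have -> : polygon_energy d u T n =
    \sum_(0 <= i < (2 ^ n)%N) d (u (i%:R * m)) (u (i.+1%:R * m)) ^+ 2 / m.
  rewrite /polygon_energy mulr_sumr; apply: eq_bigr => i _; rewrite /chord -/m.
  by field; rewrite gt_eqF.
have cv : (fun j => \sum_(0 <= i < (2 ^ n)%N)
    d (pc_interp (tk j) (V j) (i%:R * m)) (pc_interp (tk j) (V j) (i.+1%:R * m)) ^+ 2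
    / (m + tk j)) @ \oo -->
    \sum_(0 <= i < (2 ^ n)%N) d (u (i%:R * m)) (u (i.+1%:R * m)) ^+ 2 / m.
  apply: (@cvg_sum_nat (fun i j => _ ^+ 2 / (m + tk j))) => i hi.
  have [a1 a2] := im i (ltnW hi); have [b1 b2] := im i.+1 hi.
  apply: cvgM.
    have h := dist_cvg2 (hu _ a1 a2) (hu _ b1 b2).
    by apply: cvgM.
  apply: cvgV; first by rewrite gt_eqF.
  by rewrite -[X in _ --> X]addr0; apply: cvgD => //; exact: cvg_cst.
apply: (ler_cvg_to cv (cvg_cst K)); apply: nearW => j; apply: le_trans (hK j).
have g_le i : (interp_index (tk j) (i%:R * m) <= interp_index (tk j) (i.+1%:R * m))%N.
  apply: interp_index_le => //; first by rewrite mulr_ge0// ltW.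
  by rewrite ler_wpM2r ?(ltW m0)// ler_nat.
have := sum_consecutive (fun k => d (V j k) (V j k.+1) ^+ 2 / tk j) (2 ^ n) g_le.
rewrite mul0r interp_index0 mesh_pow => <-; apply: ler_sum => i _.
have im0 : 0 <= i%:R * m by rewrite mulr_ge0// ltW.
have im1 : i%:R * m <= i.+1%:R * m by rewrite ler_wpM2r ?(ltW m0)// ler_nat.
have := interp_dist_sq (V j) (tk0 j) im0 im1.
have -> : i.+1%:R * m - i%:R * m + tk j = m + tk j by rewrite -natr1; ring.
by move=> h; rewrite ler_pdivrMr ?addr_gt0// [leRHS]mulrC.
Qed.

(** * Equicontinuity and convergence of the interpolants *)

Section compactness.
Hypothesis dcomplete : complete_metric d.
Hypothesis tk1 : forall k, tk k <= 1.
Hypothesis tbound : forall T, exists C, forall k N, N%:R * tk k <= T ->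
  \sum_(0 <= n < N) d (V k n) (V k n.+1) ^+ 2 / tk k <= C.

Lemma interp_holder T : exists2 C, 0 < C & forall k s t, 0 <= s -> s <= t -> t <= T ->
  d (pc_interp (tk k) (V k) s) (pc_interp (tk k) (V k) t) ^+ 2 <= C * (t - s + tk k).
Proof.
(* The node attached to a time up to [T] may overshoot [T] by one step, hence by at most 1. *)
have [C hC] := tbound (T + 1); exists (`|C| + 1).
  by have := normr_ge0 C; lra.
move=> k s t s0 st tT; have t0 := le_trans s0 st.
apply: le_trans (interp_dist_sq (V k) (tk0 k) s0 st) _; rewrite mulrC.
have tk0' := tk0 k; apply: ler_wpM2r; first lra.
have [_ h2] := interp_index_itv tk0' t0.
have h3 : (interp_index (tk k) t)%:R * tk k <= T + 1 by have := tk1 k; lra.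
have := hC _ _ h3; rewrite (@big_cat_nat _ _ _ (interp_index (tk k) s))//=; last exact: interp_index_le.
set a := \sum_(0 <= _ < _) _; set b := \sum_(_ <= _ < _) _ => hab.
have a0 : 0 <= a by apply: sumr_ge0 => i _; rewrite divr_ge0 ?sqr_ge0// ltW.
by have := ler_norm C; lra.
Qed.

Lemma interp_holder_limit (u : R -> S) T :
  (forall t, 0 <= t -> t <= T -> (fun k => d (pc_interp (tk k) (V k) t) (u t)) @ \oo --> 0) ->
  exists2 C, 0 < C & forall s t, 0 <= s -> s <= t -> t <= T ->
    d (u s) (u t) ^+ 2 <= C * (t - s).
Proof.
move=> hu; have [C C0 hC] := interp_holder T; exists C => // s t s0 st tT.
have h := dist_cvg2 (hu s s0 (le_trans st tT)) (hu t (le_trans s0 st) tT).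
apply: ler_cvg_to (cvgM h h) (_ : (fun k => C * (t - s + tk k)) @ \oo --> _) _.
  apply: cvgM; first exact: cvg_cst.
  by rewrite -[X in _ --> X]addr0; apply: cvgD => //; exact: cvg_cst.
by apply: nearW => k; have := hC k s t s0 st tT; rewrite expr2.
Qed.

(** Ascoli-Arzela for discontinuous curves: the Hoelder bound carries the additive error [tk k], so
    the value at [t] follows the value at a nearby [q i] only for large [k], which suffices for a
    Cauchy sequence. *)
Lemma interp_cvg_dense (q : nat -> R) :
  (forall i, 0 <= q i) -> (forall t e, 0 <= t -> 0 < e -> exists i, `|q i - t| < e) ->
  (forall i, exists v, (fun k => d (pc_interp (tk k) (V k) (q i)) v) @ \oo --> 0) ->
  forall t, 0 <= t -> exists v, (fun k => d (pc_interp (tk k) (V k) t) v) @ \oo --> 0.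
Proof.
move=> q0 qd hq t t0; apply: dcomplete => e e0.
have [C C0 hC] := interp_holder (t + 1).
have e40 : 0 < (e / 4) ^+ 2 / (2 * C) by rewrite divr_gt0 ?mulr_gt0 ?exprn_gt0//; lra.
have [i hi] : exists i, `|q i - t| < Num.min 1 ((e / 4) ^+ 2 / (2 * C)).
  by apply: qd => //; rewrite lt_min ltr01.
move: hi; rewrite lt_min => /andP[hi1 hi2].
have [N1 hN1] := (cvgn0P (fun n => ltW (tk0 n))).1 tkcv _ e40.
have [v /(dist_cvgP hd) hv] := hq i.
have e80 : 0 < e / 4 by lra.
have [N2 hN2] := hv _ e80.
have near k : (maxn N1 N2 <= k)%N -> d (pc_interp (tk k) (V k) t) (pc_interp (tk k) (V k) (q i)) < e / 4.
  rewrite geq_max => /andP[/hN1 h1 _].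
  have key : d (pc_interp (tk k) (V k) t) (pc_interp (tk k) (V k) (q i)) ^+ 2 <=
      C * (`|q i - t| + tk k).
    have [tq|/ltW qt] := leP t (q i).
      rewrite ger0_norm ?subr_ge0//; apply: hC => //.
      by move: hi1; rewrite ltr_norml => /andP[_]; lra.
    rewrite (distC hd) distrC ger0_norm ?subr_ge0//; apply: hC => //; lra.
  have : C * (`|q i - t| + tk k) < (e / 4) ^+ 2.
    have : `|q i - t| + tk k < (e / 4) ^+ 2 / (2 * C) + (e / 4) ^+ 2 / (2 * C) by lra.
    have -> : (e / 4) ^+ 2 / (2 * C) + (e / 4) ^+ 2 / (2 * C) = (e / 4) ^+ 2 / C.
      by field; rewrite gt_eqF.
    by rewrite ltr_pdivlMr// mulrC.
  move=> /(le_lt_trans key); rewrite ltr_pXn2r ?nnegrE ?(dist_ge0 hd)//; lra.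
exists (maxn N1 N2) => n m Nn Nm.
have h1 := near n Nn; have h2 := near m Nm.
have h3 : d (pc_interp (tk n) (V n) (q i)) v < e / 4.
  by apply: hN2; apply: leq_trans Nn; exact: leq_maxr.
have h4 : d (pc_interp (tk m) (V m) (q i)) v < e / 4.
  by apply: hN2; apply: leq_trans Nm; exact: leq_maxr.
move: h1 h2 h3 h4; set a := pc_interp _ _ t; set b := pc_interp _ _ t.
set a' := pc_interp _ _ _; set b' := pc_interp _ _ _ => h1 h2 h3 h4.
have := dist_triangle hd a a' b; have := dist_triangle hd a' v b.
by have := dist_triangle hd v b' b; rewrite (distC hd v b') (distC hd b' b); lra.
Qed.

End compactness.
End interpolant.

Definition nnrat_seq (R : realType) (i : nat) : R :=
  if unpickle i is Some (a, b) then (a : nat)%:R / (b : nat).+1%:R else 0.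

Lemma nnrat_seq_ge0 (R : realType) i : 0 <= nnrat_seq R i.
Proof. by rewrite /nnrat_seq; case: (unpickle i) => [[a b]|]. Qed.

Lemma nnrat_seq_dense (R : realType) (t e : R) : 0 <= t -> 0 < e ->
  exists i, `|nnrat_seq R i - t| < e.
Proof.
move=> t0 e0; have [b hb] := lt_inv_natE e0; have {}hb := hb b (leqnn b).
have b0 : 0 < (b.+1%:R^-1 : R) by rewrite invr_gt0 ltr0n.
have [h1 h2] := truncn_div_itv b0 t0; set a := Num.truncn _ in h1 h2.
exists (pickle (a, b)); rewrite /nnrat_seq pickleK distrC ger0_norm ?subr_ge0//.
by apply: lt_trans hb; move: h2; rewrite -natr1 mulrDl mul1r ltrBlDl.
Qed.

Lemma diagonal_interp (R : realType) (S : Type) (d : S -> S -> R)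
    (tk : nat -> R) (V : nat -> nat -> S) : metric_space d ->
  (forall t sg, 0 <= t -> extraction sg -> exists2 sg', extraction sg' &
    exists v, (fun k => d (pc_interp (tk (sg (sg' k))) (V (sg (sg' k))) t) v) @ \oo --> 0) ->
  exists2 sg, extraction sg & forall i, exists v,
    (fun k => d (pc_interp (tk (sg k)) (V (sg k)) (nnrat_seq R i)) v) @ \oo --> 0.
Proof.
move=> hd h.
have := @diagonal_extraction S (fun i n => pc_interp (tk n) (V n) (nnrat_seq R i))
  (fun x => exists v, (fun k => d (x k) v) @ \oo --> 0).
apply.
- move=> x y N m hm [v /(dist_cvgP hd) hv]; exists v; apply/(dist_cvgP hd) => e /hv[M hM].
  exists (maxn N M) => n; rewrite geq_max => /andP[/hm[nm ->] Mn].
  by apply: hM; exact: leq_trans Mn nm.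
- by move=> i sg hs; exact: h (nnrat_seq_ge0 R i) hs.
Qed.

(** * Lower semicontinuity of the energy inequality *)

Section ereal_aux.
Variable R : realType.
Local Open Scope ereal_scope.

Lemma lt_exists_EFin (x y : \bar R) : x < y -> exists2 r : R, x < r%:E & r%:E < y.
Proof.
case: x => [x| |]; case: y => [y| |] //.
- rewrite lte_fin => xy; exists ((x + y) / 2)%R; rewrite lte_fin; lra.
- by move=> _; exists (x + 1)%R; rewrite ?ltry// lte_fin; lra.
- by move=> _; exists (y - 1)%R; rewrite ?ltNyr// lte_fin; lra.
- by move=> _; exists 0%R; rewrite ?ltry ?ltNyr.
Qed.

(** Otherwise a real [lam] lies strictly between the lower limit and [X], and [a] is at most [lam]
    along an extraction. *)
Lemma le_limn_einf_extraction (X : \bar R) (a : nat -> \bar R) :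
  (forall (lam : R) sg, extraction sg -> (forall k, a (sg k) <= lam%:E) -> X <= lam%:E) ->
  X <= limn_einf a.
Proof.
move=> h; rewrite leNgt; apply/negP => /lt_exists_EFin[lam h1 h2].
suff [sg hs hsg] : exists2 sg, extraction sg & forall k, a (sg k) <= lam%:E.
  by have := h lam sg hs hsg; rewrite leNgt h2.
apply: (@frequently_extraction (fun n => a n <= lam%:E)) => N.
apply: contrapT => hN; move: h1; rewrite ltNge => /negP; apply.
rewrite limn_einf_lim; apply: lime_ge; first exact: is_cvg_einfs.
exists N => // n /= Nn; apply: le_ereal_inf_tmp => _ [k /= nk <-].
rewrite leNgt; apply/negP => hk; apply: hN; exists k; first exact: leq_trans Nn nk.
exact: ltW.
Qed.

Lemma adde3_le_fin (X Y Z : \bar R) (c : R) : X != -oo -> 0 <= Y -> 0 <= Z ->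
  (forall a b e : R, a%:E < X -> b%:E < Y -> e%:E < Z -> (a + b + e <= c)%R) ->
  X + (Y + Z) <= c%:E.
Proof.
move=> X0 Y0 Z0 h.
have Y1 : (-1)%:E < Y by apply: lt_le_trans Y0; rewrite lte_fin; lra.
have Z1 : (-1)%:E < Z by apply: lt_le_trans Z0; rewrite lte_fin; lra.
case: X X0 h => [x| |] // _ h; last first.
  (* An infinite term is refuted by a choice that makes the sum [c + 1], the nonnegative terms not
     yet examined being represented by -1. *)
  by exfalso; have := h (c + 3)%R _ _ (ltry _) Y1 Z1; lra.
have x1 : (x - 1)%:E < x%:E by rewrite lte_fin; lra.
case: Y Y0 Y1 h => [y| |] // _ Y1 h; last first.
  by exfalso; have := h _ (c + 3 - x)%R _ x1 (ltry _) Z1; lra.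
case: Z Z0 Z1 h => [z| |] // _ Z1 h; last first.
  by exfalso; have := h _ _ (c + 3 - x)%R x1 Y1 (ltry _); lra.
rewrite -!EFinD lee_fin; apply/ler_addgt0Pl => e e0.
by have := h (x - e / 3)%R (y - e / 3)%R (z - e / 3)%R; rewrite !lte_fin; lra.
Qed.

(** Superadditivity of the lower limit, meant for the energy, the slope and the kinetic term; each
    is known only through bounds along extractions and may a priori be infinite. *)
Lemma liminf3_le (X Y Z : \bar R) (x y z c : nat -> R) (l : R) :
  X != -oo -> 0 <= Y -> 0 <= Z ->
  (forall lam sg, extraction sg -> (forall k, x (sg k) <= lam)%R -> X <= lam%:E) ->
  (forall lam sg, extraction sg -> (forall k, y (sg k) <= lam)%R -> Y <= lam%:E) ->
  (forall lam sg, extraction sg -> (forall k, z (sg k) <= lam)%R -> Z <= lam%:E) ->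
  (forall k, x k + y k + z k <= c k)%R -> (c @ \oo --> l)%classic ->
  X + (Y + Z) <= l%:E.
Proof.
move=> X0 Y0 Z0 hX hY hZ hc cl.
have ev W (w : nat -> R) (a : R) : (forall lam sg, extraction sg ->
      (forall k, w (sg k) <= lam)%R -> W <= lam%:E) -> a%:E < W ->
    exists N, forall n, (N <= n)%N -> (a < w n)%R.
  move=> hW aW; apply: contrapT => hN.
  have [sg hs hsg] : exists2 sg, extraction sg & forall k, (w (sg k) <= a)%R.
    apply: (@frequently_extraction (fun n => w n <= a)%R) => N.
    apply: contrapT => hN2; apply: hN; exists N => n Nn; rewrite ltNge; apply/negP => hn.
    by apply: hN2; exists n.
  by have := hW a sg hs hsg; rewrite leNgt aW.
apply: adde3_le_fin => // a b e /(ev _ _ _ hX)[N1 h1] /(ev _ _ _ hY)[N2 h2] /(ev _ _ _ hZ)[N3 h3].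
apply: (ler_cvg_to (cvg_cst (a + b + e)%R) cl).
exists (maxn N1 (maxn N2 N3)) => // n /=; rewrite !geq_max => /and3P[/h1 k1 /h2 k2 /h3 k3].
by have := hc n; lra.
Qed.

End ereal_aux.

Section curve.
Variables (R : realType) (S : Type) (d : S -> S -> R).
Hypothesis hd : metric_space d.
Local Notation mu := (@lebesgue_measure R).

Lemma sqre_ge0 (x : \bar R) : (0 <= x)%E -> (0 <= x ^+ 2)%E.
Proof. by move=> x0; rewrite expe2 mule_ge0. Qed.

(** Only quotients near [x] matter; this relates a curve to its extension away from the end point of
    its domain. *)
Lemma metric_deriv_local (D1 D2 : set R) (u1 u2 : R -> S) x rho : 0 < rho ->
  (forall s, `|s - x| < rho -> D1 s -> D2 s /\ u1 s = u2 s) -> u1 x = u2 x ->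
  (metric_deriv d D1 u1 x <= metric_deriv d D2 u2 x)%E.
Proof.
move=> rho0 h hx; apply: le_ereal_inf_tmp => _ [r r0 <-].
have r10 : 0 < Num.min r rho by rewrite lt_min r0.
apply: le_trans (ereal_inf_lbound (ex_intro2 _ _ (Num.min r rho) r10 erefl)) _.
apply: ge_ereal_sup => _ [->|[s [Ds /andP[s1 s2]] <-]].
  by apply: ereal_sup_ubound; left.
move: s2; rewrite lt_min => /andP[s2 s3]; have [D2s us] := h s s3 Ds.
by apply: ereal_sup_ubound; right; exists s; rewrite /= ?us ?hx ?s1 ?s2.
Qed.

(** * Absolute continuity of a curve of finite energy *)

Section speed_density.
Variable u : R -> S.
Local Notation md := (metric_deriv d `[0%R, +oo[%classic u).
Hypothesis hcont : forall T, exists2 C, 0 < C & forall s t, 0 <= s -> s <= t -> t <= T ->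
  d (u s) (u t) ^+ 2 <= C * (t - s).

Lemma holder_continuous T e : 0 < e -> exists2 r, 0 < r & forall s t,
  0 <= s -> s <= T -> 0 <= t -> t <= T -> `|s - t| < r -> d (u s) (u t) < e.
Proof.
move=> e0; have [C C0 hC] := hcont T.
exists (e ^+ 2 / C); first by rewrite divr_gt0// exprn_gt0.
have key s t : 0 <= s -> s <= t -> t <= T -> t - s < e ^+ 2 / C -> d (u s) (u t) < e.
  move=> s0 st tT; rewrite ltr_pdivlMr// mulrC => h.
  rewrite -(@ltr_pXn2r _ 2)// ?nnegrE ?(dist_ge0 hd) ?(ltW e0)//.
  exact: le_lt_trans (hC s t s0 st tT) h.
move=> s t s0 sT t0 tT; have [st|/ltW ts] := leP s t.
  by rewrite distrC ger0_norm ?subr_ge0//; exact: key.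
by rewrite ger0_norm ?subr_ge0// (distC hd); exact: key.
Qed.

Lemma measurable_speed : @measurable_fun _ _ (measurableTypeR R) _ `[0%R, +oo[%classic md.
Proof.
apply: measurable_metric_deriv => //.
move=> t; rewrite /= in_itv/= andbT => t0 e e0.
have [r r0 hr] := holder_continuous (t + 1) e0.
exists (Num.min r 1); first by rewrite lt_min r0 ltr01.
move=> s; rewrite /= in_itv/= andbT => s0; rewrite lt_min => /andP[h1 h2].
by apply: hr => //; move: h2; rewrite ltr_norml; lra.
Qed.

Hypothesis henergy : forall T, 0 < T -> exists K, forall n, polygon_energy d u T n <= K.

(** Limits of polygon speeds depend on the horizon [T], the metric derivative does not: [fine] of it
    is one density for all intervals, its infinite values forming a null set. *)
Lemma speed_density : exists m : R -> R, [/\ (forall x, 0 <= m x),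
  (forall b, mu.-integrable `[0%R, b] (fun x => (m x)%:E)) &
  forall s t, 0 <= s -> s <= t ->
    ((d (u s) (u t))%:E <= \int[mu]_(x in `[s, t]) (m x)%:E)%E].
Proof.
have mdge x : (0 <= md x)%E := metric_deriv_ge0 d _ u x.
have mmd := measurable_speed.
have mmdi b0 b1 a b : 0 <= a -> @measurable_fun _ _ (measurableTypeR R) _
    [set` Interval (BSide b0 a) (BSide b1 b)] md.
  exact: measurable_metric_deriv_itv.
have imd b : mu.-integrable `[0%R, b] md.
  apply: (@integrableS _ _ _ mu `[0%R, `|b| + 1]) => //.
    apply: subset_itvl; rewrite bnd_simp; have := ler_norm b; lra.
  set T := `|b| + 1; have T0 : 0 < T by have := normr_ge0 b; rewrite /T; lra.
  have [K hK] := henergy T0.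
  have [hE _] := speed_energy hd T0 (holder_continuous T) hK mmd.
  have mT := mmdi true false 0 T (lexx _).
  apply/integrableP; split => //.
  apply: (@le_lt_trans _ _ (\int[mu]_(x in `[0%R, T]) (1 + md x ^+ 2))%E).
    apply: ge0_le_integral_nomeas => x _; first exact: abse_ge0.
    rewrite gee0_abs//; have := mdge x; case: (md x) => [y| |] // y0.
    by rewrite expe2 -EFinM -EFinD lee_fin; have := sqr_ge0 (y - 1); nra.
  rewrite ge0_integralD//=; last 2 first.
  - by move=> x _; exact: sqre_ge0.
  - exact: emeasurable_funM.
  rewrite integral_cst//= lebesgue_measure_itv/= lte_fin T0 mul1e -EFinB.
  by apply: lte_add_pinfty; [exact: ltry|exact: le_lt_trans hE (ltry _)].
have ifin b : mu.-integrable `[0%R, b] (fun x => (fine (md x))%:E).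
  apply: le_integrable (imd b) => //.
    apply/measurable_EFinP; apply: measurableT_comp; first exact: fine_measurable.
    exact: mmdi.
  move=> x _; rewrite !gee0_abs// ?lee_fin ?fine_ge0//.
  by have := mdge x; case: (md x) => [y| |] // _; rewrite leey.
exists (fun x => fine (md x)); split => //.
  by move=> x; apply: fine_ge0.
move=> s t s0 st; have T0 : 0 < t + 1 by lra.
have [K hK] := henergy T0.
have [_ hD] := speed_energy hd T0 (holder_continuous (t + 1)) hK mmd.
have tt1 : t <= t + 1 by lra.
apply: le_trans (hD s t s0 st tt1) _.
apply: ae_ge0_le_integral => //.
- exact: mmdi.
- by move=> x _; rewrite lee_fin fine_ge0.
- apply/measurable_EFinP; apply: measurableT_comp; first exact: fine_measurable.
  exact: mmdi.
- apply: (@filterS _ _ (ae_filter_ringOfSetsType mu) _ _ _ (integrable_ae _ (imd t))) => //.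
  move=> x hx; rewrite /= in_itv/= => /andP[x1 x2]; rewrite fineK//; apply: hx.
  by rewrite /= in_itv/= x2 (le_trans s0).
Qed.

End speed_density.
End curve.

(** * Strong upper gradients *)

Lemma young_sqre (R : realType) (a b : \bar R) : (0 <= a)%E -> (0 <= b)%E ->
  (a * b <= (2^-1)%:E * a ^+ 2 + (2^-1)%:E * b ^+ 2)%E.
Proof.
have hy : ((2^-1)%:E * +oo ^+ 2 = +oo :> \bar R)%E.
  by rewrite expe2 mulyy gt0_muley// lte_fin.
have hr (x : R) : ((2^-1)%:E * x%:E ^+ 2 = (2^-1 * x ^+ 2)%:E)%E by rewrite expe2 -!EFinM.
case: a b => [a| |] [b| |] // a0 b0; rewrite ?hr ?hy ?addye ?addey ?leey//.
by rewrite -EFinM -EFinD lee_fin; have := sqr_ge0 (a - b); lra.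
Qed.

Section strong_upper_gradient_curve.
Variables (R : realType) (S : Type) (d : S -> S -> R).
Hypothesis hd : metric_space d.
Local Notation mu := (@lebesgue_measure R).
Variables (phi : S -> \bar R) (u : R -> S) (m : R -> R).
Local Notation md := (metric_deriv d `[0%R, +oo[%classic u).
Local Notation g := (relaxed_slope d phi).
Hypothesis phiNy : forall x, phi x != -oo%E.
Hypothesis phi0 : (phi (u 0) < +oo)%E.
Hypothesis m0 : forall x, 0 <= m x.
Hypothesis im : forall b, mu.-integrable `[0%R, b] (fun x => (m x)%:E).
Hypothesis hm : forall s t, 0 <= s -> s <= t ->
  ((d (u s) (u t))%:E <= \int[mu]_(x in `[s, t]) (m x)%:E)%E.
Hypothesis mmd : @measurable_fun _ _ (measurableTypeR R) _ `[0%R, +oo[%classic md.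
Hypothesis energy : forall t, 0 <= t ->
  (phi (u t) + ((2^-1)%:E * \int[mu]_(s in `[0%R, t]) g (u s) ^+ 2
     + (2^-1)%:E * \int[mu]_(s in `[0%R, t]) md s ^+ 2) <= phi (u 0%R))%E.

Lemma density_loc_abs_cont : loc_abs_cont d u.
Proof.
exists m; split=> [a b a0|//]; apply: integrableS (im b) => //.
by apply: subset_itv; rewrite bnd_simp.
Qed.

(* Constant extension to the left makes the closed end point 0 interior to an open
   interval, as strong_upper_gradient requires. *)
Let v (r : R) := u (Num.max r 0).

Lemma extension_abs_cont a b : abs_cont d `]a, b[%classic v.
Proof.
pose D : set R := `[0%R, b]%classic; pose m' := m \_ D.
have mD : @measurable _ (measurableTypeR R) D by exact: measurable_itv.
have m'0 x : 0 <= m' x by rewrite /m' /patch; case: ifP.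
have iT : mu.-integrable setT (EFin \o m').
  rewrite /m' -restrict_EFin; apply/(integrable_mkcond _ mD).
  exact: im.
have mm' (E : set (measurableTypeR R)) : measurable_fun E (EFin \o m').
  exact: measurable_funTS (measurable_int _ iT).
exists m'; split.
  by apply: integrableS iT => //; exact: measurable_itv.
move=> s t; rewrite /= !in_itv/= => /andP[_ sb] /andP[_ tb] st; rewrite /v.
have [t0|t0] := leP t 0.
  rewrite !max_r//; last exact: le_trans st t0.
  by rewrite (dist_xx hd); apply: integral_ge0 => x _; rewrite lee_fin.
set s' := Num.max s 0; have s'0 : 0 <= s' by rewrite /s' le_max lexx orbT.
have s't : s' <= t by rewrite /s' ge_max st ltW.
have ss' : s <= s' by rewrite /s' le_max lexx.
apply: le_trans (hm s'0 s't) _.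
apply: (@le_trans _ _ (\int[mu]_(x in `[s', t]) (m' x)%:E)%E).
  apply: ge0_le_integral_nomeas => x; first by move=> _; rewrite lee_fin.
  rewrite /= in_itv/= => /andP[x1 x2]; rewrite lee_fin /m' /patch ifT//.
  by rewrite inE /D /= in_itv/= (le_trans s'0 x1) (le_trans x2 (ltW tb)).
apply: ge0_subset_integral => //.
- by move=> x _; rewrite lee_fin.
- by apply: subset_itv; rewrite bnd_simp.
Qed.

(** By Young's inequality the upper gradient property bounds phi(u 0) - phi(u s) by half the
    integrals of the squared slope and squared speed over [0, s]. Subtracting this from [energy] on
    [0, t] leaves the inequality on [s, t], with empty exceptional set; a finite [phi (u 0)] bounds
    all the integrals that are subtracted. *)
Lemma sug_curve_max_slope :
  strong_upper_gradient d phi (relaxed_slope d phi) -> curve_max_slope d phi u.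
Proof.
move=> sug; split; first exact: density_loc_abs_cont.
exists set0; split; first exact: measurable0; split; first exact: measure0.
move=> s t s0 st _ _; have t0 := le_trans s0 st.
have t1 : -1 < t + 1 by lra.
have [mgv /(_ 0 s)] := sug _ _ v t1 (extension_abs_cont _ _).
have -> : v 0 = u 0 by rewrite /v max_r.
have -> : v s = u s by rewrite /v max_l.
have st1 : s < t + 1 by lra.
move=> /(_ (ltrN10 R) s0 st1)[_ h].
have mg b0 b1 a b : 0 <= a -> b <= t -> @measurable_fun _ _ (measurableTypeR R) _
    [set` Interval (BSide b0 a) (BSide b1 b)] (fun x => g (u x) ^+ 2)%E.
  move=> a0 bt.
  have : @measurable_fun _ _ (measurableTypeR R) _
    [set` Interval (BSide b0 a) (BSide b1 b)] (fun x => g (u x)).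
    apply: (eq_measurable_fun (g \o v)).
      move=> x; rewrite inE/= => hx; rewrite /v max_l//.
      by have := hx; rewrite in_itv/= => /andP[+ _]; case: (b0) => /= [|/ltW]; exact: le_trans.
    apply: measurable_funS mgv => //.
    move=> x /=; rewrite !in_itv/= => /andP[x1 x2]; apply/andP; split.
      by move: x1; case: (b0) => /=; lra.
    by move: x2; case: (b1) => /=; lra.
  by move=> h'; apply: emeasurable_funM.
have mmd2 b0 b1 a b : 0 <= a -> @measurable_fun _ _ (measurableTypeR R) _
    [set` Interval (BSide b0 a) (BSide b1 b)] (fun x => md x ^+ 2)%E.
  by move=> a0; apply: emeasurable_funM; exact: measurable_metric_deriv_itv.
have g20 x : (0 <= g (u x) ^+ 2)%E by apply: sqre_ge0; exact: relaxed_slope_ge0.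
have md20 x : (0 <= md x ^+ 2)%E by apply: sqre_ge0; exact: metric_deriv_ge0.
pose G1 := (\int[mu]_(x in `]0%R, s[) g (u x) ^+ 2)%E.
pose M1 := (\int[mu]_(x in `]0%R, s[) md x ^+ 2)%E.
have split_le (f : R -> \bar R) : (forall x, (0 <= f x)%E) ->
    (forall b0 b1 a b, 0 <= a -> b <= t -> @measurable_fun _ _ (measurableTypeR R) _
       [set` Interval (BSide b0 a) (BSide b1 b)] f) ->
    (\int[mu]_(x in `]0%R, s[) f x + \int[mu]_(x in `[s, t]) f x <=
     \int[mu]_(x in `[0%R, t]) f x)%E.
  move=> f0 mf; have sub : `]0%R, s[ `|` `[s, t] `<=` `[0%R, t].
    move=> x [] /=; rewrite !in_itv/= => /andP[x1 x2].
      by rewrite (ltW x1) (le_trans (ltW x2) st).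
    by rewrite (le_trans s0 x1) x2.
  have mU : @measurable_fun _ _ (measurableTypeR R) _ (`]0%R, s[ `|` `[s, t]) f.
    by apply: measurable_funS (mf true false 0 t (lexx _) (lexx _)).
  rewrite -ge0_integral_setU//.
    apply: ge0_subset_integral => //; first exact: measurableU.
    exact: (mf true false 0 t (lexx _) (lexx _)).
  apply/disj_setPS => x /= []; rewrite !in_itv/= => /andP[_ h1] /andP[h2 _].
  by have := lt_le_trans h1 h2; rewrite ltxx.
have hG := split_le _ g20 (fun b0 b1 a b a0 bt => mg b0 b1 a b a0 bt).
have hM := split_le _ md20 (fun b0 b1 a b a0 _ => mmd2 b0 b1 a b a0).
have hI : (phi (u 0) <= phi (u s) + ((2^-1)%:E * G1 + (2^-1)%:E * M1))%E.
  apply: le_trans h _; apply: leeD2l.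
  (* The derivatives of [v] and [u] are compared only at positive times; the value +oo at the single
     point 0 makes the majorant trivial there. *)
  pose F x := (if x == 0%R then +oo else (2^-1)%:E * g (u x) ^+ 2 + (2^-1)%:E * md x ^+ 2)%E.
  apply: (@le_trans _ _ (\int[mu]_(x in `[0%R, s]) F x)%E).
    apply: ge0_le_integral_nomeas => x; rewrite /= in_itv/= => /andP[x0 xs].
      by rewrite mule_ge0 ?relaxed_slope_ge0 ?metric_deriv_ge0.
    rewrite /F; case: eqVneq => [_|xn0]; first by rewrite leey.
    have {xn0}x0 : 0 < x by rewrite lt_neqAle eq_sym xn0.
    have -> : v x = u x by rewrite /v max_l// ltW.
    apply: le_trans (young_sqre (relaxed_slope_ge0 _ _ _) (metric_deriv_ge0 d _ u x)).
    apply: lee_wpmul2l; first exact: relaxed_slope_ge0.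
    apply: (@metric_deriv_local _ _ _ _ _ _ _ _ x) => //; last by rewrite /v max_l// ltW.
    move=> y hy _; have y0 : 0 < y by move: hy; rewrite ltr_norml; lra.
    by rewrite /= in_itv/= (ltW y0) /v max_l// ltW.
  have mF : @measurable_fun _ _ (measurableTypeR R) _ `]0%R, s[%classic F.
    apply: (eq_measurable_fun (fun x => (2^-1)%:E * g (u x) ^+ 2 + (2^-1)%:E * md x ^+ 2)%E).
      move=> x; rewrite inE/= in_itv/= => /andP[x0 _].
      by rewrite /F gt_eqF.
    apply: emeasurable_funD; apply: measurable_funeM; first exact: mg.
    exact: mmd2.
  rewrite integral_itv_bndoo//.
  have -> : (\int[mu]_(x in `]0%R, s[) F x =
      \int[mu]_(x in `]0%R, s[) ((2^-1)%:E * g (u x) ^+ 2 + (2^-1)%:E * md x ^+ 2))%E.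
    by apply: eq_integral => x; rewrite inE/= in_itv/= => /andP[x0 _]; rewrite /F gt_eqF.
  have h2 : (0 <= (2^-1)%:E :> \bar R)%E by rewrite lee_fin.
  have m1 := mg false true 0 s (lexx _) st; have m2 := mmd2 false true 0 s (lexx _).
  rewrite ge0_integralD; [|exact: measurable_itv|by move=> x _; rewrite mule_ge0|
    exact: measurable_funeM|by move=> x _; rewrite mule_ge0|exact: measurable_funeM].
  by rewrite ge0_integralZl ?ge0_integralZl.
have := energy t0; move: hI hG hM.
have G10 : (0 <= G1)%E by apply: integral_ge0 => x _.
have M10 : (0 <= M1)%E by apply: integral_ge0 => x _.
have G20 : (0 <= \int[mu]_(x in `[s, t]) g (u x) ^+ 2)%E by apply: integral_ge0 => x _.
have M20 : (0 <= \int[mu]_(x in `[s, t]) md x ^+ 2)%E by apply: integral_ge0 => x _.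
rewrite -/G1 -/M1.
move: G1 M1 (\int[mu]_(x in `[s, t]) g (u x) ^+ 2)%E (\int[mu]_(x in `[s, t]) md x ^+ 2)%E
  (\int[mu]_(x in `[0%R, t]) g (u x) ^+ 2)%E (\int[mu]_(x in `[0%R, t]) md x ^+ 2)%E
  G10 M10 G20 M20 => G1 M1 G2 M2 G M G10 M10 G20 M20 hI hG hM hE.
have h20 : (0 < (2^-1)%:E :> \bar R)%E by rewrite lte_fin.
have hE2 : (phi (u t) + ((2^-1)%:E * (G1 + G2) + (2^-1)%:E * (M1 + M2)) <= phi (u 0))%E.
  by apply: le_trans hE; apply: leeD2l; apply: leeD; rewrite lee_pmul2l.
move: (phiNy (u t)) (phiNy (u s)) (phiNy (u 0)) phi0 hI hE2 {hE hG hM h}.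
case: (phi (u 0)) => [c| |] // + + _ _.
have P0 : (0 <= (2^-1)%:E * (G1 + G2) + (2^-1)%:E * (M1 + M2))%E.
  by rewrite adde_ge0// mule_ge0// ?adde_ge0// ltW.
case: (phi (u t)) => [p| |] // _; last first.
  by move=> _ _; rewrite leNgt addye ?ltry// gt_eqF// (lt_le_trans (ltNyr 0)).
case: (phi (u s)) => [q| |] // _; last by rewrite leey.
move=> hI hE.
have hP : ((2^-1)%:E * (G1 + G2) + (2^-1)%:E * (M1 + M2) <= (c - p)%:E)%E.
  by rewrite EFinB leeBrDr// [leLHS]addeC.
have GG : (G1 + G2 <= (2 * (c - p))%:E)%E.
  rewrite EFinM -lee_pdivrMl//; apply: le_trans hP; rewrite leeDl//.
  by rewrite mule_ge0 ?adde_ge0// ltW.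
have MM : (M1 + M2 <= (2 * (c - p))%:E)%E.
  rewrite EFinM -lee_pdivrMl//; apply: le_trans hP; rewrite leeDr//.
  by rewrite mule_ge0 ?adde_ge0// ltW.
have [x1 E1 _] := between_EFin G10 (le_trans (leeDl _ G20) GG).
have [x2 E2 _] := between_EFin G20 (le_trans (leeDr _ G10) GG).
have [x3 E3 _] := between_EFin M10 (le_trans (leeDl _ M20) MM).
have [x4 E4 _] := between_EFin M20 (le_trans (leeDr _ M10) MM).
move: hI hE; rewrite E1 E2 E3 E4 -!(EFinD, EFinM) !lee_fin; lra.
Qed.

End strong_upper_gradient_curve.

(** * Convergence of the scheme *)

Lemma le_limf_einf_at_right0 (R : realType) (X : \bar R) (f : R -> \bar R) :
  (forall (lam : R) (t : nat -> R), (forall n, 0 < t n) -> t @ \oo --> 0 ->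
    (forall n, (f (t n) <= lam%:E)%E) -> (X <= lam%:E)%E) ->
  (X <= limf_einf f 0^'+)%E.
Proof.
move=> h; rewrite leNgt; apply/negP => /lt_exists_EFin[lam h1 h2].
have /choice[t ht] : forall n : nat, exists t, [/\ 0 < t, t < n.+1%:R^-1 & (f t <= lam%:E)%E].
  move=> n; apply: contrapT => hn; move: h1; rewrite ltNge => /negP; apply.
  rewrite limf_einfE; pose W := [set t : R | 0 < t < n.+1%:R^-1].
  have hW : 0^'+ W.
    apply/at_right0P; exists n.+1%:R^-1; first by rewrite invr_gt0 ltr0n.
    by move=> t t0 tn; rewrite /W /= t0.
  apply: le_trans (ereal_sup_ubound (ex_intro2 _ _ W hW erefl)).
  apply: le_ereal_inf_tmp => _ [t /andP[t0 tn] <-].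
  by rewrite leNgt; apply/negP => /ltW ht; apply: hn; exists t.
have t0 n : 0 < t n by case: (ht n).
have tcv : t @ \oo --> 0.
  apply/cvgn0P => [n|e e0]; first exact: ltW.
  have [N hN] := lt_inv_natE e0; exists N => n /hN; case: (ht n) => _ hn _.
  exact: lt_trans.
have : (X <= lam%:E)%E by apply: (h lam t) => // n; case: (ht n).
by rewrite leNgt h2.
Qed.

Lemma cvg_at_right0_seq (R : realType) (f : R -> R) (t : nat -> R) :
  (forall n, 0 < t n) -> t @ \oo --> 0 -> f @ 0^'+ --> 0 -> (f \o t) @ \oo --> 0.
Proof.
move=> t0 /(cvgn0P (fun n => ltW (t0 n))) tcv /cvg_at_right0P fcv.
apply/cvgr0Pnorm_lt => e /fcv[r r0 hr]; have [N hN] := tcv _ r0.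
by exists N => // n /= Nn; apply: hr => //; exact: hN.
Qed.

(** * Passage to the limit in the slope term *)

Section slope_integral.
Variables (R : realType) (G : R -> \bar R) (tk : nat -> R) (D : nat -> nat -> R) (t : R).
Hypothesis t0 : 0 <= t.
Hypothesis G0 : forall s, (0 <= G s)%E.
Hypothesis tk0 : forall k, 0 < tk k.
Hypothesis D0 : forall k n, 0 <= D k n.
Hypothesis pointwise : forall s, 0 <= s -> s <= t -> forall (l : R) sg, extraction sg ->
  (forall k, D (sg k) (Num.truncn (s / tk (sg k))) <= l * tk (sg k)) ->
  ((2^-1)%:E * G s <= l%:E)%E.
Local Notation mu := (@lebesgue_measure R).

(** No measurability of [G] is available: it lies below the lower limit of the step functions [H k],
    to which Fatou's lemma is applied. The factor 2 in [H k] offsets the 1/2 in front of [G], so the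
    integral up to the last node is twice the sum of [D]. *)
Lemma integral_slope_le (lam : R) :
  (forall k, \sum_(0 <= n < interp_index (tk k) t) D k n <= lam) ->
  ((2^-1)%:E * \int[mu]_(s in `[0%R, t]) G s <= lam%:E)%E.
Proof.
move=> hlam; rewrite lee_pdivrMl//.
pose H k (s : R) := (step (tk k) (fun n => 2 * (D k n / tk k)) s)%:E.
have H0 k s : (0 <= H k s)%E by rewrite lee_fin /step mulr_ge0// divr_ge0// ltW.
have mH k (E : set (measurableTypeR R)) : measurable_fun E (H k).
  by apply/measurable_EFinP; apply: measurable_step.
apply: (@le_trans _ _ (\int[mu]_(s in `[0%R, t]) limn_einf (H^~ s))%E).
  apply: ge0_le_integral_nomeas => // s; rewrite /= in_itv/= => /andP[s0 st].
  apply: le_limn_einf_extraction => l sg hs hl.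
  have : ((2^-1)%:E * G s <= (2^-1 * l)%:E)%E.
    apply: (pointwise s0 st hs) => k.
    have := hl k; rewrite /H lee_fin /step -ler_pdivrMr//; lra.
  by rewrite EFinM lee_pmul2l// lte_fin.
apply: le_trans (fatou _ _ _ _) _ => //.
rewrite limn_einf_lim; apply: lime_le; first exact: is_cvg_einfs.
apply: nearW => k; apply: (@le_trans _ _ (\int[mu]_(s in `[0%R, t]) H k s)%E).
  by apply: ereal_inf_lbound; exists k => /=.
rewrite -integral_itv_bndo_bndc; last exact: mH.
have [h1 _] := interp_index_itv (tk0 k) t0.
apply: (@le_trans _ _ (\int[mu]_(s in `[0%R, ((interp_index (tk k) t)%:R * tk k)%R[) H k s)%E).
  by apply: ge0_subset_integral => //; apply: subset_itvl; rewrite bnd_simp.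
rewrite integral_step0//; last by move=> n; rewrite mulr_ge0// divr_ge0// ltW.
rewrite -EFinM lee_fin -mulr_sumr -mulr_suml.
have -> : tk k * (2 * ((\sum_(0 <= i < interp_index (tk k) t) D k i) / tk k)) =
    2 * \sum_(0 <= i < interp_index (tk k) t) D k i by field; rewrite gt_eqF.
by rewrite ler_wpM2l.
Qed.

End slope_integral.

(** The quotient on the cell of [s] belongs to the left node, while the interpolant takes the right
    one. The two indices agree or differ by one, and a single step has length O(sqrt tau). *)
Lemma left_interp_dist (R : realType) (S : Type) (d : S -> S -> R) (V : nat -> S) (tau s C : R) :
  metric_space d -> 0 < tau -> 0 <= s ->
  d (V (Num.truncn (s / tau))) (V (Num.truncn (s / tau)).+1) ^+ 2 <= C * tau -> 0 <= C ->
  d (V (Num.truncn (s / tau))) (pc_interp tau V s) ^+ 2 <= C * tau.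
Proof.
move=> hd tau0 s0 h C0; have [h1 h2] := truncn_div_itv tau0 s0.
have [h3 h4] := interp_index_itv tau0 s0.
rewrite /pc_interp -/(interp_index tau s).
set n := Num.truncn _ in h h1 h2 *; set i := interp_index _ _ in h3 h4 *.
have ni : (n <= i)%N by rewrite -(ler_nat R) -(ler_pM2r tau0); lra.
have inn : (i <= n.+1)%N.
  rewrite -ltnS -(ltr_nat R) -(ltr_pM2r tau0) -[n.+2%:R]natr1 mulrDl mul1r; lra.
move: inn; rewrite leq_eqVlt => /predU1P[->//|]; rewrite ltnS => inn.
have -> : i = n by apply/eqP; rewrite eqn_leq inn.
by rewrite (dist_xx hd) expr0n/= mulr_ge0// ltW.
Qed.

(** * The two assertions for a fixed choice of parameters *)

Section minimizing_movement.
Variables (R : realType) (S : Type) (d : S -> S -> R).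
Variables (phi : S -> \bar R) (phie : R -> S -> \bar R).
Variables (A B : R) (us : S).
Hypothesis hd : metric_space d.
Hypothesis dcomplete : complete_metric d.
Hypothesis phiNy : forall u, phi u != -oo%E.
Hypothesis B0 : 0 < B.
Hypothesis lb : forall e u, 0 < e -> ((- A - B * d u us ^+ 2)%:E <= phie e u)%E.
Hypothesis cpt : forall (en : nat -> R) (un : nat -> S),
  (forall n, 0 < en n) -> en @ \oo --> 0 ->
  (exists C : R, forall n m, (phie (en n) (un n) <= C%:E)%E /\ d (un n) (un m) <= C) ->
  exists (sg : nat -> nat) (v : S), (forall k, (sg k < sg k.+1)%N) /\
    (fun k => d (un (sg k)) v) @ \oo --> 0.
Hypothesis gliminf : forall (u : S) (ue : R -> S), (fun e => d (ue e) u) @ 0^'+ --> 0 ->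
  (phi u <= limf_einf (fun e => phie e (ue e)) 0^'+)%E.
Hypothesis recov : forall u : S, exists ue : R -> S,
  (fun e => d (ue e) u) @ 0^'+ --> 0 /\
  (fun e => phie e (ue e)) @ 0^'+ --> phi u.
Variables (eT eps : R -> R).
Hypothesis heT : forall t, 0 < t -> t * (4 * B + 2) <= 1 -> forall e w, 0 < e -> e <= eT t ->
  (phie e w <= (t^-1)%:E)%E -> d w us <= t^-1 ->
  exists w', [/\ d w w' <= t, (phi w' <= phie e w + (t ^+ 2)%:E)%E &
    (yosida d t (phie e) w <= yosida d t phi w' + (t ^+ 2)%:E)%E].
Hypothesis heps : forall tau, 0 < tau -> 0 < eps tau <= eT tau.
Hypothesis epscv : eps @ 0^'+ --> 0.

Let slope_le (tau e : nat -> R) (un : nat -> S) (u : S) (C lam : R) :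
  (forall n, 0 < tau n) -> tau @ \oo --> 0 -> (forall n, 0 < e n <= eT (tau n)) ->
  (fun n => d (un n) u) @ \oo --> 0 -> (forall n, (phie (e n) (un n) <= C%:E)%E) ->
  (forall n, (phie (e n) (un n) <=
    yosida d (tau n) (phie (e n)) (un n) + (lam * tau n)%:E)%E) ->
  ((2^-1)%:E * relaxed_slope d phi u ^+ 2 <= lam%:E)%E.
Proof. exact: relaxed_slope_le_seq hd B0 lb cpt gliminf recov _ _ _ _ _ _ _ heT. Qed.

Lemma yosida_slope_liminf (u : S) (ut : R -> S) :
  (fun tau => d (ut tau) u) @ 0^'+ --> 0 ->
  (exists C : R, forall tau, 0 < tau ->
     (phie (eps tau) (ut tau) <= C%:E)%E /\ d (ut tau) u <= C) ->
  ((2^-1)%:E * relaxed_slope d phi u ^+ 2 <=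
   limf_einf (fun tau => (phie (eps tau) (ut tau)
               - yosida d tau (phie (eps tau)) (ut tau)) * (tau^-1)%:E) 0^'+)%E.
Proof.
move=> ucv [C hC]; apply: le_limf_einf_at_right0 => lam t t0 tcv hlam.
apply: (slope_le (C := C) t0 tcv (fun n => heps (t0 n)) (un := ut \o t)) => [|n|n].
- exact: (cvg_at_right0_seq t0 tcv ucv).
- exact: (hC _ (t0 n)).1.
have [e0 _] := andP (heps (t0 n)).
have hY := yosida_le_self hd (phie (eps (t n))) (t n) (ut (t n)).
have [c Ec _] := between_EFin (lb (ut (t n)) e0) (hC _ (t0 n)).1.
have := hlam n; move: hY; rewrite /= Ec lee_pdivrMr//.
case: (yosida _ _ _ _) => [y| |] // _; rewrite -?(EFinB, EFinM, EFinD) !lee_fin; lra.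
Qed.

Section scheme.
Variables (u0 : S) (c0 : R) (U : R -> nat -> S) (gam : R -> R).
Hypothesis Ec0 : phi u0 = c0%:E.
Hypothesis Ucv : (fun tau => d (U tau 0%N) u0) @ 0^'+ --> 0.
Hypothesis Fcv : (fun tau => phie (eps tau) (U tau 0%N)) @ 0^'+ --> phi u0.
Hypothesis gam0 : forall tau, 0 < tau -> 0 < gam tau.
Hypothesis gamcv : gam @ 0^'+ --> 0.
Hypothesis Ustep : forall tau (n : nat), 0 < tau -> (0 < n)%N ->
  (phie (eps tau) (U tau n) + (d (U tau n) (U tau n.-1) ^+ 2 / (2 * tau))%:E
   <= yosida d tau (phie (eps tau)) (U tau n.-1) + (gam tau * tau)%:E)%E.

Let F tau n := fine (phie (eps tau) (U tau n)).
Let Y tau n := fine (yosida d tau (phie (eps tau)) (U tau n)).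

Lemma scheme_start : exists2 t1, 0 < t1 & forall tau, 0 < tau -> tau < t1 ->
  [/\ d (U tau 0%N) u0 <= 1, (phie (eps tau) (U tau 0%N) <= (c0 + 1)%:E)%E, gam tau <= 1,
      16 * B * tau <= 1 & tau <= 1].
Proof.
have [r1 r10 h1] := (cvg_at_right0P _).1 Ucv 1 ltr01.
have [r2 r20 h2] := (cvg_at_right0P _).1 gamcv 1 ltr01.
have /at_right0P[r3 r30 h3] : \forall tau \near 0^'+,
    (phie (eps tau) (U tau 0%N) < (c0 + 1)%:E)%E.
  have /Fcv : nbhs (phi u0) [set x | (x < (c0 + 1)%:E)%E]; last by [].
  apply: open_nbhs_nbhs; split; first exact: open_ereal_lt_ereal.
  by rewrite /= Ec0 lte_fin; lra.
have B16 : 0 < 16 * B by rewrite mulr_gt0.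
exists (Num.min (Num.min r1 r2) (Num.min r3 (Num.min 1 (16 * B)^-1))).
  by rewrite !lt_min r10 r20 r30 ltr01 invr_gt0.
move=> tau tau0; rewrite !lt_min => /andP[/andP[k1 k2] /and3P[k3 k4 k5]]; split.
- by apply: ltW; apply: le_lt_trans (ler_norm _) (h1 _ tau0 k1).
- by apply: ltW; exact: h3.
- by apply: ltW; apply: le_lt_trans (ler_norm _) (h2 _ tau0 k2).
- by rewrite mulrC -ler_pdivlMr// div1r ltW.
- exact: ltW.
Qed.

(** Finiteness propagates along the scheme: each energy exceeds the previous one by at most gam tau,
    and the scheme inequality itself keeps the Yosida value away from -oo. *)
Lemma scheme_fin tau : 0 < tau -> (phie (eps tau) (U tau 0%N) <= (c0 + 1)%:E)%E ->
  forall n, [/\ phie (eps tau) (U tau n) = (F tau n)%:E,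
    yosida d tau (phie (eps tau)) (U tau n) = (Y tau n)%:E, Y tau n <= F tau n &
    F tau n.+1 + d (U tau n) (U tau n.+1) ^+ 2 / (2 * tau) <= Y tau n + gam tau * tau].
Proof.
move=> tau0 h0; have [e0 _] := andP (heps tau0).
have lbU n := lb (U tau n) e0.
have FE n : phie (eps tau) (U tau n) = (F tau n)%:E.
  elim: n => [|n IH]; first by rewrite /F; have [c -> _] := between_EFin (lbU 0%N) h0.
  have := Ustep tau0 (ltn0Sn n); rewrite /= => h.
  have : (phie (eps tau) (U tau n.+1) <= (F tau n + gam tau * tau)%:E)%E.
    rewrite EFinD -IH; apply: le_trans (leeD2r _ (yosida_le_self hd _ _ _)).
    apply: le_trans h; rewrite leeDl// lee_fin divr_ge0 ?sqr_ge0//.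
    by rewrite mulr_ge0// ltW.
  by move=> /(between_EFin (lbU n.+1))[c Ec _]; rewrite /F Ec.
have YE n : yosida d tau (phie (eps tau)) (U tau n) = (Y tau n)%:E.
  have := yosida_le_self hd (phie (eps tau)) tau (U tau n).
  have := Ustep tau0 (ltn0Sn n); rewrite /Y /= !FE.
  by case: (yosida _ _ _ _).
move=> n; split=> //.
  by rewrite -lee_fin -FE -YE; exact: yosida_le_self.
have := Ustep tau0 (ltn0Sn n); rewrite /= FE YE -!EFinD lee_fin.
by rewrite (distC hd (U tau n.+1)).
Qed.

Theorem scheme_converges :
  exists (tk : nat -> R) (u : R -> S),
    [/\ ((forall k, 0 < tk k) /\ (forall k, tk k.+1 < tk k) /\ tk @ \oo --> 0),
        loc_abs_cont d u,
        (forall t, 0 <= t ->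
           (fun k => d (pc_interp (tk k) (U (tk k)) t) (u t)) @ \oo --> 0),
        u 0 = u0 &
        ((forall t, 0 <= t ->
           (phi (u t)
            + ((2^-1)%:E * \int[lebesgue_measure]_(s in `[0%R, t])
                              relaxed_slope d phi (u s) ^+ 2
               + (2^-1)%:E * \int[lebesgue_measure]_(s in `[0%R, t])
                              metric_deriv d `[0%R, +oo[%classic u s ^+ 2)
            <= phi (u 0%R))%E) /\
        (strong_upper_gradient d phi (relaxed_slope d phi) ->
           curve_max_slope d phi u))].
Proof.
have [t1 t10 ht1] := scheme_start.
have bounds T : exists2 C, 0 <= C & forall tau, 0 < tau -> tau < t1 -> forall N, N%:R * tau <= T ->
    [/\ F tau N <= C, d (U tau N) us <= C &
      \sum_(0 <= n < N) d (U tau n) (U tau n.+1) ^+ 2 / tau <= C].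
  have [C hC] := @scheme_bounds R S d A B us T (c0 + 1) (d u0 us + 1) hd B0.
  exists `|C| => // tau tau0 taut1 N NT.
  have [k1 k2 k3 k4 k5] := ht1 _ tau0 taut1; have hf := scheme_fin tau0 k2.
  have [e0 _] := andP (heps tau0).
  have [|||||h1 h2 h3] := hC tau (gam tau) (U tau) (F tau) (Y tau) tau0 k4 k3 _ _ _ _ _ N NT.
  - by move=> n; case: (hf n).
  - by move=> n; case: (hf n).
  - by move=> n; rewrite -lee_fin; case: (hf n) => <- _ _ _; exact: lb.
  - by rewrite -lee_fin; case: (hf 0%N) => <- _ _ _.
  - by have := dist_triangle hd (U tau 0%N) u0 us; lra.
  by have := ler_norm C; split; lra.
(* Denominators starting at 2 keep every [tn n] strictly below [t1]; the strict decrease survives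
   extraction. *)
pose tn (n : nat) : R := t1 / n.+2%:R.
have tn0 n : 0 < tn n by rewrite divr_gt0.
have tnt1 n : tn n < t1.
  by rewrite /tn ltr_pdivrMr// ltr_pMr// ltr1n.
have tndec n : tn n.+1 < tn n.
  by rewrite /tn ltr_pM2l// ltf_pV2 ?posrE// ltr_nat.
have tncv : tn @ \oo --> 0.
  apply/cvgn0P => [n|e e0]; first exact: ltW.
  have [N hN] := lt_inv_natE (divr_gt0 e0 t10); exists N => n /leqW /hN.
  by rewrite ltr_pdivlMr// mulrC.
have tn1 n : tn n <= 1 by case: (ht1 _ (tn0 n) (tnt1 n)).
have index_le (tau t T : R) : 0 < tau -> tau <= 1 -> 0 <= t -> t <= T ->
    (interp_index tau t)%:R * tau <= T + 1.
  by move=> tau0 tau1 t0 tT; have [_ h] := interp_index_itv tau0 t0; lra.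
have eps0 tau : 0 < tau -> 0 < eps tau by move=> /heps/andP[].
have FE tau n : 0 < tau -> tau < t1 -> phie (eps tau) (U tau n) = (F tau n)%:E.
  by move=> a b; have [_ k2 _ _ _] := ht1 _ a b; case: (scheme_fin a k2 n).
have [sg hs hsg] : exists2 sg, extraction sg & forall i, exists v,
    (fun k => d (pc_interp (tn (sg k)) (U (tn (sg k))) (nnrat_seq R i)) v) @ \oo --> 0.
  apply: (diagonal_interp (V := fun n => U (tn n)) hd) => t sg t0 hs.
  have [C C0 hC] := bounds (t + 1).
  have hn n := hC _ (tn0 (sg n)) (tnt1 (sg n)) _ (index_le _ _ _ (tn0 (sg n)) (tn1 (sg n)) t0 (lexx t)).
  have ecv : (fun n => eps (tn (sg n))) @ \oo --> 0.
    exact: (cvgn0_extraction hs (cvg_at_right0_seq tn0 tncv epscv)).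
  have [|sg' [v [hs' hv]]] := @cpt (fun n => eps (tn (sg n)))
      (fun n => pc_interp (tn (sg n)) (U (tn (sg n))) t) (fun n => eps0 _ (tn0 _)) ecv.
    exists (2 * C) => n m; have [a1 a2 _] := hn n; have [_ b2 _] := hn m; split.
      by rewrite /pc_interp FE// lee_fin -/(interp_index _ _); lra.
    have := dist_triangle hd (pc_interp (tn (sg n)) (U (tn (sg n))) t) us
      (pc_interp (tn (sg m)) (U (tn (sg m))) t).
    by rewrite (distC hd us) /pc_interp -!/(interp_index _ _); lra.
  by exists sg' => //; exists v.
pose tk k := tn (sg k).
have tk0 k : 0 < tk k by exact: tn0.
have tkt1 k : tk k < t1 by exact: tnt1.
have tk1 k : tk k <= 1 by exact: tn1.
have tkcv : tk @ \oo --> 0 by exact: cvgn0_extraction hs tncv.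
have tkdec k : tk k.+1 < tk k.
  suff h a b : (a < b)%N -> tn b < tn a by apply: h; exact: hs.
  elim: b => // b IH; rewrite ltnS leq_eqVlt => /predU1P[->//|/IH]; exact: lt_trans.
pose V k := U (tk k).
have tbound T : exists C, forall k N, N%:R * tk k <= T ->
    \sum_(0 <= n < N) d (V k n) (V k n.+1) ^+ 2 / tk k <= C.
  by have [C _ hC] := bounds T; exists C => k N h; case: (hC _ (tk0 k) (tkt1 k) N h).
have /choice[u hu] : forall t, exists v, 0 <= t ->
    (fun k => d (pc_interp (tk k) (V k) t) v) @ \oo --> 0.
  move=> t; have [t0|] := leP 0 t; last by exists u0.
  have [v hv] := interp_cvg_dense hd tk0 tkcv dcomplete tk1 tbound
    (@nnrat_seq_ge0 R) (@nnrat_seq_dense R) hsg t0.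
  by exists v.
have u00 : u 0 = u0.
  apply: (dist_cvg_unique hd (hu 0 (lexx _))).
  have -> : (fun k => d (pc_interp (tk k) (V k) 0) u0) = (fun k => d (U (tk k) 0%N) u0).
    by apply/funext => k; rewrite /pc_interp mul0r ceil0.
  exact: (cvg_at_right0_seq tk0 tkcv Ucv).
have hcont T : exists2 C, 0 < C & forall s t, 0 <= s -> s <= t -> t <= T ->
    d (u s) (u t) ^+ 2 <= C * (t - s).
  by apply: (interp_holder_limit hd tk0 tkcv tk1 tbound) => t t0 _; exact: hu.
have henergy T : 0 < T -> exists K, forall n, polygon_energy d u T n <= K.
  move=> T0; have [C hC] := tbound (T + 1); exists C.
  apply: (limit_polygon_energy_le hd tk0 tkcv T0 (u := u)) => [t t0' _|k]; first exact: hu.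
  by apply: hC; apply: index_le => //; exact: ltW.
have mmd := measurable_speed hd hcont.
have [m [m0 im hm]] := speed_density hd hcont henergy.
have energy t : 0 <= t -> (phi (u t)
      + ((2^-1)%:E * \int[lebesgue_measure]_(s in `[0%R, t]) relaxed_slope d phi (u s) ^+ 2
         + (2^-1)%:E * \int[lebesgue_measure]_(s in `[0%R, t])
                          metric_deriv d `[0%R, +oo[%classic u s ^+ 2) <= phi (u 0%R))%E.
  (* At time 0 both integrals vanish; the dyadic estimates require a positive horizon. *)
  rewrite le_eqVlt => /predU1P[<-|t0].
    by rewrite set_itv1 !integral_set1 !mule0 !adde0.
  have t0' := ltW t0; rewrite u00 Ec0.
  pose N k := interp_index (tk k) t.
  have hN k : (N k)%:R * tk k <= t + 1 by exact: index_le.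
  pose D k n := F (tk k) n - Y (tk k) n.
  have D0 k n : 0 <= D k n.
    have [_ k2 _ _ _] := ht1 _ (tk0 k) (tkt1 k).
    by rewrite subr_ge0; case: (scheme_fin (tk0 k) k2 n).
  have tsg_cv (f : R -> R) sg' : extraction sg' -> f @ 0^'+ --> 0 ->
      (fun k => f (tk (sg' k))) @ \oo --> 0.
    by move=> hs' hf; exact: (cvgn0_extraction hs' (cvg_at_right0_seq tk0 tkcv hf)).
  (* In the error term, [t + 1] bounds the duration [N k * tk k] of the discrete trajectory. *)
  apply: (@liminf3_le _ _ _ _ (fun k => F (tk k) (N k))
    (fun k => \sum_(0 <= n < N k) D k n)
    (fun k => \sum_(0 <= n < N k) d (V k n) (V k n.+1) ^+ 2 / (2 * tk k))
    (fun k => F (tk k) 0%N + gam (tk k) * (t + 1))) => //.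
  - apply: mule_ge0; first by rewrite lee_fin.
    by apply: integral_ge0 => s _; apply: sqre_ge0; exact: relaxed_slope_ge0.
  - apply: mule_ge0; first by rewrite lee_fin.
    by apply: integral_ge0 => s _; apply: sqre_ge0; exact: metric_deriv_ge0.
  - move=> lam sg' hs' hlam.
    apply: (gamma_liminf_seq hd gliminf (en := fun k => eps (tk (sg' k)))
      (vn := fun k => pc_interp (tk (sg' k)) (V (sg' k)) t)).
    + by move=> k; exact: eps0.
    + exact: tsg_cv.
    + exact: (cvgn0_extraction hs' (hu t t0')).
    + by move=> k; rewrite /pc_interp FE// lee_fin; exact: hlam.
  - move=> lam sg' hs' hlam.
    apply: (integral_slope_le (tk := tk \o sg') (D := D \o sg') t0') => //.
    + by move=> s; apply: sqre_ge0; exact: relaxed_slope_ge0.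
    + by move=> k; exact: tk0.
    + by move=> k n; exact: D0.
    (* The first assertion is used at the left nodes [U (ta k) (n_ k)], where the scheme evaluates
       the quotient; these nodes must be shown to converge to [u s] like the interpolants. *)
    move=> s s0 st l sg2 hs2 hl.
    pose ta k := tk (sg' (sg2 k)); pose n_ k := Num.truncn (s / ta k).
    have [C C0 hC] := bounds (t + 1).
    have ta0 k : 0 < ta k by exact: tk0.
    have nb k : (n_ k).+1%:R * ta k <= t + 1.
      have [h1 _] := truncn_div_itv (ta0 k) s0; have := tk1 (sg' (sg2 k)).
      by rewrite -natr1 mulrDl mul1r -/(ta k); lra.
    have nb' k : (n_ k)%:R * ta k <= t + 1.
      by apply: le_trans (nb k); rewrite ler_wpM2r ?(ltW (ta0 k))// ler_nat.
    have hs22 := extraction_comp hs' hs2.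
    have tacv : ta @ \oo --> 0 by exact: (cvgn0_extraction hs22 tkcv).
    have pcv : (fun k => d (pc_interp (ta k) (U (ta k)) s) (u s)) @ \oo --> 0.
      exact: (cvgn0_extraction hs22 (hu s s0)).
    have close k : d (U (ta k) (n_ k)) (pc_interp (ta k) (U (ta k)) s) ^+ 2 <= C * ta k.
      apply: left_interp_dist => //; rewrite -/(n_ k).
      have [_ _ ] := hC _ (ta0 k) (tkt1 _) _ (nb k).
      rewrite big_nat_recr//= => h; rewrite -ler_pdivrMr//; apply: le_trans h.
      by rewrite lerDr sumr_ge0// => i _; rewrite divr_ge0 ?sqr_ge0// ltW.
    have ncv : (fun k => d (U (ta k) (n_ k)) (u s)) @ \oo --> 0.
      apply/(dist_cvgP hd) => e e0; have e20 : 0 < e / 2 by lra.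
      have C10 : 0 < C + 1 by lra.
      have [N1 hN1] := (dist_cvgP hd _ _).1 pcv _ e20.
      have [N2 hN2] := (cvgn0P (fun n => ltW (ta0 n))).1 tacv _
        (divr_gt0 (exprn_gt0 2 e20) C10).
      exists (maxn N1 N2) => k; rewrite geq_max => /andP[/hN1 h1 /hN2].
      rewrite ltr_pdivlMr// => h2.
      have h3 : d (U (ta k) (n_ k)) (pc_interp (ta k) (U (ta k)) s) < e / 2.
        rewrite -(@ltr_pXn2r _ 2)// ?nnegrE ?(dist_ge0 hd) ?(ltW e20)//.
        by apply: le_lt_trans (close k) _; have := ta0 k; lra.
      by have := dist_triangle hd (U (ta k) (n_ k)) (pc_interp (ta k) (U (ta k)) s) (u s); lra.
    apply: (slope_le (C := C) (e := fun k => eps (ta k)) ta0 tacv (fun k => heps (ta0 k)) ncv).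
    + by move=> k; rewrite FE ?tkt1// lee_fin; case: (hC _ (ta0 k) (tkt1 _) _ (nb' k)).
    + move=> k; have [_ k2 _ _ _] := ht1 _ (ta0 k) (tkt1 _).
      have [-> -> _ _] := scheme_fin (ta0 k) k2 (n_ k).
      by rewrite -EFinD lee_fin; have := hl k; rewrite /D /= -/(ta k) -/(n_ k); lra.
  - move=> lam sg' hs' hlam; rewrite lee_pdivrMl//.
    (* The kinetic sums have [2 * tk] in the denominator, whence [2 * lam]. They are bounded along
       the given extraction only, but the limit curve is the same there. *)
    have hK : forall n, polygon_energy d u t n <= 2 * lam.
      apply: (@limit_polygon_energy_le _ _ _ hd (tk \o sg') (V \o sg')) => //.
      + by move=> k; exact: tk0.
      + exact: cvgn0_extraction hs' tkcv.
      + by move=> s s0 _; exact: (cvgn0_extraction hs' (hu s s0)).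
      move=> k; have := hlam k => h.
      have -> : \sum_(0 <= n < interp_index ((tk \o sg') k) t)
          d ((V \o sg') k n) ((V \o sg') k n.+1) ^+ 2 / (tk \o sg') k =
          2 * \sum_(0 <= n < N (sg' k)) d (V (sg' k) n) (V (sg' k) n.+1) ^+ 2 / (2 * tk (sg' k)).
        rewrite mulr_sumr; apply: eq_bigr => i _ /=; field; rewrite gt_eqF//.
      by rewrite ler_wpM2l.
    have [h _] := speed_energy hd t0 (@holder_continuous _ _ _ hd u hcont t) hK mmd.
    by rewrite -EFinM.
  - move=> k; have [_ k2 _ _ _] := ht1 _ (tk0 k) (tkt1 k).
    have hf := scheme_fin (tk0 k) k2.
    have := @discrete_energy R S d (tk k) (gam (tk k)) (V k) (F (tk k)) (Y (tk k))
      (fun n => let: And4 _ _ _ h := hf n in h) (N k).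
    have : gam (tk k) * ((N k)%:R * tk k) <= gam (tk k) * (t + 1).
      by rewrite ler_wpM2l// ltW// gam0.
    by rewrite /D; lra.
  - rewrite -[c0]addr0; apply: cvgD.
      have : (fun k => phie (eps (tk k)) (U (tk k) 0%N)) @ \oo --> c0%:E.
        rewrite -Ec0; apply: cvg_trans Fcv => P /= /at_right0P[r r0 hr].
        have [M hM] := (cvgn0P (fun n => ltW (tk0 n))).1 tkcv _ r0.
        by exists M => // k /= Mk; apply: hr => //; exact: hM.
      by move=> /fine_cvgP[].
    rewrite -[X in _ --> X](mul0r (t + 1)); apply: cvgM; last exact: cvg_cst.
    exact: (cvg_at_right0_seq tk0 tkcv gamcv).
exists tk, u; split => //.
  exact: density_loc_abs_cont im hm.
split=> //; apply: (sug_curve_max_slope hd phiNy _ m0 im hm mmd energy).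
by rewrite u00 Ec0 ltry.
Qed.

End scheme.
End minimizing_movement.

Theorem theorem6p1 (R : realType) (S : Type) (d : S -> S -> R)
  (phi : S -> \bar R) (phie : R -> S -> \bar R) :
  metric_space d -> complete_metric d -> separable_metric d ->
  (* values in (-oo, +oo] *)
  (forall u, phi u != -oo%E) ->
  (forall e u, 0 < e -> phie e u != -oo%E) ->
  (* uniform quadratic lower bound *)
  (exists (A B : R) (ustar : S), 0 < A /\ 0 < B /\
     forall e u, 0 < e -> ((- A - B * d u ustar ^+ 2)%:E <= phie e u)%E) ->
  (* compactness *)
  (forall (en : nat -> R) (un : nat -> S),
     (forall n, 0 < en n) -> en @ \oo --> 0 ->
     (exists C : R, forall n m, (phie (en n) (un n) <= C%:E)%E /\ d (un n) (un m) <= C) ->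
     exists (sg : nat -> nat) (v : S), (forall k, (sg k < sg k.+1)%N) /\
       (fun k => d (un (sg k)) v) @ \oo --> 0) ->
  (* Gamma-liminf inequality *)
  (forall (u : S) (ue : R -> S), (fun e => d (ue e) u) @ 0^'+ --> 0 ->
     (phi u <= limf_einf (fun e => phie e (ue e)) 0^'+)%E) ->
  (* recovery sequences *)
  (forall u : S, exists ue : R -> S,
     (fun e => d (ue e) u) @ 0^'+ --> 0 /\
     (fun e => phie e (ue e)) @ 0^'+ --> phi u) ->
  exists epsT : R -> R, (forall tau, 0 < tau -> 0 < epsT tau) /\
  forall eps : R -> R,
    (forall tau, 0 < tau -> 0 < eps tau <= epsT tau) ->
    eps @ 0^'+ --> 0 ->
    (* first assertion *)
    (forall (u : S) (ut : R -> S),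
       (fun tau => d (ut tau) u) @ 0^'+ --> 0 ->
       (exists C : R, forall tau, 0 < tau ->
          (phie (eps tau) (ut tau) <= C%:E)%E /\ d (ut tau) u <= C) ->
       ((2^-1)%:E * relaxed_slope d phi u ^+ 2 <=
        limf_einf (fun tau => (phie (eps tau) (ut tau)
                    - yosida d tau (phie (eps tau)) (ut tau)) * (tau^-1)%:E) 0^'+)%E)
    /\
    (* second assertion: convergence of the minimizing-movement scheme *)
    (forall (u0 : S) (U : R -> nat -> S) (gam : R -> R),
       (phi u0 < +oo)%E ->
       (fun tau => d (U tau 0%N) u0) @ 0^'+ --> 0 ->
       (fun tau => phie (eps tau) (U tau 0%N)) @ 0^'+ --> phi u0 ->
       (forall tau, 0 < tau -> 0 < gam tau) ->
       gam @ 0^'+ --> 0 ->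
       (forall tau (n : nat), 0 < tau -> (0 < n)%N ->
          (phie (eps tau) (U tau n) + (d (U tau n) (U tau n.-1) ^+ 2 / (2 * tau))%:E
           <= yosida d tau (phie (eps tau)) (U tau n.-1) + (gam tau * tau)%:E)%E) ->
       exists (tk : nat -> R) (u : R -> S),
         [/\ ((forall k, 0 < tk k) /\ (forall k, tk k.+1 < tk k) /\ tk @ \oo --> 0),
             loc_abs_cont d u,
             (forall t, 0 <= t ->
                (fun k => d (pc_interp (tk k) (U (tk k)) t) (u t)) @ \oo --> 0),
             u 0 = u0 &
             ((forall t, 0 <= t ->
                (phi (u t)
                 + ((2^-1)%:E * \int[lebesgue_measure]_(s in `[0%R, t])
                                   relaxed_slope d phi (u s) ^+ 2
                    + (2^-1)%:E * \int[lebesgue_measure]_(s in `[0%R, t])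
                                   metric_deriv d `[0%R, +oo[%classic u s ^+ 2)
                 <= phi (u 0%R))%E) /\
             (strong_upper_gradient d phi (relaxed_slope d phi) ->
                curve_max_slope d phi u))]).
Proof.
move=> hd dcomplete _ phiNy _ [A [B [us [_ [B0 lb]]]]] cpt gliminf recov.
(* Outside the range of small positive [tau] the threshold is set to 1: the slope estimate is used
   only along parameters tending to 0. *)
have /choice[eT heT] : forall tau : R, exists e, 0 < e /\ (0 < tau -> tau * (4 * B + 2) <= 1 ->
    forall e' w, 0 < e' -> e' <= e -> (phie e' w <= (tau^-1)%:E)%E -> d w us <= tau^-1 ->
    exists w', [/\ d w w' <= tau, (phi w' <= phie e' w + (tau ^+ 2)%:E)%E &
      (yosida d tau (phie e') w <= yosida d tau phi w' + (tau ^+ 2)%:E)%E]).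
  move=> tau; have [tau0|tau0] := ltP 0 tau; last by exists 1.
  have [tauB|tauB] := leP (tau * (4 * B + 2)) 1; last by exists 1.
  by have [e e0 he] := gamma_yosida_close hd B0 lb cpt gliminf recov tau0 tauB; exists e.
exists eT; split=> [tau _|eps heps epscv]; first by case: (heT tau).
have {}heT t t0 tB := (heT t).2 t0 tB.
split=> [u ut|u0 U gam phi0 Ucv Fcv gam0 gamcv Ustep].
  exact: (yosida_slope_liminf hd B0 lb cpt gliminf recov heT heps).
have [c0 Ec0] : exists c0, phi u0 = c0%:E.
  by move: (phiNy u0) phi0; case: (phi u0) => [c| |] // _ _; exists c.
exact: (scheme_converges hd dcomplete phiNy B0 lb cpt gliminf recov heT heps epscv
  Ec0 Ucv Fcv gam0 gamcv Ustep).
Qed.
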